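(* Let $\mathbf X_n\sim\mathcal U(\mathcal M_n^{\mathbb T})$ and, for fixed $k$, let $\mathbf X_n^k$ denote the projection of $\mathbf X_n$ onto the first $k$ coordinates. Then as $n\to\infty$, $$\sqrt{2pn}\,\mathbf X_n^k\longrightarrow\mathcal G_k\quad\text{in distribution},$$ where $\mathcal G_k=(G_1,\dots,G_k)$ and $G_1,\dots,G_k$ are i.i.d. random matrices of the complex Ginibre ensemble, i.e. having density $g(G)=\pi^{-p^2}\exp(-\|G\|^2)$ with respect to the Lebesgue measure on $\mathbb C^{p\times p}$.
   Context: Fix an integer $p\ge1$. $\|G\|=\mathrm{tr}(G^*G)^{1/2}$. Lebesgue measure on $\mathbb C^{p\times p}$ is $dX=\prod_{1\le i,j\le p}d\,\mathrm{Re}(x_{ij})\,d\,\mathrm{Im}(x_{ij})$. Let $\mathcal P(\mathbb T)$ be the set of nonnegative-Hermitian-$p\times p$-matrix-valued measures $\mu$ on the unit circle $\mathbb T$ with $\mu(\mathbb T)=I_p$, $\Gamma_j(\mu)=\int_{-\pi}^{\pi}e^{ij\theta}d\mu(\theta)$, and $\mathcal M_n^{\mathbb T}=\{(\Gamma_1(\mu),\dots,\Gamma_n(\mu)):\mu\in\mathcal P(\mathbb T)\}\subset(\mathbb C^{p\times p})^n$, compact with nonempty interior. $\mathcal U(\mathcal M_n^{\mathbb T})$ is the uniform distribution on $\mathcal M_n^{\mathbb T}$ with respect to $d\Gamma_1\cdots d\Gamma_n$. *)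

(* Defs.v *)
From HB Require Import structures.
From mathcomp Require Import all_boot all_order all_algebra.
From mathcomp Require Import spectral sesquilinear.
From mathcomp.real_closed Require Import complex.
From mathcomp Require Import all_classical all_reals all_analysis.

Set Implicit Arguments.
Unset Strict Implicit.
Unset Printing Implicit Defensive.

Import Order.TTheory GRing.Theory Num.Theory.
Import numFieldNormedType.Exports.

Local Open Scope classical_set_scope.
Local Open Scope ring_scope.
Local Open Scope sesquilinear_scope.

(* [numFieldTopology] provides the topology given by the modulus only on the
   alias [R[i]^o]. *)
HB.instance Definition _ (R : rcfType) := PseudoPointedMetric.copy R[i] R[i]^o.

Lemma sigma_algebra_measurable_preimage d (T' : measurableType d) (T : Type)
    (f : T -> T') :
  sigma_algebra setT (preimage_set_system setT f (@measurable _ T')).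
Proof. exact/sigma_algebra_preimage/sigma_algebra_measurable. Qed.

(* The sigma-algebra of [R[i]] is the Borel one, written as the inverse image of
   the Borel sigma-algebra of [R * R] by [z |-> (Re z, Im z)]. *)
Definition complex_display : measure_display. Proof. exact. Qed.

Definition complex_pair (R : realType) (z : R[i]) :
  measurableTypeR R * measurableTypeR R := (complex.Re z, complex.Im z).

Definition pair_complex (R : realType)
  (x : measurableTypeR R * measurableTypeR R) : R[i] := Complex x.1 x.2.

Section measurable_complex.
Variable R : realType.

Let measurable_complex :=
  sigma_algebra_measurable_preimage (@complex_pair R).

Let complex_setC (A : set R[i]) :
  preimage_set_system setT (@complex_pair R) measurable A ->
  preimage_set_system setT (@complex_pair R) measurable (~` A).
Proof. by move=> mA; rewrite -setTD; case: measurable_complex => _ + _; exact. Qed.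

HB.instance Definition _ := @isMeasurable.Build complex_display R[i]
  (preimage_set_system setT (@complex_pair R) measurable)
  (let: And3 h _ _ := measurable_complex in h) complex_setC
  (let: And3 _ _ h := measurable_complex in h).

End measurable_complex.

Lemma measurable_complex_pair (R : realType) :
  measurable_fun setT (@complex_pair R).
Proof. by move=> _ A mA; exists A. Qed.

Lemma measurable_pair_complex (R : realType) :
  measurable_fun setT (@pair_complex R).
Proof.
move=> _ _ [A mA <-]; rewrite !setTI -comp_preimage.
by rewrite (_ : _ \o _ = id) ?preimage_id//; apply/funext => -[].
Qed.

Lemma pair_complexK (R : realType) : cancel (@pair_complex R) (@complex_pair R).
Proof. by case. Qed.

Definition circle (R : realType) : Type := set_type [set z : R[i] | `|z| = 1].

Definition circle_val (R : realType) : circle R -> R[i] := set_val.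

Definition circle1 (R : realType) : circle R :=
  exist _ 1 (mem_set (normr1 R[i] : [set z : R[i] | `|z| = 1] 1)).

(* The Borel sigma-algebra of the unit circle, trace of that of [R[i]]. *)
Definition circle_display : measure_display. Proof. exact. Qed.

Section measurable_circle.
Variable R : realType.

HB.instance Definition _ := Choice.on (circle R).
HB.instance Definition _ := isPointed.Build (circle R) (circle1 R).

Let measurable_circle := sigma_algebra_measurable_preimage (@circle_val R).

Let circle_setC (A : set (circle R)) :
  preimage_set_system setT (@circle_val R) measurable A ->
  preimage_set_system setT (@circle_val R) measurable (~` A).
Proof. by move=> mA; rewrite -setTD; case: measurable_circle => _ + _; exact. Qed.

HB.instance Definition _ := @isMeasurable.Build circle_display (circle R)
  (preimage_set_system setT (@circle_val R) measurable)
  (let: And3 h _ _ := measurable_circle in h) circle_setC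
  (let: And3 _ _ h := measurable_circle in h).

End measurable_circle.

(* The product sigma-algebra, generated by the entries. It is used with entries
   in [R[i]] and with entries in ['M[R[i]]_p], where it is the Borel one. *)
Definition matrix_display : measure_display -> measure_display.
Proof. exact. Qed.

Section measurable_matrix.
Context d (T : measurableType d) (m n : nat).

Definition matrix_measurable : set (set 'M[T]_(m, n)) :=
  <<s \bigcup_(ij in [set: 'I_m * 'I_n])
        preimage_set_system setT (fun M : 'M[T]_(m, n) => M ij.1 ij.2)
          measurable >>.

Let matrix_set0 : matrix_measurable set0.
Proof. exact: sigma_algebra0. Qed.

Let matrix_setC A : matrix_measurable A -> matrix_measurable (~` A).
Proof. exact: sigma_algebraC. Qed.

Let matrix_bigcup (F : (set 'M[T]_(m, n))^nat) :
  (forall i, matrix_measurable (F i)) -> matrix_measurable (\bigcup_i F i).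
Proof. exact: sigma_algebra_bigcup. Qed.

HB.instance Definition _ := @isMeasurable.Build (matrix_display d) 'M[T]_(m, n)
  matrix_measurable matrix_set0 matrix_setC matrix_bigcup.

End measurable_matrix.

(* [tnth t] read along the enumeration [mxvec_index] of the entries. *)
Definition tuple_matrix (T : Type) (m n : nat) (t : (m * n).-tuple T) :
  'M[T]_(m, n) := \matrix_(i, j) tnth t (mxvec_index i j).

Definition matrix_tuple (T : Type) (m n : nat) (M : 'M[T]_(m, n)) :
  (m * n).-tuple T := [tuple mxvec M ord0 l | l < m * n].

Lemma tuple_matrixK (T : Type) (m n : nat) :
  cancel (@tuple_matrix T m n) (@matrix_tuple T m n).
Proof.
move=> t; apply: eq_from_tnth => l; rewrite tnth_mktuple.
by case/mxvec_indexP: l => i j; rewrite mxvecE mxE.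
Qed.

Section measurable_tuple_matrix.
Context d (T : measurableType d) (m n : nat).

Lemma measurable_entry (i : 'I_m) (j : 'I_n) :
  measurable_fun setT (fun M : 'M[T]_(m, n) => M i j).
Proof.
by move=> _ A mA; apply: sub_sigma_algebra; exists (i, j) => //; exists A.
Qed.

Lemma measurable_tuple_matrix : measurable_fun setT (@tuple_matrix T m n).
Proof.
apply: (@measurability _ _ _ _ _ _ (\bigcup_(ij in [set: 'I_m * 'I_n])
  preimage_set_system setT (fun M : 'M[T]_(m, n) => M ij.1 ij.2) measurable)) => //.
move=> _ [_ [[i j] _ [A mA <-]] <-]; rewrite !setTI -comp_preimage.
rewrite (_ : _ \o _ = @tnth _ T ^~ (mxvec_index i j)).
  by rewrite -[X in measurable X]setTI; exact: measurable_tnth.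
by apply/funext => t /=; rewrite mxE.
Qed.

Lemma measurable_matrix_tuple : measurable_fun setT (@matrix_tuple T m n).
Proof.
apply/measurable_fun_tnthP => l; case/mxvec_indexP: l => i j.
rewrite (_ : _ \o _ = fun M : 'M[T]_(m, n) => M i j); first exact: measurable_entry.
by apply/funext => M /=; rewrite tnth_mktuple mxvecE.
Qed.

End measurable_tuple_matrix.

(* The image measure of [mu] by [f]; the measurable left inverse [g] is there to
   keep sigma-finiteness. *)
Section image_measure.
Context d1 d2 (T1 : measurableType d1) (T2 : measurableType d2) (R : realType).
Variables (mu : {sigma_finite_measure set T1 -> \bar R}).
Variables (f : T1 -> T2) (g : T2 -> T1).
Hypotheses (mf : measurable_fun setT f) (mg : measurable_fun setT g).
Hypothesis fK : cancel f g.

Definition image_measure_fun of measurable_fun setT f & measurable_fun setT g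
  & cancel f g : set T2 -> \bar R := pushforward mu f.

Local Notation nu := (image_measure_fun mf mg fK).

Let nu0 : nu set0 = 0%E.
Proof. by rewrite /nu /pushforward preimage_set0 measure0. Qed.

Let nu_ge0 A : (0 <= nu A)%E.
Proof. exact: measure_ge0. Qed.

Let nu_sigma_additive : semi_sigma_additive nu.
Proof.
move=> F mF tF mUF; rewrite /image_measure_fun /pushforward preimage_bigcup.
have mfF n : measurable (f @^-1` F n) by rewrite -[X in measurable X]setTI; exact: mf.
apply: measure_semi_sigma_additive => //; last exact: bigcup_measurable.
apply/trivIsetP => /= i j _ _ ij; rewrite -preimage_setI.
by move/trivIsetP : tF => /(_ _ _ _ _ ij) ->//; rewrite preimage_set0.
Qed.

HB.instance Definition _ := isMeasure.Build _ _ _ nu nu0 nu_ge0 nu_sigma_additive.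

Let nu_sigma_finite : sigma_finite setT nu.
Proof.
have [F TF Foo] := sigma_finiteT mu.
exists (fun n => g @^-1` F n) => [|n]; first by rewrite -preimage_bigcup -TF.
have [mF muF] := Foo n; split; first by rewrite -[X in measurable X]setTI; exact: mg.
rewrite /image_measure_fun /pushforward -comp_preimage.
by rewrite (_ : g \o f = id) ?preimage_id//; exact/funext.
Qed.

HB.instance Definition _ := Measure_isSigmaFinite.Build _ _ _ nu nu_sigma_finite.

Definition image_measure : {sigma_finite_measure set T2 -> \bar R} := nu.

End image_measure.

Definition tuple_cons (T : Type) (n : nat) (x : T * n.-tuple T) : n.+1.-tuple T :=
  [tuple of x.1 :: x.2].

Definition tuple_uncons (T : Type) (n : nat) (t : n.+1.-tuple T) :
  T * n.-tuple T := (thead t, [tuple of behead t]).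

Lemma tuple_consK (T : Type) (n : nat) : cancel (@tuple_cons T n) (@tuple_uncons T n).
Proof. by case=> x t; congr pair; apply/val_inj. Qed.

(* [\x], repackaged: the sigma-finiteness of a product of sigma-finite measures is
   not inferred for [\x] itself. *)
Section product_measure.
Context d1 d2 (T1 : measurableType d1) (T2 : measurableType d2) (R : realType).
Variable m1 : {sigma_finite_measure set T1 -> \bar R}.
Variable m2 : {sigma_finite_measure set T2 -> \bar R}.

Definition product_measure_fun : set (T1 * T2)%type -> \bar R := (m1 \x m2)%E.

HB.instance Definition _ := Measure.on product_measure_fun.

Let product_sigma_finite : sigma_finite setT product_measure_fun.
Proof.
have /sigma_finiteP[F [TF ndF Foo]] := sigma_finiteT m1.
have /sigma_finiteP[G [TG ndG Goo]] := sigma_finiteT m2.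
exists (fun n => F n `*` G n).
  rewrite -setXTT TF TG predeqE => -[x y]; split.
    move=> [/= [n _ Fnx] [k _ Gky]]; exists (maxn n k) => //; split.
    - by move: x Fnx; exact/subsetPset/ndF/leq_maxl.
    - by move: y Gky; exact/subsetPset/ndG/leq_maxr.
  by move=> [n _ []/= ? ?]; split; exists n.
move=> k; have [? ?] := Foo k; have [? ?] := Goo k.
split; first exact: measurableX.
by rewrite /product_measure_fun product_measure1E// lte_mul_pinfty// ge0_fin_numE.
Qed.

HB.instance Definition _ :=
  Measure_isSigmaFinite.Build _ _ _ product_measure_fun product_sigma_finite.

Definition product_measure : {sigma_finite_measure set (T1 * T2)%type -> \bar R} :=
  product_measure_fun.

End product_measure.

Section product_measures.
Context d (T : measurableType d) (R : realType).

Lemma measurable_tuple_cons n : measurable_fun setT (@tuple_cons T n).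
Proof. exact: measurable_cons. Qed.

Lemma measurable_tuple_uncons n : measurable_fun setT (@tuple_uncons T n).
Proof.
apply: measurable_fun_pair; last exact: measurable_behead.
exact: measurable_tnth.
Qed.

Variable mu : {sigma_finite_measure set T -> \bar R}.

Fixpoint tuple_product_measure (n : nat) :
    {sigma_finite_measure set (n.-tuple T) -> \bar R} :=
  match n with
  | 0 => \d_([tuple] : 0.-tuple T)
  | n.+1 => image_measure (product_measure mu (tuple_product_measure n))
              (@measurable_tuple_cons n) (@measurable_tuple_uncons n)
              (@tuple_consK T n)
  end.

Definition matrix_product_measure (m n : nat) :
    {sigma_finite_measure set 'M[T]_(m, n) -> \bar R} :=
  image_measure (tuple_product_measure (m * n))
    (@measurable_tuple_matrix _ T m n) (@measurable_matrix_tuple _ T m n)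
    (@tuple_matrixK T m n).

End product_measures.

Section lebesgue_complex.
Variable R : realType.

(* d Re z d Im z *)
Definition complex_lebesgue : {sigma_finite_measure set R[i] -> \bar R} :=
  image_measure
    (product_measure (@lebesgue_measure R) (@lebesgue_measure R))
    (@measurable_pair_complex R) (@measurable_complex_pair R)
    (@pair_complexK R).

Definition matrix_lebesgue (p : nat) :
    {sigma_finite_measure set 'M[R[i]]_p -> \bar R} :=
  matrix_product_measure complex_lebesgue p p.

(* dX_1 ... dX_n *)
Definition seq_matrix_lebesgue (p n : nat) :
    {sigma_finite_measure set 'rV['M[R[i]]_p]_n -> \bar R} :=
  matrix_product_measure (matrix_lebesgue p) 1 n.

End lebesgue_complex.

(* The integral of a real function against a signed measure: the difference of
   its integrals against the two parts of the Jordan decomposition. *)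
Definition charge_integral d (T : measurableType d) (R : realType)
    (nu : {charge set T -> \bar R}) (f : T -> R) : R :=
  let: exist P hP := cid (Hahn_decomposition nu) in
  let: exist N nuPN := cid hP in
  \int[jordan_pos nuPN]_x f x - \int[jordan_neg nuPN]_x f x.

Record complex_measure d (T : measurableType d) (R : realType) := ComplexMeasure {
  re_measure : {charge set T -> \bar R};
  im_measure : {charge set T -> \bar R} }.

Section complex_measure.
Context d (T : measurableType d) (R : realType).
Implicit Type mu : complex_measure T R.

Definition complex_measure_val mu (A : set T) : R[i] :=
  Complex (fine (re_measure mu A)) (fine (im_measure mu A)).

Definition complex_integral mu (f : T -> R[i]) : R[i] :=
  let re x := complex.Re (f x) in let im x := complex.Im (f x) in
  Complex
    (charge_integral (re_measure mu) re - charge_integral (im_measure mu) im)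
    (charge_integral (im_measure mu) re + charge_integral (re_measure mu) im).

End complex_measure.

Definition matrix_measure d (T : measurableType d) (R : realType) (p : nat) :=
  'I_p -> 'I_p -> complex_measure T R.

Section matrix_measure.
Context d (T : measurableType d) (R : realType) (p : nat).
Implicit Type mu : matrix_measure T R p.

Definition matrix_measure_val mu (A : set T) : 'M[R[i]]_p :=
  \matrix_(a, b) complex_measure_val (mu a b) A.

Definition matrix_integral mu (f : T -> R[i]) : 'M[R[i]]_p :=
  \matrix_(a, b) complex_integral (mu a b) f.

Definition nonneg_hermitian (A : 'M[R[i]]_p) :=
  A \is hermsymmx /\ forall u : 'cV[R[i]]_p, 0 <= (u ^t* *m A *m u) 0 0.

Definition nonneg_hermitian_measure mu :=
  forall A, measurable A -> nonneg_hermitian (matrix_measure_val mu A).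

End matrix_measure.

Section moment_space.
Variables (R : realType) (p : nat).

Definition circle_matrix_measures : set (matrix_measure (circle R) R p) :=
  [set mu | nonneg_hermitian_measure mu /\ matrix_measure_val mu setT = 1%:M].

(* [e ^ (i j theta)] is [z ^+ j] at the point [z = e ^ (i theta)]. *)
Definition trig_moment (mu : matrix_measure (circle R) R p) (j : nat) :
  'M[R[i]]_p := matrix_integral mu (fun z => circle_val z ^+ j).

(* The coordinate of index [l : 'I_n] is the moment of order [l.+1]. *)
Definition moment_space (n : nat) : set 'rV['M[R[i]]_p]_n :=
  [set \row_(l < n) trig_moment mu l.+1 | mu in circle_matrix_measures].

(* Meaningful for [k <= n]; the missing coordinates are 0 otherwise. *)
Definition first_coords (k n : nat) (G : 'rV['M[R[i]]_p]_n) :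
    'rV['M[R[i]]_p]_k :=
  \row_(l < k) (if insub (l : nat) is Some l' then G ord0 l' else 0).

Definition scale_coords (c : R) (k : nat) (G : 'rV['M[R[i]]_p]_k) :
    'rV['M[R[i]]_p]_k :=
  \row_(l < k) (c%:C%C *: G ord0 l).

Definition frobenius_norm (G : 'M[R[i]]_p) : R :=
  Num.sqrt (complex.Re (\tr (G ^t* *m G))).

Definition ginibre_pdf (G : 'M[R[i]]_p) : R :=
  (pi ^+ (p ^ 2))^-1 * expR (- frobenius_norm G ^+ 2).

End moment_space.

Section random_variables.
Context d (Omega : measurableType d) (R : realType) (P : probability Omega R).

Definition uniform_on d' (T : measurableType d') (lambda : set T -> \bar R)
    (D : set T) (X : {RV P >-> T}) :=
  forall A, measurable A ->
    distribution P X A = (fine (lambda (D `&` A)) / fine (lambda D))%:E.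

Definition has_density d' (T : measurableType d') (lambda : set T -> \bar R)
    (g : T -> R) (X : {RV P >-> T}) :=
  forall A, measurable A -> distribution P X A = (\int[lambda]_(x in A) (g x)%:E)%E.

Definition mutually_independent d' (T : measurableType d') (I : finType)
    (X : I -> {RV P >-> T}) :=
  forall (J : {set I}) (A : I -> set T), (forall i, measurable (A i)) ->
    P (\bigcap_(i in [set i | i \in J]) (X i @^-1` A i)) =
    (\prod_(i in J) P (X i @^-1` A i))%E.

End random_variables.

(* Each [Y n] may live on its own probability space. *)
Definition cvg_in_distribution (R : realType) (T : topologicalType)
    (d : nat -> measure_display) (Omega : forall n, measurableType (d n))
    (P : forall n, probability (Omega n) R) (Y : forall n, Omega n -> T)
    (d' : measure_display) (Omega' : measurableType d')
    (Q : probability Omega' R) (Z : Omega' -> T) :=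
  forall f : T -> R, continuous f -> (exists M, forall x, `|f x| <= M) ->
    ('E_(P n)[f \o Y n] @[n --> \oo] --> 'E_Q[f \o Z])%E.

(* Main.v *)
(* Up to a negligible set, the moment space is the set of sequences whose block
   Toeplitz matrices T_n are positive definite. Let h_n = det T_n / det T_(n-1). Given
   the first n coordinates, the next one ranges over a matrix ball, the image of the
   strict contractions A under an affine map of Jacobian h_n^(2p), and
   h_(n+1) = h_n det(1 - A^* A). Integrating the last coordinates out one by one, the
   first k coordinates of a uniform point have a density proportional to
   h_k^(2p(n-k)) on the set where T_k is positive definite.
   Now h_k is the determinant of a Schur complement 1 - F M^-1 F^*, where
   F = (Gamma_1, ..., Gamma_k). After scaling by sqrt(2pn), M tends to 1 and the density
   to exp(- tr F F^* ). Moreover M <= kp because M has trace kp, so that the densities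
   are dominated by a Gaussian function, and dominated convergence applies both to the
   integral of a test function and to the normalization. *)
Require Import Defs.
From HB Require Import structures.
From mathcomp Require Import all_boot all_order all_algebra.
From mathcomp Require Import spectral sesquilinear.
From mathcomp.real_closed Require Import complex.
From mathcomp Require Import all_classical all_reals all_analysis.
From mathcomp Require Import measurable_realfun ring lra.

Set Implicit Arguments.
Unset Strict Implicit.
Unset Printing Implicit Defensive.

Import Order.TTheory GRing.Theory Num.Theory.
Import numFieldNormedType.Exports.

Local Open Scope classical_set_scope.
Local Open Scope ring_scope.
Local Open Scope sesquilinear_scope.

(** * Positive definite matrices *)

(** No normalizing constant is computed. The volume of the moment space, the masses of the matrix
    balls and the Gaussian integral are gathered in one unknown factor, which the test function 1
    determines, so that every expectation is a ratio of two integrals. That the Gaussian integral is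
    finite and nonzero is read off from the $G_l$, whose laws have total mass 1. The identification
    of the moment space has two halves. Given a measure, $z^k$ is replaced by a step function on
    small cells of the circle, for which the Toeplitz matrix is visibly nonnegative. Conversely, a
    positive definite sequence is realized by finitely many atoms, the eigenvalues of a unitary
    matrix. The boundary is negligible because multiplying the moments by $t<1$ replaces a Toeplitz
    matrix $T$ by $tT+(1-t)1$; measurability of the moment space is not established, so this
    comparison rests on monotonicity of the measure on arbitrary sets. The rate has its origin in
    the exponent: $h_k$ is close to $1-\|F\|^2$, and after scaling the exponent $2p(n-k)$ meets the
    factor $1/(2pn)$, with product $1-k/n$. *)

Section positive_definite.
Variable C : numClosedFieldType.

Lemma adjmxM m n q (A : 'M[C]_(m, n)) (B : 'M[C]_(n, q)) :
  (A *m B) ^t* = B ^t* *m A ^t*.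
Proof. by rewrite trmx_mul map_mxM. Qed.

Lemma adjmxD m n (A B : 'M[C]_(m, n)) : (A + B) ^t* = A ^t* + B ^t*.
Proof. by rewrite linearD map_mxD. Qed.

Lemma adjmxN m n (A : 'M[C]_(m, n)) : (- A) ^t* = - A ^t*.
Proof. by rewrite linearN map_mxN. Qed.

Lemma adjmxB m n (A B : 'M[C]_(m, n)) : (A - B) ^t* = A ^t* - B ^t*.
Proof. by rewrite adjmxD adjmxN. Qed.

Lemma adjmx1 n : (1%:M : 'M[C]_n) ^t* = 1%:M.
Proof. by rewrite trmx1 map_mx1. Qed.

Lemma adjmx0 m n : (0 : 'M[C]_(m, n)) ^t* = 0.
Proof. by rewrite trmx0 map_mx0. Qed.

Lemma adjmx_scalar n (a : C) : (a%:M : 'M[C]_n) ^t* = (a^*)%:M.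
Proof. by rewrite tr_scalar_mx map_scalar_mx. Qed.

Lemma adjmxZ m n a (A : 'M[C]_(m, n)) : (a *: A) ^t* = a^* *: A ^t*.
Proof. by rewrite linearZ map_mxZ. Qed.

Lemma adjmxV n (A : 'M[C]_n) : (invmx A) ^t* = invmx (A ^t*).
Proof. by rewrite trmx_inv map_invmx. Qed.

Lemma adjmx_block m1 m2 n1 n2 (A : 'M[C]_(m1, n1)) (B : 'M[C]_(m1, n2))
    (D : 'M[C]_(m2, n1)) (E : 'M[C]_(m2, n2)) :
  (block_mx A B D E) ^t* = block_mx (A ^t*) (D ^t*) (B ^t*) (E ^t*).
Proof. by rewrite tr_block_mx map_block_mx. Qed.

Lemma adjmx_col m1 m2 n (A : 'M[C]_(m1, n)) (B : 'M[C]_(m2, n)) :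
  (col_mx A B) ^t* = row_mx (A ^t*) (B ^t*).
Proof. by rewrite tr_col_mx map_row_mx. Qed.

Lemma det_adjmx n (A : 'M[C]_n) : \det (A ^t*) = (\det A)^*.
Proof. by rewrite det_map_mx det_tr. Qed.

Lemma adjmx_unit n (A : 'M[C]_n) : (A ^t* \in unitmx) = (A \in unitmx).
Proof. by rewrite map_unitmx unitmx_tr. Qed.

Definition hform n (A : 'M[C]_n) (u : 'cV[C]_n) : C := (u ^t* *m A *m u) 0 0.

Definition psd n (A : 'M[C]_n) := A ^t* = A /\ forall u, 0 <= hform A u.

Definition posdef n (A : 'M[C]_n) :=
  A ^t* = A /\ forall u, u != 0 -> 0 < hform A u.

Lemma hformD n (A B : 'M[C]_n) u : hform (A + B) u = hform A u + hform B u.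
Proof. by rewrite /hform mulmxDr mulmxDl mxE. Qed.

Lemma hformB n (A B : 'M[C]_n) u : hform (A - B) u = hform A u - hform B u.
Proof. by rewrite /hform mulmxBr mulmxBl !mxE. Qed.

Lemma hformZ n a (A : 'M[C]_n) u : hform (a *: A) u = a * hform A u.
Proof. by rewrite /hform -scalemxAr -scalemxAl mxE. Qed.

Lemma hform0 n (A : 'M[C]_n) : hform A 0 = 0.
Proof. by rewrite /hform mulmx0 mxE. Qed.

Lemma hform_congr m n (S : 'M[C]_(m, n)) (A : 'M[C]_m) u :
  hform (S ^t* *m A *m S) u = hform A (S *m u).
Proof. by rewrite /hform adjmxM !mulmxA. Qed.

Lemma hform1 n (u : 'cV[C]_n) : hform 1%:M u = \sum_i `|u i 0| ^+ 2.
Proof.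
rewrite /hform mulmx1 mxE; apply: eq_bigr => i _.
by rewrite !mxE normCK mulrC.
Qed.

Lemma hform1_ge0 n (u : 'cV[C]_n) : 0 <= hform 1%:M u.
Proof. by rewrite hform1 sumr_ge0// => i _; rewrite exprn_ge0. Qed.

Lemma hform1_gt0 n (u : 'cV[C]_n) : u != 0 -> 0 < hform 1%:M u.
Proof.
move=> u0; rewrite lt_neqAle hform1_ge0 andbT eq_sym hform1.
rewrite psumr_eq0 => [|i _]; last exact: exprn_ge0.
apply: contra u0 => /allP h; apply/eqP/matrixP => i j; rewrite ord1 mxE.
by have := h i (mem_index_enum _); rewrite /= sqrf_eq0 normr_eq0 => /eqP.
Qed.

Lemma posdef1 n : posdef (1%:M : 'M[C]_n).
Proof. by split; [exact: adjmx1|exact: hform1_gt0]. Qed.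

Lemma posdef_psd n (A : 'M[C]_n) : posdef A -> psd A.
Proof.
move=> [hA pA]; split=> // u.
by have [->|/pA/ltW//] := eqVneq u 0; rewrite hform0.
Qed.

Lemma psd_congr m n (S : 'M[C]_(m, n)) (A : 'M[C]_m) :
  psd A -> psd (S ^t* *m A *m S).
Proof.
move=> [hA pA]; split=> [|u]; last by rewrite hform_congr.
by rewrite !adjmxM trmxCK hA mulmxA.
Qed.

Lemma posdef_congr n (S : 'M[C]_n) (A : 'M[C]_n) : S \in unitmx ->
  posdef A -> posdef (S ^t* *m A *m S).
Proof.
move=> uS [hA pA]; split=> [|u u0]; first by rewrite !adjmxM trmxCK hA mulmxA.
rewrite hform_congr pA//; apply: contra u0 => /eqP Su0.
by rewrite -(mulKmx uS u) Su0 mulmx0.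
Qed.

Lemma posdef_congrE n (S : 'M[C]_n) (A : 'M[C]_n) : S \in unitmx ->
  posdef (S ^t* *m A *m S) <-> posdef A.
Proof.
move=> uS; split; last exact: posdef_congr.
have uS' : invmx S \in unitmx by rewrite unitmx_inv.
move=> /(posdef_congr uS'); rewrite adjmxV !mulmxA mulVmx ?adjmx_unit// mul1mx.
by rewrite -mulmxA mulmxV// mulmx1.
Qed.

Lemma posdef_unit n (A : 'M[C]_n) : posdef A -> A \in unitmx.
Proof.
move=> [hA pA]; rewrite -row_free_unit -kermx_eq0; apply/eqP/row_matrixP => i.
rewrite row0; apply/eqP/contraT => k0.
have : (row i (kermx A)) ^t* != 0.
  by apply: contra k0 => /eqP k0; rewrite -(trmxCK (row i _)) k0 adjmx0.
move=> /pA; rewrite /hform trmxCK (_ : row i (kermx A) *m A = 0).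
  by rewrite mul0mx mxE ltxx.
by rewrite -row_mul mulmx_ker row0.
Qed.

Lemma posdefV n (A : 'M[C]_n) : posdef A -> posdef (invmx A).
Proof.
move=> pA; have uA := posdef_unit pA; have [hA _] := pA.
have uV : invmx A \in unitmx by rewrite unitmx_inv.
by have := posdef_congr uV pA; rewrite adjmxV hA mulVmx// mul1mx.
Qed.

Lemma hform_col m n (A : 'M[C]_m) (D : 'M[C]_n) u v :
  hform (block_mx A 0 0 D) (col_mx u v) = hform A u + hform D v.
Proof.
rewrite /hform adjmx_col mul_row_block !mulmx0 addr0 add0r mul_row_col.
by rewrite mxE.
Qed.

Lemma posdef_block_diag m n (A : 'M[C]_m) (D : 'M[C]_n) :
  posdef (block_mx A 0 0 D) <-> posdef A /\ posdef D.
Proof.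
split=> [[h p]|[[hA pA] [hD pD]]].
  move: h; rewrite adjmx_block !adjmx0 => /eq_block_mx[hA _ _ hD].
  split; split=> // u u0.
  - have := p (col_mx u 0); rewrite hform_col hform0 addr0; apply.
    by apply: contra u0; rewrite col_mx_eq0 => /andP[].
  - have := p (col_mx 0 u); rewrite hform_col hform0 add0r; apply.
    by apply: contra u0; rewrite col_mx_eq0 => /andP[].
split=> [|u]; first by rewrite adjmx_block !adjmx0 hA hD.
rewrite -[u]vsubmxK col_mx_eq0 negb_and hform_col.
have hA0 := (posdef_psd (conj hA pA)).2; have hD0 := (posdef_psd (conj hD pD)).2.
by case/orP => [/pA|/pD] h; [exact: ltr_pwDl|exact: ltr_wpDl].
Qed.

(** One step of block Gaussian elimination: congruence by the unitriangular [S] clears the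
    off-diagonal blocks, so that positivity and determinant are read off the diagonal ones. *)
Lemma schur_factor m n (A : 'M[C]_m) (B : 'M[C]_(m, n)) (D : 'M[C]_n) :
  A \in unitmx -> A ^t* = A ->
  let S := block_mx 1%:M (invmx A *m B) 0 1%:M in
  block_mx A B (B ^t*) D =
  S ^t* *m block_mx A 0 0 (D - B ^t* *m invmx A *m B) *m S.
Proof.
move=> uA hA S; rewrite /S adjmx_block !adjmx1 adjmx0 adjmxM adjmxV hA.
rewrite !mulmx_block !mulmx0 !mul0mx !mul1mx !mulmx1 !addr0 !add0r.
by rewrite mulmxKV// mulKVmx// mulmxA addrC subrK.
Qed.

Lemma unit_ublock m n (B : 'M[C]_(m, n)) :
  block_mx 1%:M B 0 1%:M \in unitmx.
Proof. by rewrite unitmxE det_ublock !det1 mulr1 unitr1. Qed.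

Lemma posdef_ulsub m n (A : 'M[C]_m) (B : 'M[C]_(m, n)) D E :
  posdef (block_mx A B D E) -> posdef A.
Proof.
move=> [h p]; move: h; rewrite adjmx_block => /eq_block_mx[hA _ _ _].
split=> // u u0; have := p (col_mx u 0); rewrite /hform.
rewrite adjmx_col mul_row_block adjmx0 !mul0mx !addr0 mul_row_col mulmx0 addr0.
by apply; apply: contra u0; rewrite col_mx_eq0 => /andP[].
Qed.

Lemma posdef_schur m n (A : 'M[C]_m) (B : 'M[C]_(m, n)) (D : 'M[C]_n) :
  posdef (block_mx A B (B ^t*) D) <->
  posdef A /\ posdef (D - B ^t* *m invmx A *m B).
Proof.
split=> [p|[pA pS]].
  have pA := posdef_ulsub p; move: p.
  by rewrite (schur_factor _ _ (posdef_unit pA) pA.1) posdef_congrE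
    ?unit_ublock// posdef_block_diag.
by rewrite (schur_factor _ _ (posdef_unit pA) pA.1) posdef_congrE
  ?unit_ublock// posdef_block_diag.
Qed.

Lemma det_schur m n (A : 'M[C]_m) (B : 'M[C]_(m, n)) (D : 'M[C]_n) :
  posdef A ->
  \det (block_mx A B (B ^t*) D) = \det A * \det (D - B ^t* *m invmx A *m B).
Proof.
move=> pA; rewrite (schur_factor _ _ (posdef_unit pA) pA.1) !det_mulmx.
by rewrite det_adjmx !det_ublock !det1 mulr1 rmorph1 mul1r mulr1.
Qed.

Definition swap_mx m n : 'M[C]_(m + n, n + m) := block_mx 0 1%:M 1%:M 0.

Lemma swap_block m n (A : 'M[C]_m) (B : 'M[C]_(m, n)) D (E : 'M[C]_n) :
  (swap_mx m n) ^t* *m block_mx A B D E *m (swap_mx m n) = block_mx E D B A.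
Proof.
rewrite /swap_mx adjmx_block !adjmx1 !adjmx0 !mulmx_block.
by rewrite !mul0mx !mul1mx !mulmx0 !mulmx1 !add0r !addr0.
Qed.

Lemma posdef_swap m n (A : 'M[C]_m) (B : 'M[C]_(m, n)) D (E : 'M[C]_n) :
  posdef (block_mx A B D E) -> posdef (block_mx E D B A).
Proof.
move=> [hp pp]; rewrite -swap_block; split.
  by rewrite !adjmxM trmxCK hp mulmxA.
move=> u u0; rewrite hform_congr pp//; apply: contra u0.
rewrite -[u]vsubmxK mul_block_col !mul0mx !mul1mx add0r addr0 !col_mx_eq0.
by rewrite andbC.
Qed.

(** Elimination from the other corner, obtained by permuting the blocks. A Toeplitz matrix contains
    the one of the preceding order in both corners, so both eliminations occur. *)
Lemma posdef_schur_dr m n (A : 'M[C]_m) (B : 'M[C]_(m, n)) (D : 'M[C]_n) :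
  posdef (block_mx A B (B ^t*) D) <->
  posdef D /\ posdef (A - B *m invmx D *m B ^t*).
Proof.
have := posdef_schur D (B ^t*) A; rewrite trmxCK => <-.
by split; exact: posdef_swap.
Qed.

Lemma schur_factor_dr m n (A : 'M[C]_m) (B : 'M[C]_(m, n)) (D : 'M[C]_n) :
  D \in unitmx -> D ^t* = D ->
  let S := block_mx 1%:M 0 (invmx D *m B ^t*) 1%:M in
  block_mx A B (B ^t*) D =
  S ^t* *m block_mx (A - B *m invmx D *m B ^t*) 0 0 D *m S.
Proof.
move=> uA hA S; rewrite /S adjmx_block !adjmx1 adjmx0 adjmxM adjmxV hA trmxCK.
rewrite !mulmx_block !mulmx0 !mul0mx !mul1mx !mulmx1 !addr0 !add0r.
by rewrite mulmxKV// mulKVmx// mulmxA subrK.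
Qed.

Lemma det_schur_dr m n (A : 'M[C]_m) (B : 'M[C]_(m, n)) (D : 'M[C]_n) :
  posdef D ->
  \det (block_mx A B (B ^t*) D) = \det D * \det (A - B *m invmx D *m B ^t*).
Proof.
move=> pD; rewrite (schur_factor_dr _ _ (posdef_unit pD) pD.1) !det_mulmx.
by rewrite det_adjmx !det_lblock !det1 mulr1 rmorph1 mul1r mulr1 mulrC.
Qed.

(** The form of the inverse splits into a part free of [X] and a part that sees [X] only through
    [Y]. With [X] the unknown next moment, this exhibits the centre [F *m invmx M *m E] of the
    matrix ball. *)
Lemma schur_corner m n q (A : 'M[C]_m) (F : 'M[C]_(m, n)) (M : 'M[C]_n)
    (X : 'M[C]_(m, q)) (E : 'M[C]_(n, q)) :
  posdef M -> posdef (A - F *m invmx M *m F ^t*) ->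
  let Y := X - F *m invmx M *m E in
  (col_mx X E) ^t* *m invmx (block_mx A F (F ^t*) M) *m col_mx X E =
  E ^t* *m invmx M *m E + Y ^t* *m invmx (A - F *m invmx M *m F ^t*) *m Y.
Proof.
move=> pM pL Y; set L := A - _.
have uM := posdef_unit pM; have uL := posdef_unit pL.
set S := block_mx 1%:M 0 (invmx M *m F ^t*) 1%:M.
set S' := block_mx 1%:M 0 (- (invmx M *m F ^t*)) 1%:M.
have SS : S *m S' = 1%:M.
  rewrite /S /S' mulmx_block !mul0mx !mulmx0 !mulmx1 !mul1mx !addr0 add0r.
  by rewrite subrr -scalar_mx_block.
have SS2 : S' *m S = 1%:M by exact: mulmx1C.
set W := block_mx (invmx L) 0 0 (invmx M).
(* In the coordinates given by [S] the matrix is block diagonal, which makes its inverse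
   explicit. *)
have WI : S ^t* *m block_mx L 0 0 M *m S *m (S' *m W *m S' ^t*) = 1%:M.
  rewrite !mulmxA -(mulmxA _ S) SS mulmx1 -(mulmxA _ _ W) /W mulmx_block.
  rewrite !mul0mx !mulmx0 !addr0 !add0r !mulmxV// -scalar_mx_block mulmx1.
  by rewrite -adjmxM SS2 adjmx1.
rewrite (schur_factor_dr _ _ uM pM.1) -/L -/S.
rewrite -[invmx _]mulmx1 -WI mulKmx; last first.
  by case/mulmx1_unit : WI.
have SX : S' ^t* *m col_mx X E = col_mx Y E.
  rewrite /S' adjmx_block !adjmx1 adjmx0 adjmxN adjmxM adjmxV pM.1 trmxCK.
  by rewrite mul_block_col !mul1mx mul0mx add0r mulNmx.
rewrite -!mulmxA SX !mulmxA.
have -> : (col_mx X E) ^t* *m S' = (col_mx Y E) ^t*.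
  by rewrite -SX adjmxM trmxCK.
by rewrite adjmx_col mul_row_block !mulmx0 addr0 add0r mul_row_col addrC.
Qed.

(** Triangular factors are preferred to Hermitian square roots: multiplication by them acts
    triangularly on the entries of a matrix, and the Jacobian becomes a product of one-dimensional
    dilations. *)
Definition lower_pos n (L : 'M[C]_n) :=
  (forall i j : 'I_n, (i < j)%N -> L i j = 0) /\ (forall i, 0 < L i i).

Lemma cholesky n (A : 'M[C]_n) :
  posdef A -> exists2 L, lower_pos L & A = L *m L ^t*.
Proof.
elim: n A => [|n IH] A pA.
  by exists 1%:M; [split=> -[]//|apply/matrixP => -[]//].
pose A' := A : 'M[C]_(1 + n).
set a := ulsubmx A'; set b := ursubmx A'; set D := drsubmx A'.
have A'E : A' = block_mx a b (b ^t*) D.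
  rewrite -[LHS]submxK; congr block_mx.
  have : A' ^t* = A' := pA.1.
  by rewrite -{1 2}[A']submxK adjmx_block => /eq_block_mx[].
have : posdef A' := pA.
rewrite A'E => /posdef_schur[pa /IH[L [tL dL] LE]].
have aE : a = (a 0 0)%:M by exact: mx11_scalar.
have a0 : 0 < a 0 0.
  have := pa.2 1; rewrite oner_eq0 /hform adjmx1 mul1mx mulmx1; exact.
pose s := sqrtC (a 0 0).
have s0 : 0 < s by rewrite sqrtC_gt0.
have sK : s^* = s by apply/CrealP; rewrite realE ltW.
have ssa : s * s = a 0 0 by rewrite -expr2 sqrtCK.
(* The first column of [A] divided by the square root of its corner, followed by the factor [L] of
   the Schur complement. *)
pose W := block_mx s%:M 0 (s^-1 *: b ^t*) L : 'M[C]_(1 + n).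
exists W; rewrite /W.
  split=> [i j|i].
    rewrite !mxE; case: splitP => i' ii; rewrite !mxE; case: splitP => j' jj.
    - by rewrite ii jj !ord1.
    - by rewrite mxE.
    - by rewrite ii jj ord1.
    - by move=> ij; apply: tL; rewrite ii jj in ij.
  rewrite mxE; case: splitP => i' ii; rewrite mxE; case: splitP => j' jj.
  - by rewrite !ord1 mxE.
  - by move: ii; rewrite jj; case: i' => -[].
  - by move: ii; rewrite jj; case: j' {jj} => -[].
  - by have -> : i' = j' by apply/val_inj/eqP; rewrite -(eqn_add2l 1) -ii jj.
change (A' = W *m W ^t*); rewrite A'E /W adjmx_block adjmx0 mulmx_block !mul0mx !mulmx0 !addr0.
have hs : (s%:M : 'M[C]_1) ^t* = s%:M by rewrite adjmx_scalar sK.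
have hb : (s^-1 *: b ^t*) ^t* = s^-1 *: b.
  by rewrite adjmxZ trmxCK fmorphV /= sK.
rewrite hs hb -LE; congr block_mx.
- by rewrite aE -scalar_mxM ssa.
- by rewrite mul_scalar_mx scalerA divff ?scale1r// gt_eqF.
- by rewrite mul_mx_scalar scalerA divff ?scale1r// gt_eqF.
- rewrite addrC -scalemxAl -scalemxAr scalerA aE invmx_scalar mul_mx_scalar.
  by rewrite -scalemxAl -invfM ssa subrK.
Qed.

Lemma lower_pos_det n (L : 'M[C]_n) : lower_pos L -> \det L = \prod_i L i i.
Proof. by move=> [tL _]; rewrite det_trig//; apply/is_trig_mxP. Qed.

Lemma lower_pos_det_gt0 n (L : 'M[C]_n) : lower_pos L -> 0 < \det L.
Proof. by move=> hL; rewrite lower_pos_det// prodr_gt0// => i _; exact: hL.2. Qed.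

Lemma lower_pos_unit n (L : 'M[C]_n) : lower_pos L -> L \in unitmx.
Proof. by move=> hL; rewrite unitmxE unitfE gt_eqF// lower_pos_det_gt0. Qed.

Lemma lower_pos_det_adj n (L : 'M[C]_n) :
  lower_pos L -> \det (L *m L ^t*) = \det L ^+ 2.
Proof.
move=> hL; rewrite det_mulmx det_adjmx (_ : (\det L)^* = \det L)//.
by apply/CrealP; rewrite realE ltW// lower_pos_det_gt0.
Qed.

Lemma posdef_det_gt0 n (A : 'M[C]_n) : posdef A -> 0 < \det A.
Proof.
by move=> /cholesky[L hL ->]; rewrite lower_pos_det_adj// exprn_gt0// lower_pos_det_gt0.
Qed.

(** A diagonal entry of [L *m L ^t*] is [L i i ^+ 2] plus squared moduli, while the determinant sees
    only the [L i i]. *)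
Lemma hadamard n (A : 'M[C]_n) : posdef A -> \det A <= \prod_i A i i.
Proof.
move=> /cholesky[L hL ->]; rewrite lower_pos_det_adj// lower_pos_det// -prodrXl.
apply: ler_prod => i _; rewrite exprn_ge0 ?(ltW (hL.2 i))//= mxE (bigD1 i)//=.
rewrite !mxE -normCK (ger0_norm (ltW (hL.2 i))) lerDl sumr_ge0// => j _.
by rewrite !mxE -normCK exprn_ge0.
Qed.

Lemma posdef_diag_gt0 n (A : 'M[C]_n) i : posdef A -> 0 < A i i.
Proof.
move=> /cholesky[L hL ->]; rewrite mxE (bigD1 i)//= ltr_pwDl//.
  by rewrite !mxE -normCK exprn_gt0// normr_gt0 gt_eqF// hL.2.
by rewrite sumr_ge0// => j _; rewrite !mxE -normCK exprn_ge0.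
Qed.

Lemma psd_spectral n (A : 'M[C]_n) : psd A ->
  exists P : 'M[C]_n, exists2 d : 'rV[C]_n, (forall i, 0 <= d 0 i) &
    P \is unitarymx /\ A = P ^t* *m diag_mx d *m P.
Proof.
move=> [hA pA].
have nA : A \is normalmx by apply: hermitian_normalmx; rewrite is_hermitianmxE scale1r hA.
have := orthomx_spectralP nA; set P := spectralmx A; set d := spectral_diag A.
have uP : P \is unitarymx := spectral_unitarymx A.
rewrite invmx_unitary// => AE; exists P; exists d => // i.
(* The test vector is the eigenvector of index [i], where the form takes the value [d 0 i]. *)
have := pA (P ^t* *m delta_mx i 0); rewrite -hform_congr AE !mulmxA trmxCK.
rewrite (unitarymxP uP) mul1mx -mulmxA (unitarymxP uP) mulmx1.
rewrite /hform !mxE (bigD1 i)//= big1 => [|j ji]; last first.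
  by rewrite !mxE (negbTE ji) mulr0.
rewrite addr0 !mxE !eqxx mulr1 (bigD1 i)//= big1 => [|j ji].
  by rewrite !mxE !eqxx rmorph1 mul1r mulr1n addr0.
by rewrite !mxE (negbTE ji) rmorph0 mul0r.
Qed.

Lemma mxtrace_unitary_conj n (P D : 'M[C]_n) :
  P \is unitarymx -> \tr (P ^t* *m D *m P) = \tr D.
Proof. by move=> uP; rewrite mxtrace_mulC mulmxA (unitarymxP uP) mul1mx. Qed.

Lemma psd_trace_ge0 n (A : 'M[C]_n) : psd A -> 0 <= \tr A.
Proof.
move=> /psd_spectral[P [d d0 [uP ->]]].
by rewrite mxtrace_unitary_conj// mxtrace_diag sumr_ge0.
Qed.

Lemma weierstrass_prod (I : Type) (r : seq I) (f : I -> C) :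
  (forall i, 0 <= f i) -> (forall i, f i <= 1) ->
  1 - \sum_(i <- r) f i <= \prod_(i <- r) (1 - f i).
Proof.
move=> f0 f1; have h : 0 <= \prod_(i <- r) (1 - f i) <= 1.
  by elim/big_ind : _ => [|x y /andP[x0 x1] /andP[y0 y1]|i _];
    rewrite ?ler01 ?lexx// ?mulr_ge0 ?mulr_ile1// subr_ge0 f1 lerBlDr lerDl f0.
elim: r h => [|i r IH] h; first by rewrite !big_nil subr0.
rewrite !big_cons; have h' : 0 <= \prod_(i <- r) (1 - f i) <= 1.
  by elim/big_ind : _ => [|x y /andP[x0 x1] /andP[y0 y1]|j _];
    rewrite ?ler01 ?lexx// ?mulr_ge0 ?mulr_ile1// subr_ge0 f1 lerBlDr lerDl f0.
rewrite mulrBl mul1r opprD addrCA addrC lerB ?IH//.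
by rewrite -[leRHS]mulr1 ler_wpM2l//; case/andP : h'.
Qed.

(** Diagonalizing [Y] reduces this to a product over eigenvalues in [0, 1]. It is the lower half of
    the estimate of [toep_ratio]; [hadamard] gives the upper half. *)
Lemma det_1B_ge n (Y : 'M[C]_n) : psd Y -> psd (1%:M - Y) ->
  1 - \tr Y <= \det (1%:M - Y).
Proof.
move=> /psd_spectral[P [d d0 [uP ->]]].
have -> : 1%:M - P ^t* *m diag_mx d *m P =
    P ^t* *m diag_mx (\row_i (1 - d 0 i)) *m P.
  have -> : diag_mx (\row_i (1 - d 0 i)) = 1%:M - diag_mx d.
    by apply/matrixP => i j; rewrite !mxE; case: eqP => // _; rewrite subr0.
  rewrite mulmxBr mulmxBl mulmx1; congr (_ - _).
  by rewrite -(invmx_unitary uP) mulVmx// unitarymx_unit.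
move=> [_ h]; rewrite mxtrace_unitary_conj// mxtrace_diag.
have -> : \det (P ^t* *m diag_mx (\row_i (1 - d 0 i)) *m P) = \prod_i (1 - d 0 i).
  rewrite !det_mulmx mulrC mulrA -det_mulmx (unitarymxP uP) det1 mul1r det_diag.
  by apply: eq_bigr => i _; rewrite mxE.
apply: weierstrass_prod => // i.
have := h (P ^t* *m delta_mx i 0); rewrite -hform_congr !mulmxA trmxCK.
rewrite (unitarymxP uP) mul1mx -mulmxA (unitarymxP uP) mulmx1.
rewrite /hform !mxE (bigD1 i)//= big1 => [|j ji]; last first.
  by rewrite !mxE (negbTE ji) mulr0.
rewrite addr0 !mxE !eqxx mulr1 (bigD1 i)//= big1 => [|j ji].
  by rewrite !mxE !eqxx rmorph1 mul1r mulr1n addr0 subr_ge0.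
by rewrite !mxE (negbTE ji) rmorph0 mul0r.
Qed.

(** By completing a square: with [v = invmx T *m u], the form at [u] is that of [T] at
    [v - b^-1 *: u] plus [b^-2] times that of [b%:M - T] at [u]. *)
Lemma psdB_inv_ge n (T : 'M[C]_n) (b : C) : posdef T -> 0 < b ->
  psd (b%:M - T) -> psd (invmx T - b^-1%:M).
Proof.
move=> pT b0 [_ h]; have [hT p0] := pT; have uT := posdef_unit pT.
have bK : b^* = b by apply/CrealP; rewrite realE ltW.
split=> [|u].
  by rewrite adjmxB adjmxV hT adjmx_scalar fmorphV /= bK.
set v := invmx T *m u; set w := v - b^-1 *: u.
have uE : u = T *m v by rewrite mulKVmx.
have hu : hform b%:M u = b * hform 1%:M u by rewrite -hformZ scalemx1.
have hw : hform T w = hform (invmx T) u - 2 * b^-1 * hform 1%:M u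
     + b^-2 * hform T u.
  rewrite /w /hform mulmx1 adjmxB adjmxZ fmorphV /= bK.
  rewrite !mulmxBl !mulmxBr -!scalemxAl -!scalemxAr /v adjmxM adjmxV hT.
  rewrite mulmxKV// -!mulmxA (mulmxA T) mulmxV// mul1mx scalerA !mxE.
  by field; rewrite gt_eqF.
have h1 : 0 <= hform T w by exact: (posdef_psd pT).2.
have h2 := h u; rewrite hformB hu subr_ge0 in h2.
have e : b^-2 * hform T u <= b^-1 * hform 1%:M u.
  have -> : b^-1 * hform 1%:M u = b^-2 * (b * hform 1%:M u) by field; rewrite gt_eqF.
  by rewrite ler_wpM2l// invr_ge0 exprn_ge0// ltW.
have -> : hform (invmx T - b^-1%:M) u = hform T w
    + (b^-1 * hform 1%:M u - b^-2 * hform T u).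
  by rewrite hw hformB -[b^-1%:M]scalemx1 hformZ; ring.
by rewrite addr_ge0// subr_ge0.
Qed.

(** Here the form at [u] is [a] times the squared length of [v - a^-1 *: u] plus the form of
    [T - a%:M] at [v]. *)
Lemma psdB_inv_le n (T : 'M[C]_n) (a : C) : posdef T -> 0 < a ->
  psd (T - a%:M) -> psd (a^-1%:M - invmx T).
Proof.
move=> pT a0 [_ h]; have [hT p0] := pT; have uT := posdef_unit pT.
have aK : a^* = a by apply/CrealP; rewrite realE ltW.
split=> [|u].
  by rewrite adjmxB adjmxV hT adjmx_scalar fmorphV /= aK.
set v := invmx T *m u; set w := v - a^-1 *: u.
have hv : hform (invmx T) u = hform T v.
  rewrite /hform /v adjmxM adjmxV hT -!mulmxA (mulmxA T) mulmxV// mul1mx.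
  by rewrite !mulmxA.
have hw : hform 1%:M w = hform 1%:M v - 2 * a^-1 * hform (invmx T) u
     + a^-2 * hform 1%:M u.
  rewrite /w /hform !mulmx1 adjmxB adjmxZ fmorphV /= aK.
  rewrite !mulmxBl !mulmxBr -!scalemxAl -!scalemxAr /v adjmxM adjmxV hT.
  rewrite scalerA -!mulmxA !mxE.
  by field; rewrite gt_eqF.
have h1 := hform1_ge0 w.
have h2 := h v; rewrite hformB -[a%:M]scalemx1 hformZ -hv subr_ge0 in h2.
have -> : hform (a^-1%:M - invmx T) u = a * hform 1%:M w
    + (hform (invmx T) u - a * hform 1%:M v).
  by rewrite hw hformB -[a^-1%:M]scalemx1 hformZ; field; rewrite gt_eqF.
by rewrite addr_ge0 ?subr_ge0// mulr_ge0// ltW.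
Qed.

End positive_definite.

(** * Scalar bounds on Hermitian matrices and extension of isometries *)

Section hermitian_bounds.
Variable C : numClosedFieldType.

(** Each eigenvalue is at most the sum of all. The bound is crude, but the trace of a Toeplitz
    matrix does not depend on the moments, which makes the Gaussian domination uniform. *)
Lemma psd_trace_bound n (A : 'M[C]_n) : psd A -> psd ((\tr A)%:M - A).
Proof.
move=> pA; have [hA _] := pA; have t0 := psd_trace_ge0 pA.
have [P [d d0 [uP AE]]] := psd_spectral pA.
split=> [|u].
  rewrite adjmxB hA adjmx_scalar (_ : (\tr A)^* = \tr A)//.
  by apply/CrealP; rewrite realE t0.
have -> : (\tr A)%:M - A = P ^t* *m diag_mx (\row_i (\tr A - d 0 i)) *m P.
  have -> : diag_mx (\row_i (\tr A - d 0 i)) = (\tr A)%:M - diag_mx d.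
    by apply/matrixP => i j; rewrite !mxE; case: eqP => // _; rewrite subr0.
  rewrite mulmxBr mulmxBl -AE; congr (_ - _).
  rewrite mul_mx_scalar -scalemxAl -(invmx_unitary uP) mulVmx ?scalemx1//.
  exact: unitarymx_unit.
rewrite hform_congr /hform -mulmxA mul_diag_mx mxE sumr_ge0// => i _.
rewrite !mxE mulrCA mulr_ge0//; last by rewrite mulrC -normCK exprn_ge0.
rewrite subr_ge0 AE mxtrace_unitary_conj// mxtrace_diag (bigD1 i)//= lerDl.
by rewrite sumr_ge0.
Qed.

Lemma hermitian_bounded n (H : 'M[C]_n) : H ^t* = H ->
  exists2 c, 0 <= c & psd (c%:M - H) /\ psd (c%:M + H).
Proof.
move=> hH; have hH' : H \is hermsymmx by rewrite is_hermitianmxE scale1r hH.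
have := orthomx_spectralP (hermitian_normalmx hH').
have /realmxC := hermitian_spectral_diag_real hH'.
set P := spectralmx H; set d := spectral_diag H => dR.
have uP : P \is unitarymx := spectral_unitarymx H.
rewrite invmx_unitary// => HE.
have dreal i : d 0 i \is Num.real.
  by apply/CrealP; move/matrixP/(_ 0 i) : dR; rewrite mxE.
pose c := \sum_i `|d 0 i|.
have c0 : 0 <= c by exact: sumr_ge0.
have dc i : `|d 0 i| <= c.
  by rewrite /c (bigD1 i)//= lerDl sumr_ge0.
have cK : c^* = c by apply/CrealP; rewrite realE c0.
have key (e : 'rV[C]_n) : (forall i, 0 <= c + e 0 i) ->
    forall u, 0 <= hform (c%:M + P ^t* *m diag_mx e *m P) u.
  move=> ce u.
  have -> : c%:M + P ^t* *m diag_mx e *m P =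
      P ^t* *m diag_mx (\row_i (c + e 0 i)) *m P.
    have -> : diag_mx (\row_i (c + e 0 i)) = c%:M + diag_mx e.
      by apply/matrixP => i j; rewrite !mxE; case: eqP => // _; rewrite addr0.
    rewrite mulmxDr mulmxDl; congr (_ + _).
    rewrite mul_mx_scalar -scalemxAl -(invmx_unitary uP) mulVmx ?scalemx1//.
    exact: unitarymx_unit.
  rewrite hform_congr /hform -mulmxA mul_diag_mx mxE sumr_ge0// => i _.
  by rewrite !mxE mulrCA mulr_ge0//; rewrite mulrC -normCK exprn_ge0.
exists c => //; split; split.
- by rewrite adjmxB hH adjmx_scalar cK.
- move=> u; have -> : c%:M - H = c%:M + P ^t* *m diag_mx (- d) *m P.
    by rewrite linearN /= mulmxN mulNmx -HE.
  apply: key => i; rewrite mxE subr_ge0.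
  by apply: le_trans (dc i); apply: real_ler_norm.
- by rewrite adjmxD hH adjmx_scalar cK.
- move=> u; rewrite HE; apply: key => i.
  rewrite -lerBlDl sub0r lerNl; apply: le_trans (dc i).
  by rewrite -normrN real_ler_norm ?realN.
Qed.

Lemma psdD n (A B : 'M[C]_n) : psd A -> psd B -> psd (A + B).
Proof.
move=> [hA pA] [hB pB]; split=> [|u]; first by rewrite adjmxD hA hB.
by rewrite hformD addr_ge0.
Qed.

Lemma psdZ n a (A : 'M[C]_n) : 0 <= a -> psd A -> psd (a *: A).
Proof.
move=> a0 [hA pA]; split=> [|u]; last by rewrite hformZ mulr_ge0.
by rewrite adjmxZ hA (_ : a^* = a)//; apply/CrealP; rewrite realE a0.
Qed.

Lemma posdefZ n a (A : 'M[C]_n) : 0 < a -> posdef A -> posdef (a *: A).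
Proof.
move=> a0 [hA pA]; split=> [|u u0]; last by rewrite hformZ mulr_gt0 ?pA.
by rewrite adjmxZ hA (_ : a^* = a)//; apply/CrealP; rewrite realE ltW.
Qed.

Lemma posdef_psdD n (A B : 'M[C]_n) : posdef A -> psd B -> posdef (A + B).
Proof.
move=> [hA pA] [hB pB]; split=> [|u u0]; first by rewrite adjmxD hA hB.
by rewrite hformD ltr_pwDl ?pA.
Qed.

Lemma psd_trace_conj_le m n (F : 'M[C]_(m, n)) (A B : 'M[C]_n) :
  psd (B - A) -> \tr (F *m A *m F ^t*) <= \tr (F *m B *m F ^t*).
Proof.
move=> /(psd_congr (F ^t*)) /psd_trace_ge0; rewrite trmxCK mulmxBr mulmxBl.
by rewrite linearB subr_ge0.
Qed.

(** The added rows are a Gram-Schmidt basis of the orthogonal complement of the rows of [A]. *)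
Lemma unitarymx_complete m n (A : 'M[C]_(m, n)) : A \is unitarymx ->
  exists A' : 'M[C]_(n - m, n), A ^t* *m A + A' ^t* *m A' = 1%:M /\
    A' \is unitarymx /\ A *m A' ^t* = 0.
Proof.
move=> uA; pose O := orthomx (@Num.Def.conjC C) 1%:M A.
have rA := mxrank_unitary uA.
have mn : (m <= n)%N by rewrite -rA rank_leq_col.
have rO : \rank O = (n - m)%N by rewrite /O rank_ortho rA.
have [B [uB BO]] : exists B : 'M[C]_(n - m, n), B \is unitarymx /\ (B <= O)%MS.
  have : schmidt (row_base O) \is unitarymx.
    by rewrite schmidt_unitarymx// rank_leq_col.
  have : (schmidt (row_base O) <= O)%MS.
    by rewrite (eqmx_schmidt_free (row_base_free _)) eq_row_base.
  by move: (schmidt _); rewrite rO => B h1 h2; exists B.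
have AB : B *m A ^t* = 0 by apply/orthomx1P.
have BA : A *m B ^t* = 0 by rewrite -[LHS]trmxCK adjmxM trmxCK AB adjmx0.
exists B; split=> //.
have W1 : col_mx A B *m (col_mx A B) ^t* = 1%:M.
  rewrite adjmx_col mul_col_row AB BA (unitarymxP uA) (unitarymxP uB).
  by rewrite -scalar_mx_block.
(* A one-sided inverse is two-sided for square matrices, and [m + (n - m)] is [n] only up to an
   equation; hence the variable [k]. *)
have W2 : forall k (W : 'M[C]_(k, n)), k = n -> W *m W ^t* = 1%:M ->
    W ^t* *m W = 1%:M 
    by move=> k W kn; case: n / kn W {uA O rA mn rO uB BO AB BA W1 A B} => W; exact: mulmx1C.
have := W2 _ _ (subnKC mn) W1.
by rewrite adjmx_col mul_row_col.
Qed.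

(** The Cholesky factor of the common Gram matrix orthonormalizes both families of rows. After
    completion to orthonormal bases, [V] sends the first basis to the second. *)
Lemma isometry_extend m n (A B : 'M[C]_(m, n)) :
  A *m A ^t* = B *m B ^t* -> posdef (A *m A ^t*) ->
  exists2 V, V \is unitarymx & B = A *m V.
Proof.
move=> AB pA; have [L hL LE] := cholesky pA.
have uL := lower_pos_unit hL.
have unit1 (X : 'M[C]_(m, n)) : X *m X ^t* = L *m L ^t* ->
    invmx L *m X \is unitarymx.
  move=> h; apply/unitarymxP; rewrite adjmxM adjmxV !mulmxA -(mulmxA _ X) h.
  by rewrite mulmxA mulVmx// mul1mx mulmxV// adjmx_unit.
have uA := unit1 _ LE; have uB : invmx L *m B \is unitarymx by rewrite unit1 -?AB.
have [A' [A1 [uA' A0]]] := unitarymx_complete uA.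
have [B' [B1 [uB' B0]]] := unitarymx_complete uB.
have [A2 A2E] : exists X, X = invmx L *m A by exists (invmx L *m A).
have [B2 B2E] : exists X, X = invmx L *m B by exists (invmx L *m B).
move: A1 A0 B1 B0 uA uB; rewrite -A2E -B2E => EA A0 EB B0 uA uB.
have B0' : B' *m B2 ^t* = 0 by rewrite -[LHS]trmxCK adjmxM trmxCK B0 adjmx0.
exists (A2 ^t* *m B2 + A' ^t* *m B').
  apply/unitarymxP; rewrite adjmxD !adjmxM !trmxCK mulmxDr !mulmxDl.
  rewrite !mulmxA -(mulmxA (A2 ^t*) B2) (unitarymxP uB) mulmx1.
  rewrite -(mulmxA (A' ^t*) B') B0' mulmx0 mul0mx addr0.
  rewrite -(mulmxA (A2 ^t*) B2) B0 mulmx0 mul0mx add0r.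
  by rewrite -(mulmxA (A' ^t*) B') (unitarymxP uB') mulmx1.
apply: (can_inj (mulKmx (_ : invmx L \in unitmx))); first by rewrite unitmx_inv.
rewrite mulmxA -A2E mulmxDr !mulmxA (unitarymxP uA) mul1mx A0 mul0mx addr0.
by rewrite B2E.
Qed.

End hermitian_bounds.

(** * Block Toeplitz matrices *)

Section toeplitz.
Variables (C : numClosedFieldType) (q : nat).
Local Notation p := q.+1.
Implicit Types (s : seq 'M[C]_p) (x y : nat).

(** The moment of order 0 is the total mass, the identity; orders beyond the sequence read as 0. *)
Definition moment_nth s k : 'M[C]_p := nth 0 (1%:M :: s) k.

(** A scalar index is split into its block [x %/ p] and its position [x %% p] in the block. Below
    the block diagonal the adjoint block is read, so that the matrix is Hermitian by
    construction. *)
Definition toep_entry s x y : C :=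
  if (x %/ p <= y %/ p)%N
  then moment_nth s (y %/ p - x %/ p) (inord (x %% p)) (inord (y %% p))
  else (moment_nth s (x %/ p - y %/ p) (inord (y %% p)) (inord (x %% p)))^*.

(* The [N]-th leading principal submatrix of the block Toeplitz matrix with first
   block row [1, s_1, s_2, ...]; [N] need not be a multiple of the block size. *)
Definition toep s N : 'M[C]_N := \matrix_(x, y) toep_entry s x y.

Lemma toep_herm s N : (toep s N) ^t* = toep s N.
Proof.
apply/matrixP => x y; rewrite !mxE /toep_entry.
case: (ltngtP (x %/ p) (y %/ p)) => [_|_|->] //=; first by rewrite conjCK.
by rewrite subnn /moment_nth /= !mxE eq_sym rmorph_nat.
Qed.

Lemma toep_entry_shift s x y :
  toep_entry s (p + x) (p + y) = toep_entry s x y.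
Proof. by rewrite /toep_entry !divnDl ?dvdnn// !divnn /= leq_add2l !subnDl !modnDl. Qed.

Lemma toep_drsub s N : drsubmx (toep s (p + N)) = toep s N.
Proof. by apply/matrixP => x y; rewrite !mxE /= toep_entry_shift. Qed.

Lemma toep_ulsub s N M : ulsubmx (toep s (N + M)) = toep s N.
Proof. by apply/matrixP => x y; rewrite !mxE. Qed.

Lemma toep_unit s : toep s p = 1%:M.
Proof.
apply/matrixP => x y; rewrite !mxE /toep_entry !divn_small// subnn /moment_nth.
by rewrite /= !modn_small// !mxE !inord_val.
Qed.

Lemma toep_block s N M :
  toep s (N + M) = block_mx (toep s N) (ursubmx (toep s (N + M)))
     (ursubmx (toep s (N + M)) ^t*) (drsubmx (toep s (N + M))).
Proof.
rewrite -[LHS]submxK toep_ulsub; congr block_mx.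
have := toep_herm s (N + M).
by rewrite -{1 2}[toep s (N + M)]submxK adjmx_block => /eq_block_mx[].
Qed.

(** The moment of order [k] links blocks at distance [k], so it first appears beyond the size
    [k * p]. Appending a moment thus leaves the earlier matrices unchanged. *)
Lemma eq_toep s s' N :
  (forall k, (k * p < N)%N -> moment_nth s k = moment_nth s' k) ->
  toep s N = toep s' N.
Proof.
move=> h; apply/matrixP => x y; rewrite !mxE /toep_entry.
have hk (z w : 'I_N) : moment_nth s (z %/ p - w %/ p) = moment_nth s' (z %/ p - w %/ p).
  apply: h; apply: leq_ltn_trans (ltn_ord z).
  apply: leq_trans (leq_trunc_div z p).
  by rewrite leq_mul2r leq_subr orbT.
by case: ifP => _; rewrite !hk.
Qed.

Lemma toep_rcons s (x : 'M[C]_p) :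
  toep (rcons s x) (p + size s * p) = toep s (p + size s * p).
Proof.
apply: eq_toep => k; rewrite -mulSn ltn_mul2r/= ltnS => ks.
case: k ks => [//|k ks]; rewrite /moment_nth /= nth_rcons ks//.
Qed.

Definition toep_ratio s n : C :=
  \det (toep s (p + n * p)) / \det (toep s (n * p)).

Definition toep_row s n : 'M[C]_(p, n * p) := ursubmx (toep s (p + n * p)).

Lemma toep_blockE s n : toep s (p + n * p) =
  block_mx 1%:M (toep_row s n) (toep_row s n ^t*) (toep s (n * p)).
Proof. by rewrite toep_block toep_drsub toep_unit. Qed.

Definition toep_schur s n : 'M[C]_p :=
  1%:M - toep_row s n *m invmx (toep s (n * p)) *m toep_row s n ^t*.

Lemma posdef_toep_dr s n : posdef (toep s (p + n * p)) ->
  posdef (toep s (n * p)) /\ posdef (toep_schur s n).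
Proof. by rewrite toep_blockE => /posdef_schur_dr. Qed.

Lemma toep_ratioE s n : posdef (toep s (p + n * p)) ->
  toep_ratio s n = \det (toep_schur s n).
Proof.
move=> /posdef_toep_dr[pM pL].
rewrite /toep_ratio toep_blockE det_schur_dr// mulrC mulKf//.
by rewrite gt_eqF// posdef_det_gt0.
Qed.

Lemma toep_ratio_gt0 s n : posdef (toep s (p + n * p)) -> 0 < toep_ratio s n.
Proof.
move=> h; rewrite toep_ratioE//.
by apply: posdef_det_gt0; have [] := posdef_toep_dr h.
Qed.

Lemma posdef_toep_le s N M : posdef (toep s (N + M)) -> posdef (toep s N).
Proof. by rewrite toep_block => /posdef_ulsub. Qed.

(* The matrices that extend [s] to a positive definite Toeplitz sequence form a
   matrix ball: the image of the strict contractions [A] under an affine map. *)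
Lemma toep_fiber s : let n := size s in
  posdef (toep s (p + n * p)) ->
  exists (c : 'M[C]_p) (P Q : 'M[C]_p),
    [/\ lower_pos P, lower_pos Q,
        \det P ^+ 2 = toep_ratio s n /\ \det Q ^+ 2 = toep_ratio s n &
        forall A, let s' := rcons s (c + P *m A *m Q ^t*) in
        (posdef (toep s' (p + n.+1 * p)) <-> posdef (1%:M - A ^t* *m A)) /\
        (posdef (1%:M - A ^t* *m A) ->
         toep_ratio s' n.+1 = toep_ratio s n * \det (1%:M - A ^t* *m A))].
Proof.
move=> n pT; have [pM pL] := posdef_toep_dr pT.
set F := toep_row s n in pM pL *; set M := toep s (n * p) in pM pL *.
have addC : (n * p + p)%N = (p + n * p)%N by rewrite addnC.
(* The same matrix is now read as [M] bordered on the other side: [F] is its first block row and [E]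
   its last block column, without the diagonal block. Hence both Schur complements of [M] have the
   determinant [toep_ratio s n]. *)
pose E := ursubmx (toep s (n * p + p)).
have TE : toep s (n * p + p) = block_mx M E (E ^t*) 1%:M.
  rewrite toep_block; congr block_mx; apply/matrixP => x y; rewrite !mxE /=.
  by rewrite -mulnC /toep_entry !(mulnC p) !divnMDl// !divn_small ?ltn_ord// !addn0
    subnn leqnn /moment_nth /= !modnMDl !modn_small ?ltn_ord// !mxE !inord_val.
pose R := 1%:M - E ^t* *m invmx M *m E.
have pT' : posdef (toep s (n * p + p)) by rewrite addC.
have [_ pR] : posdef M /\ posdef R by move: pT'; rewrite TE => /posdef_schur.
have detR : \det R = toep_ratio s n.
  rewrite /toep_ratio -/M -addC TE det_schur// mulrC mulKf//.
  by rewrite gt_eqF// posdef_det_gt0.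
have [P hP PE] := cholesky pL; have [Q hQ QE] := cholesky pR.
have uP := lower_pos_unit hP; have uQ := lower_pos_unit hQ.
have dP : \det P ^+ 2 = toep_ratio s n.
  by rewrite -lower_pos_det_adj// -PE toep_ratioE.
have dQ : \det Q ^+ 2 = toep_ratio s n by rewrite -lower_pos_det_adj// -QE.
exists (F *m invmx M *m E), P, Q; split=> // A s'.
have T's' : toep s' (p + n * p) = toep s (p + n * p) by exact: toep_rcons.
(* In the last block column only the top block is new; below it stands [E], by shift invariance. *)
have TS : toep s' ((p + n * p) + p) =
    block_mx (toep s (p + n * p))
      (col_mx (F *m invmx M *m E + P *m A *m Q ^t*) E)
      ((col_mx (F *m invmx M *m E + P *m A *m Q ^t*) E) ^t*) 1%:M.
  have urE : ursubmx (toep s' ((p + n * p) + p)) =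
      col_mx (F *m invmx M *m E + P *m A *m Q ^t*) E.
    rewrite -[LHS]vsubmxK; congr col_mx; apply/matrixP => x y; rewrite !mxE /=.
      rewrite /toep_entry -mulSn mulnC divn_small ?ltn_ord// leq0n subn0.
      rewrite mulnC divnMDl// divn_small ?ltn_ord// addn0 modnMDl.
      rewrite !modn_small ?ltn_ord// !inord_val /moment_nth /= nth_rcons.
      by rewrite ltnn eqxx !mxE.
    rewrite -addnA toep_entry_shift.
    have := toep_rcons s (F *m invmx M *m E + P *m A *m Q ^t*).
    rewrite -addC => /matrixP/(_ (lshift p x) (rshift (n * p) y)).
    by rewrite !mxE.
  rewrite toep_block urE T's'; congr block_mx.
  apply/matrixP => x y; rewrite !mxE /= -mulSn.
  by rewrite /toep_entry !divnMDl// !divn_small ?ltn_ord// !addn0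
    subnn leqnn /moment_nth /= !modnMDl !modn_small ?ltn_ord// !mxE !inord_val.
(* By [schur_corner] the Schur complement is [R] minus the form of [invmx (P *m P ^t* )] at
   [P *m A *m Q ^t*]: the factors [P] cancel and [Q] comes out on both sides. *)
have SE : 1%:M - (col_mx (F *m invmx M *m E + P *m A *m Q ^t*) E) ^t* *m
     invmx (toep s (p + n * p)) *m col_mx (F *m invmx M *m E + P *m A *m Q ^t*) E =
   Q *m (1%:M - A ^t* *m A) *m Q ^t*.
  rewrite toep_blockE -/F -/M schur_corner//.
  rewrite (_ : 1%:M - F *m invmx M *m F ^t* = P *m P ^t*)//.
  rewrite (_ : F *m invmx M *m E + _ - _ = P *m A *m Q ^t*); last first.
    by rewrite addrAC subrr add0r.
  rewrite mulmxBr mulmxBl mulmx1 -QE /R opprD addrA; congr (_ - _).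
  have uP' : P ^t* \in unitmx by rewrite adjmx_unit.
  rewrite !adjmxM trmxCK (invrM uP uP' : invmx (P *m P ^t*) = invmx (P ^t*) *m invmx P).
  rewrite !mulmxA.
  rewrite -(mulmxA (Q *m A ^t*)) mulmxV ?adjmx_unit// mulmx1.
  by rewrite -(mulmxA (Q *m A ^t*)) mulVmx// mulmx1.
have addC' : (p + n.+1 * p)%N = (p + n * p + p)%N by rewrite -mulSn mulSnr.
have QQ : posdef (Q *m (1%:M - A ^t* *m A) *m Q ^t*) <-> posdef (1%:M - A ^t* *m A).
  have uQ' : Q ^t* \in unitmx by rewrite adjmx_unit.
  by have := posdef_congrE (1%:M - A ^t* *m A) uQ'; rewrite trmxCK.
rewrite addC'; split.
  rewrite TS posdef_schur SE; split=> [[_]|h]; first by move/QQ.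
  by split=> //; apply/QQ.
move=> pA; rewrite /toep_ratio addC' TS det_schur// SE -mulSn in T's' *.
rewrite T's' mulrAC mulfV ?mul1r; last by rewrite gt_eqF// posdef_det_gt0.
rewrite !det_mulmx det_adjmx mulrAC (_ : (\det Q)^* = \det Q).
  by rewrite -expr2 dQ.
by apply/CrealP; rewrite realE ltW// lower_pos_det_gt0.
Qed.

Lemma toep_fiber_neg s (x : 'M[C]_p) : ~ posdef (toep s (p + size s * p)) ->
  ~ posdef (toep (rcons s x) (p + (size s).+1 * p)).
Proof.
move=> h; rewrite mulSnr addnA => /posdef_toep_le.
by rewrite toep_rcons.
Qed.

Lemma moment_nth_scale s (t : C) k : moment_nth [seq t *: M | M <- s] k =
  t *: moment_nth s k + (1 - t) *: (if k == 0 then 1%:M else 0).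
Proof.
case: k => [|k]; rewrite /moment_nth /=.
  by rewrite -scalerDl addrC subrK scale1r.
rewrite scaler0 addr0; have [ks|sk] := ltnP k (size s); first by rewrite (nth_map 0).
by rewrite !nth_default ?size_map// scaler0.
Qed.

(** The moment of order 0 remains 1, so shrinking the others moves the matrix towards the identity
    along a segment. This serves both for the boundary of the moment space and for the limit of
    small moments. *)
Lemma toep_scale s N (t : C) : t \is Num.real ->
  toep [seq t *: M | M <- s] N = t *: toep s N + (1 - t)%:M.
Proof.
move=> /CrealP tK; apply/matrixP => x y; rewrite !mxE /toep_entry !moment_nth_scale.
case: (ltngtP (x %/ p) (y %/ p)) => /= [xy|xy|xy].
- rewrite subn_eq0 leqNgt xy /= scaler0 addr0 mxE.
  by case: eqP => [e|_]; [rewrite e ltnn in xy|rewrite mulr0n addr0].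
- rewrite subn_eq0 leqNgt xy /= scaler0 addr0 mxE rmorphM /= tK.
  by case: eqP => [e|_]; [rewrite e ltnn in xy|rewrite mulr0n addr0].
- rewrite xy subnn /= !mxE; congr (_ + _); rewrite -[RHS]mulr_natr; congr (_ * _%:R).
  have [->|xy'] := eqVneq x y; first by rewrite eqxx.
  case: eqP => // /(congr1 (@nat_of_ord p)); rewrite !inordK ?ltn_pmod// => m.
  case/negP : xy'; apply/eqP/val_inj.
  by change (x = y :> nat); rewrite (divn_eq x p) (divn_eq y p) xy m.
Qed.

Lemma toep_trace s N : \tr (toep s N) = N%:R.
Proof.
rewrite /mxtrace (eq_bigr (fun=> 1)) => [|i _]; first by rewrite sumr_const card_ord.
by rewrite mxE /toep_entry leqnn subnn /moment_nth /= mxE eqxx.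
Qed.

Lemma toep_entry_row s N (x y : 'I_N) (a : 'I_p) j (b : 'I_p) :
  x = a :> nat -> y = (j * p + b)%N :> nat -> toep s N x y = moment_nth s j a b.
Proof.
move=> xa yb; rewrite mxE /toep_entry xa yb divn_small ?ltn_ord// leq0n subn0.
by rewrite divnMDl// divn_small ?ltn_ord// addn0 modnMDl !modn_small ?ltn_ord// !inord_val.
Qed.

(* In a factorization of the Toeplitz matrix, the first [n] block rows and the last
   [n] ones have the same Gram matrix; the isometry between them extends to a unitary
   matrix, whose eigenvalues are the atoms [z i]. *)
Lemma toep_representation s : let n := size s in
  posdef (toep s (p + n * p)) ->
  exists N (z : 'I_N -> C) (M : 'I_N -> 'M[C]_p),
    [/\ forall i, `|z i| = 1, forall i, psd (M i) &
        forall l, (l <= n)%N -> \sum_i z i ^+ l *: M i = moment_nth s l].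
Proof.
move=> n pT; have [R hR RE] := cholesky pT.
have wn : (n * p <= p + n * p)%N by rewrite leq_addl.
(* The rows of [R] are vectors with Toeplitz Gram matrix: [R1] holds the block rows 0 to n - 1, [R2]
   the block rows 1 to n, and [R0] the first one. *)
pose R1 := rowsub (widen_ord wn) R; pose R2 := dsubmx R; pose R0 := usubmx R.
have R1E : R1 *m R1 ^t* = toep s (n * p).
  apply/matrixP => x y; rewrite !mxE.
  move/matrixP/(_ (widen_ord wn x) (widen_ord wn y)) : RE; rewrite !mxE /= => ->.
  by apply: eq_bigr => i _; rewrite !mxE.
have R2E : R2 *m R2 ^t* = toep s (n * p).
  apply/matrixP => x y; rewrite !mxE.
  move/matrixP/(_ (rshift p x) (rshift p y)) : RE; rewrite !mxE /= toep_entry_shift => ->.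
  by apply: eq_bigr => i _; rewrite !mxE.
have [V uV VE] : exists2 V, V \is unitarymx & R2 = R1 *m V.
  apply: isometry_extend; first by rewrite R1E R2E.
  by rewrite R1E; have [] := posdef_toep_dr pT.
have uV' : V ^t* \is unitarymx by rewrite trmxC_unitary.
have nV : V ^t* \is normalmx.
  apply/normalmxP; rewrite (unitarymxP uV') trmxCK.
  by apply/esym/mulmx1C; have := unitarymxP uV'; rewrite trmxCK.
have := orthomx_spectralP nV.
set P := spectralmx _; set d := spectral_diag _.
have uP : P \is unitarymx := spectral_unitarymx _.
have PP : P ^t* *m P = 1%:M by apply: mulmx1C; exact/unitarymxP.
rewrite invmx_unitary// => dE.
(* The moments involve powers of [V ^t*], which is therefore the matrix that is diagonalized; powers
   of [V] itself carry the conjugate eigenvalues. *)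
pose D j := diag_mx (\row_i (d 0 i)^* ^+ j).
have D1 : (diag_mx d) ^t* = D 1.
  apply/matrixP => x y; rewrite !mxE eq_sym expr1; case: eqP => [->//|_].
  by rewrite !mulr0n rmorph0.
have DS j : D j.+1 = D j *m D 1.
  rewrite /D mulmx_diag; congr diag_mx; apply/rowP => i.
  by rewrite !mxE expr1 exprSr.
have VD : V = P ^t* *m D 1 *m P.
  by rewrite -[LHS]trmxCK dE !adjmxM trmxCK D1 mulmxA.
have dd i : d 0 i * (d 0 i)^* = 1.
  have : D 1 *m (D 1) ^t* = 1%:M.
    have := unitarymxP uV; rewrite VD !adjmxM trmxCK !mulmxA.
    rewrite -(mulmxA _ P) (unitarymxP uP) mulmx1 => h.
    have := congr1 (fun X => P *m X *m P ^t*) h.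
    rewrite /= mulmx1 (unitarymxP uP) !mulmxA (unitarymxP uP) mul1mx.
    by rewrite -!mulmxA (unitarymxP uP) mulmx1.
  rewrite -D1 trmxCK D1 => /matrixP/(_ i i); rewrite mul_mx_diag !mxE eqxx expr1.
  by rewrite !mulr1n mulrC.
(* Iterating [R2 = R1 *m V]: the block row [j] is [R0] times the power [j] of [V]. *)
have rowR j (b : 'I_p) (h : (j * p + b < p + n * p)%N) :
    row (Ordinal h) R = row b R0 *m (P ^t* *m D j *m P).
  elim: j h => [|j IH] h.
    have -> : D 0%N = 1%:M.
      by apply/matrixP => x y; rewrite !mxE expr0.
    rewrite mulmx1 PP mulmx1; apply/rowP => i; rewrite !mxE.
    by congr (R _ _); apply: val_inj.
  have h1 : (j * p + b < n * p)%N by rewrite mulSn -addnA ltn_add2l in h.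
  have h2 : (j * p + b < p + n * p)%N by rewrite (leq_trans h1).
  have -> : row (Ordinal h) R = row (Ordinal h1) R2.
    apply/rowP => i; rewrite !mxE; congr (R _ _); apply: val_inj => /=.
    by rewrite mulSn addnA.
  have -> : row (Ordinal h1) R2 = row (Ordinal h2) R *m V.
    rewrite VE row_mul; congr (_ *m _); apply/rowP => i; rewrite !mxE.
    by congr (R _ _); apply: val_inj.
  rewrite IH VD -!mulmxA; congr (_ *m (_ *m _)).
  by rewrite DS !mulmxA -(mulmxA (D j) P) (unitarymxP uP) mulmx1.
pose W := R0 *m P ^t*.
exists (p + n * p)%N, (fun i => d 0 i), (fun i => col i W *m (col i W) ^t*).
split=> [i|i|l ln].
- by apply/eqP; rewrite -sqrp_eq1// normCK dd.
- have := psd_congr ((col i W) ^t*) (posdef_psd (posdef1 C 1)).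
  by rewrite mulmx1 trmxCK.
apply/matrixP => a b.
have ha : (a < p + n * p)%N by rewrite ltn_addr.
have hb : (l * p + b < p + n * p)%N.
  rewrite -mulSn; apply: (@leq_trans (l.+1 * p)%N).
    by rewrite mulSnr ltn_add2l.
  by rewrite leq_mul2r ltnS ln orbT.
rewrite -(@toep_entry_row s _ (Ordinal ha) (Ordinal hb))// RE.
have -> : (R *m R ^t*) (Ordinal ha) (Ordinal hb) =
    (row (Ordinal ha) R *m (row (Ordinal hb) R) ^t*) 0 0.
  by rewrite !mxE; apply: eq_bigr => i _; rewrite !mxE.
have ha0 : (0 * p + a < p + n * p)%N by rewrite mul0n.
have -> : Ordinal ha = Ordinal ha0 by apply: val_inj.
rewrite !rowR -/W !adjmxM trmxCK -!mulmxA.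
have -> : D 0%N = 1%:M by apply/matrixP => x y; rewrite !mxE expr0.
rewrite mul1mx (mulmxA P) (unitarymxP uP) mul1mx.
have hW c : row c R0 *m P ^t* = row c W by rewrite row_mul.
rewrite mulmxA hW; have -> : P *m row b R0 ^t* = (row b W) ^t*.
  by rewrite -hW adjmxM trmxCK.
have -> : (D l) ^t* = diag_mx (\row_i d 0 i ^+ l).
  apply/matrixP => x y; rewrite !mxE eq_sym; case: eqP => [->|_].
    by rewrite !mulr1n rmorphXn /= conjCK.
  by rewrite !mulr0n rmorph0.
rewrite summxE [RHS]mxE; apply: eq_bigr => i _.
by rewrite mul_diag_mx !mxE big_ord1 !mxE mulrCA.
Qed.

End toeplitz.

(** * Changes of variables *)

Lemma index_allpairs (S T : eqType) (s : seq S) (t : seq T) x y :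
  x \in s -> y \in t ->
  index (x, y) [seq (a, b) | a <- s, b <- t] = (index x s * size t + index y t)%N.
Proof.
elim: s => // a s IH; rewrite inE allpairs_cons index_cat.
have inj : injective (pair a : T -> S * T) by move=> b c [].
have [->|xa] := eqVneq x a => /= xs yt.
  by rewrite mem_map// yt index_map// ?eqxx.
rewrite ifF; last by apply/mapP => -[b _ [ax _]]; rewrite ax eqxx in xa.
by rewrite size_map IH// eq_sym (negbTE xa) mulSn addnA.
Qed.

(** Entries are enumerated row by row; in this order a Kronecker product of lower triangular
    matrices is lower triangular. *)
Lemma mxvec_index_val m n (i : 'I_m) (j : 'I_n) :
  mxvec_index i j = (i * n + j)%N :> nat.
Proof.
rewrite /mxvec_index /=.
have -> : (i * n + j)%N = index (i, j) [seq (a, b) | a <- enum 'I_m, b <- enum 'I_n].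
  by rewrite index_allpairs ?mem_enum// !index_enum_ord size_enum_ord.
have -> : [seq (a, b) | a <- enum 'I_m, b <- enum 'I_n] = enum {: 'I_m * 'I_n}.
  by rewrite [in RHS]enumT unlock.
rewrite -[in RHS](enum_rankK (i, j)) index_uniq ?enum_uniq// -cardE.
exact: ltn_ord.
Qed.

Section scales.
Context d (T : measurableType d) (R : realType).
Variable mu : {measure set T -> \bar R}.

(** Change of variables with constant Jacobian [a]. In terms of integrals it passes to products and
    images without mention of an inverse of [f]. *)
Definition scales (f : T -> T) (a : R) := measurable_fun setT f /\
  forall g : T -> \bar R, measurable_fun setT g -> (forall x, 0 <= g x)%E ->
    (\int[mu]_x g x = a%:E * \int[mu]_x g (f x))%E.

End scales.

Section integral_image.
Context d1 d2 (T1 : measurableType d1) (T2 : measurableType d2) (R : realType).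
Local Open Scope ereal_scope.

Lemma integral_image (mu : {sigma_finite_measure set T1 -> \bar R})
    (f : T1 -> T2) (h : T2 -> T1) (mf : measurable_fun setT f)
    (mh : measurable_fun setT h) (fK : cancel f h) (g : T2 -> \bar R) :
  measurable_fun setT g -> (forall x, 0 <= g x) ->
  \int[image_measure mu mf mh fK]_x g x = \int[mu]_x g (f x).
Proof. by move=> mg g0; rewrite ge0_integral_pushforward. Qed.

End integral_image.

Section lebesgue_scales.
Variable R : realType.
Local Open Scope ereal_scope.
Notation leb := (@lebesgue_measure R).

Lemma scales_lebesgue (a b : R) : (0 < a)%R ->
  scales leb (fun x : measurableTypeR R => a * x + b)%R a.
Proof.
move=> a0; pose f (x : measurableTypeR R) : measurableTypeR R := (a * x + b)%R.
have mf : measurable_fun setT f.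
  by apply: measurable_funD => //; apply: measurable_funM.
split=> // g mg g0.
have a0' : (0 <= a)%R := ltW a0.
pose f' (x : measurableTypeR R) : measurableTypeR R := ((x - b) / a)%R.
have mf' : measurable_fun setT f'.
  by apply: measurable_funM => //; apply: measurable_funB.
have fK : cancel f f'.
  by move=> x; rewrite /f /f' addrK mulrAC divff ?mul1r// gt_eqF.
(* Lebesgue measure is determined by its values on half-open intervals, where [nu] agrees with
   it. *)
pose nu := mscale (NngNum a0') (image_measure leb mf mf' fK).
have eqnu A : measurable A -> leb A = nu A.
  apply: lebesgue_measure_unique => X /ocitvP[->|[[c e] /= ce ->]].
    by rewrite !measure0.
  rewrite /nu /mscale /= /image_measure_fun /pushforward.
  have -> : f @^-1` `]c, e]%classic = `]((c - b) / a)%R, ((e - b) / a)%R]%classic.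
    apply/seteqP; split=> x /=; rewrite !in_itv /= /f ltr_pdivrMr// ler_pdivlMr//.
      by rewrite ltrBlDr lerBrDr mulrC.
    by rewrite ltrBlDr lerBrDr mulrC.
  rewrite !lebesgue_measure_itv /= !lte_fin ce ltr_pM2r ?invr_gt0// ltrD2r ce.
  rewrite -!EFinD -EFinM; congr EFin; field.
  by rewrite gt_eqF.
rewrite (eq_measure_integral nu) => [|A mA _]; last exact: eqnu.
rewrite ge0_integral_mscale//; congr (_ * _).
by rewrite integral_image.
Qed.

End lebesgue_scales.

Section product_scales.
Context d1 d2 (T1 : measurableType d1) (T2 : measurableType d2) (R : realType).
Local Open Scope ereal_scope.

Lemma integral_product (m1 : {sigma_finite_measure set T1 -> \bar R})
    (m2 : {sigma_finite_measure set T2 -> \bar R}) (g : T1 * T2 -> \bar R) :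
  measurable_fun setT g -> (forall x, 0 <= g x) ->
  \int[product_measure m1 m2]_x g x = \int[m1]_x \int[m2]_y g (x, y).
Proof. by move=> mg g0; rewrite fubini_tonelli1. Qed.

(** By Tonelli. The second map may depend on the first variable as long as its Jacobian does not,
    which covers triangular maps. *)
Lemma scales_product (m1 : {sigma_finite_measure set T1 -> \bar R})
    (m2 : {sigma_finite_measure set T2 -> \bar R})
    (f1 : T1 -> T1) (f2 : T1 -> T2 -> T2) (a b : R) :
  (0 <= b)%R ->
  measurable_fun setT (fun x : T1 * T2 => (f1 x.1, f2 x.1 x.2)) ->
  scales m1 f1 a -> (forall x, scales m2 (f2 x) b) ->
  scales (product_measure m1 m2) (fun x => (f1 x.1, f2 x.1 x.2)) (a * b).
Proof.
move=> b0 mf [mf1 h1] h2; split=> // g mg g0.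
rewrite !integral_product//; last exact: measurableT_comp mg mf.
have mF : measurable_fun setT (fun x => \int[m2]_y g (x, y)).
  exact: measurable_fun_fubini_tonelli_F.
rewrite h1//; last by move=> x; exact: integral_ge0.
rewrite EFinM -muleA; congr (_ * _).
rewrite -ge0_integralZl//; first last.
- by move=> x _; exact: integral_ge0.
- have mgf : measurable_fun setT (fun x : T1 * T2 => g (f1 x.1, f2 x.1 x.2)).
    exact: measurableT_comp mg mf.
  exact: (measurable_fun_fubini_tonelli_F _ mgf).
apply: eq_integral => x _; have [_ ->//] := h2 x.
exact: measurableT_comp mg (measurable_pair1 _).
Qed.

Lemma scales_image (mu : {sigma_finite_measure set T1 -> \bar R})
    (f : T1 -> T2) (h : T2 -> T1) (mf : measurable_fun setT f)
    (mh : measurable_fun setT h) (fK : cancel f h) (F : T1 -> T1) (a : R) :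
  scales mu F a -> scales (image_measure mu mf mh fK) (f \o F \o h) a.
Proof.
move=> [mF hF]; have mFf : measurable_fun setT (f \o F \o h).
  by apply: measurableT_comp => //; exact: measurableT_comp.
split=> // g mg g0.
have mgF : measurable_fun setT (g \o (f \o F \o h)) := measurableT_comp mg mFf.
rewrite integral_image// (integral_image mu mf mh fK mgF); last first.
  by move=> x; exact: g0.
have mgf : measurable_fun setT (g \o f) by exact: measurableT_comp.
rewrite (hF _ mgf); last by move=> x; exact: g0.
by congr (_ * _); apply: eq_integral => x _ /=; rewrite fK.
Qed.

End product_scales.

Section complex_scales.
Variable R : realType.
Local Open Scope complex_scope.

Lemma measurable_Re : measurable_fun setT (@complex.Re R : R[i] -> R).
Proof. exact: measurableT_comp measurable_fst (@measurable_complex_pair R). Qed.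

Lemma measurable_Im : measurable_fun setT (@complex.Im R : R[i] -> R).
Proof. exact: measurableT_comp measurable_snd (@measurable_complex_pair R). Qed.

Lemma measurable_Complex d (T : measurableType d) (f g : T -> R) :
  measurable_fun setT f -> measurable_fun setT g ->
  measurable_fun setT (fun x => Complex (f x) (g x) : R[i]).
Proof.
move=> mf mg.
have h : measurable_fun setT
    (fun x => (f x, g x) : measurableTypeR R * measurableTypeR R).
  exact: measurable_fun_pair.
exact: (measurableT_comp (@measurable_pair_complex R) h).
Qed.

Lemma measurable_complexP d (T : measurableType d) (f : T -> R[i]) :
  measurable_fun setT (fun x => complex.Re (f x)) ->
  measurable_fun setT (fun x => complex.Im (f x)) -> measurable_fun setT f.
Proof.
move=> m1 m2; rewrite (_ : f = fun x => Complex (complex.Re (f x)) (complex.Im (f x))).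
  exact: measurable_Complex.
by apply/funext => x; case: (f x).
Qed.

Section operations.
Context d (T : measurableType d).
Implicit Types f g : T -> R[i].

Lemma measurable_complexD f g : measurable_fun setT f -> measurable_fun setT g ->
  measurable_fun setT (fun x => f x + g x).
Proof.
move=> mf mg; have mRe h (mh : measurable_fun setT h) := measurableT_comp measurable_Re mh.
have mIm h (mh : measurable_fun setT h) := measurableT_comp measurable_Im mh.
apply: measurable_complexP.
  rewrite (_ : (fun x => _) = (fun x => complex.Re (f x) + complex.Re (g x))).
    by apply: measurable_funD; exact: mRe.
  by apply/funext => x; case: (f x); case: (g x).
rewrite (_ : (fun x => _) = (fun x => complex.Im (f x) + complex.Im (g x))).
  by apply: measurable_funD; exact: mIm.
by apply/funext => x; case: (f x); case: (g x).
Qed.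

Lemma measurable_complexM f g : measurable_fun setT f -> measurable_fun setT g ->
  measurable_fun setT (fun x => f x * g x).
Proof.
move=> mf mg; have mRe h (mh : measurable_fun setT h) := measurableT_comp measurable_Re mh.
have mIm h (mh : measurable_fun setT h) := measurableT_comp measurable_Im mh.
apply: measurable_complexP.
  rewrite (_ : (fun x => _) = (fun x => complex.Re (f x) * complex.Re (g x)
     - complex.Im (f x) * complex.Im (g x))).
    by apply: measurable_funB; apply: measurable_funM;
      (exact: mRe || exact: mIm).
  by apply/funext => x; case: (f x); case: (g x).
rewrite (_ : (fun x => _) = (fun x => complex.Re (f x) * complex.Im (g x)
     + complex.Im (f x) * complex.Re (g x))).
  by apply: measurable_funD; apply: measurable_funM;
      (exact: mRe || exact: mIm).
by apply/funext => x; case: (f x); case: (g x).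
Qed.

Lemma measurable_complex_conj f : measurable_fun setT f ->
  measurable_fun setT (fun x => (f x)^*)%R.
Proof.
move=> mf; apply: measurable_complexP.
  rewrite (_ : (fun x => _) = (fun x => complex.Re (f x))).
    exact: measurableT_comp measurable_Re mf.
  by apply/funext => x; case: (f x).
rewrite (_ : (fun x => _) = (fun x => - complex.Im (f x))).
  by apply: measurable_funN; exact: measurableT_comp measurable_Im mf.
by apply/funext => x; case: (f x).
Qed.

Lemma measurable_complex_sum (I : Type) (r : seq I) (P : pred I) (F : I -> T -> R[i]) :
  (forall i, measurable_fun setT (F i)) ->
  measurable_fun setT (fun x => \sum_(i <- r | P i) F i x).
Proof.
move=> mF; elim: r => [|i r IH].
  by rewrite (_ : (fun x => _) = cst 0)//; apply/funext => x; rewrite big_nil.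
rewrite (_ : (fun x => _) = (fun x => (if P i then F i x else 0) +
   \sum_(i <- r | P i) F i x)).
  by apply: measurable_complexD => //; case: (P i).
by apply/funext => x; rewrite big_cons; case: ifP => //; rewrite add0r.
Qed.

Lemma measurable_complex_prod (I : Type) (r : seq I) (P : pred I) (F : I -> T -> R[i]) :
  (forall i, measurable_fun setT (F i)) ->
  measurable_fun setT (fun x => \prod_(i <- r | P i) F i x).
Proof.
move=> mF; elim: r => [|i r IH].
  by rewrite (_ : (fun x => _) = cst 1)//; apply/funext => x; rewrite big_nil.
rewrite (_ : (fun x => _) = (fun x => (if P i then F i x else 1) *
   \prod_(i <- r | P i) F i x)).
  by apply: measurable_complexM => //; case: (P i).
by apply/funext => x; rewrite big_cons; case: ifP => //; rewrite mul1r.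
Qed.

End operations.

(** A positive complex number is real, so [a] dilates the real and imaginary parts separately and
    each contributes one factor. *)
Lemma scales_complex (a b : R[i]) : 0 < a ->
  scales (complex_lebesgue R) (fun z => a * z + b) (complex.Re a ^+ 2).
Proof.
case: a b => a1 a2 [b1 b2]; rewrite ltcE /= => /andP[/eqP -> a0].
have h c := scales_lebesgue c a0.
have mid : measurable_fun setT (fun x : measurableTypeR R * measurableTypeR R =>
    (a1 * x.1 + b1, a1 * x.2 + b2)).
  apply: measurable_fun_pair; apply: measurable_funD => //;
  by apply: measurable_funM.
have := scales_product (ltW a0) mid (h b1) (fun=> h b2).
move=> /(scales_image (@measurable_pair_complex R) (@measurable_complex_pair R)
   (@pair_complexK R)).
rewrite -expr2; congr scales; apply/funext => -[x y] /=.
rewrite /pair_complex /complex_pair /=.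
by apply/eqP; rewrite eq_complex /= !mul0r subr0 addr0 !eqxx.
Qed.

End complex_scales.

Section tuple_integral.
Context d (T : measurableType d) (R : realType).
Variable mu : {sigma_finite_measure set T -> \bar R}.
Local Open Scope ereal_scope.
Local Notation tmu := (tuple_product_measure mu).

(** One function for all lengths: prefixes and appended elements change the length of a tuple, and
    sequences avoid the casts. *)
Definition seq_measurable (h : seq T -> \bar R) :=
  forall n, measurable_fun setT (fun t : n.-tuple T => h t).

Lemma measurable_rcons_tuple n :
  measurable_fun setT (fun z : n.-tuple T * T => [tuple of rcons z.1 z.2]).
Proof.
apply/measurable_fun_tnthP => i.
have [ilt|ige] := ltnP i n.
  rewrite (_ : _ \o _ = (fun t => tnth t (Ordinal ilt)) \o fst).
    exact: measurableT_comp (measurable_tnth _) measurable_fst.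
  apply/funext => -[t x] /=; rewrite !(tnth_nth x) /= nth_rcons size_tuple.
  by rewrite ilt.
rewrite (_ : _ \o _ = snd); first exact: measurable_snd.
apply/funext => -[t x] /=; rewrite (tnth_nth x) /= nth_rcons size_tuple ltnNge ige /=.
by rewrite eqn_leq ige -ltnS ltn_ord.
Qed.

Lemma seq_measurable_rcons h n : seq_measurable h ->
  measurable_fun setT (fun z : n.-tuple T * T => h (rcons z.1 z.2)).
Proof.
by move=> mh; exact: measurableT_comp (mh _) (@measurable_rcons_tuple n).
Qed.

Lemma seq_measurable_cons2 h n : seq_measurable h ->
  measurable_fun setT (fun z : T * n.-tuple T => h (z.1 :: z.2)).
Proof.
by move=> mh; exact: measurableT_comp (mh _) (@measurable_tuple_cons _ T n).
Qed.

Lemma seq_measurable_cons h x : seq_measurable h ->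
  seq_measurable (fun s => h (x :: s)).
Proof.
move=> mh n; have mx : measurable_fun setT (pair x : n.-tuple T -> T * n.-tuple T).
  exact: measurable_pair1.
rewrite (_ : (fun t => _) = (fun z : T * n.-tuple T => h (z.1 :: z.2)) \o pair x)//.
have H := measurableT_comp (seq_measurable_cons2 mh) mx.
exact: H.
Qed.

Lemma seq_measurable_integral h : seq_measurable h -> (forall s, 0 <= h s) ->
  seq_measurable (fun s => \int[mu]_y h (rcons s y)).
Proof.
move=> mh h0 n.
apply: (measurable_fun_fubini_tonelli_F
  (fun z : n.-tuple T * T => h (rcons z.1 z.2))) => //.
exact: seq_measurable_rcons.
Qed.

Lemma integral_tuple0 (h : 0.-tuple T -> \bar R) : measurable_fun setT h ->
  \int[tmu 0]_t h t = h [tuple].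
Proof. by move=> mh; rewrite integral_dirac// diracT mul1e. Qed.

Lemma integral_tuple_cons n (g : n.+1.-tuple T -> \bar R) :
  measurable_fun setT g -> (forall t, 0 <= g t) ->
  \int[tmu n.+1]_t g t = \int[mu]_x \int[tmu n]_t g (tuple_cons (x, t)).
Proof.
move=> mg g0; rewrite integral_image//.
rewrite (integral_product _ _ (g := fun x => g (tuple_cons x)))//.
exact: measurableT_comp mg (@measurable_tuple_cons _ T n).
Qed.

Lemma integral_seq_cons n h : seq_measurable h -> (forall s, 0 <= h s) ->
  \int[tmu n.+1]_t h t = \int[mu]_x \int[tmu n]_t h (x :: t).
Proof. by move=> mh h0; rewrite (integral_tuple_cons (mh n.+1)). Qed.

(** The product measure adds coordinates in front, whereas the moments are integrated out from the
    last one. Peeling off the head on both sides settles this without exchanging integrals. *)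
Lemma integral_tuple_rcons n h : seq_measurable h -> (forall s, 0 <= h s) ->
  \int[tmu n.+1]_t h t = \int[tmu n]_t \int[mu]_y h (rcons t y).
Proof.
elim: n h => [|n IH] h mh h0.
  rewrite integral_seq_cons// integral_tuple0; last exact: seq_measurable_integral.
  apply: eq_integral => x _; rewrite integral_tuple0//.
  exact: (seq_measurable_cons x mh).
rewrite integral_seq_cons//.
rewrite (integral_seq_cons n (h := fun s => \int[mu]_y h (rcons s y))); first last.
- by move=> s; exact: integral_ge0.
- exact: seq_measurable_integral.
apply: eq_integral => x _; rewrite (IH (fun s => h (x :: s)))//.
exact: seq_measurable_cons.
Qed.

End tuple_integral.

Lemma tnth_uncons (T : Type) n (t : n.+1.-tuple T) j :
  tnth t (lift ord0 j) = tnth (tuple_uncons t).2 j.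
Proof. by rewrite !(tnth_nth (thead t)) /= nth_behead. Qed.

Lemma tnth_cons0 (T : Type) n (x : T) (t : n.-tuple T) :
  tnth (tuple_cons (x, t)) ord0 = x.
Proof. by []. Qed.

Lemma tnth_consS (T : Type) n (x : T) (t : n.-tuple T) j :
  tnth (tuple_cons (x, t)) (lift ord0 j) = tnth t j.
Proof. by rewrite !(tnth_nth x). Qed.

Section affine_scales.
Variable R : realType.
Local Notation C := R[i].
Local Notation cmu := (complex_lebesgue R).

Definition affine_tuple n (K : 'M[C]_n) (b : 'I_n -> C) (t : n.-tuple C) :
  n.-tuple C := [tuple b i + \sum_j K i j * tnth t j | i < n].

Lemma measurable_affine_tuple n (K : 'M[C]_n) (b : 'I_n -> C) :
  measurable_fun setT (affine_tuple K b).
Proof.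
apply/measurable_fun_tnthP => i.
rewrite (_ : _ \o _ = fun t => b i + \sum_j K i j * tnth t j).
  apply: measurable_complexD => //; apply: measurable_complex_sum => j.
  by apply: measurable_complexM => //; exact: measurable_tnth.
by apply/funext => t /=; rewrite tnth_mktuple.
Qed.

Lemma scales_affine_tuple n (K : 'M[C]_n) (b : 'I_n -> C) : lower_pos K ->
  scales (tuple_product_measure cmu n) (affine_tuple K b)
    (\prod_i complex.Re (K i i) ^+ 2).
Proof.
elim: n K b => [|n IH] K b [tK dK].
  split; first exact: measurable_affine_tuple.
  move=> g mg g0; rewrite big_ord0 mul1e; apply: eq_integral => t _.
  by congr g; rewrite (tuple0 t) [RHS]tuple0.
pose K' := \matrix_(i, j) K (lift ord0 i) (lift ord0 j).
have hK' : lower_pos K'.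
  by split=> [i j ij|i]; rewrite mxE//; apply: tK; rewrite /= /bump /= !add1n ltnS.
(* By triangularity the first output depends on the first input alone; once that input is fixed, its
   effect on the other coordinates is a translation. *)
pose b' (x : C) (i : 'I_n) := b (lift ord0 i) + K (lift ord0 i) ord0 * x.
have h1 := scales_complex (b ord0) (dK ord0).
have h2 x := IH _ (b' x) hK'.
pose F (z : C * n.-tuple C) := (K ord0 ord0 * z.1 + b ord0, affine_tuple K' (b' z.1) z.2).
have mF : measurable_fun setT F.
  apply: measurable_fun_pair.
    by apply: measurable_complexD => //; apply: measurable_complexM.
  apply/measurable_fun_tnthP => i.
  rewrite (_ : _ \o _ = fun z : C * n.-tuple C =>
     b (lift ord0 i) + K (lift ord0 i) ord0 * z.1 + \sum_j K' i j * tnth z.2 j).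
    apply: measurable_complexD.
      by apply: measurable_complexD => //; apply: measurable_complexM.
    apply: measurable_complex_sum => j; apply: measurable_complexM => //.
    exact: measurableT_comp (measurable_tnth _) measurable_snd.
  by apply/funext => z /=; rewrite tnth_mktuple.
have p0 : 0 <= \prod_i complex.Re (K' i i) ^+ 2.
  by apply: prodr_ge0 => i _; rewrite sqr_ge0.
have := scales_product p0 mF h1 h2.
move=> /(scales_image (@measurable_tuple_cons _ C n) (@measurable_tuple_uncons _ C n)
   (@tuple_consK C n)).
rewrite big_ord_recl; under eq_bigr do rewrite mxE.
congr scales; apply/funext => t; apply: eq_from_tnth => i; rewrite tnth_mktuple /=.
rewrite big_ord_recl.
have t0 : tnth t ord0 = (tuple_uncons t).1 by [].
have tS j : tnth t (lift ord0 j) = tnth (tuple_uncons t).2 j.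
  exact: tnth_uncons.
case: (unliftP ord0 i) => [j ->|->].
  rewrite tnth_consS tnth_mktuple.
  rewrite t0 /b' addrA; congr (_ + _); apply: eq_bigr => l _.
  by rewrite mxE tS.
rewrite tnth_cons0 /= t0 addrC big1 ?addr0// => j _.
by rewrite tK// mul0r.
Qed.

Lemma measurable_matrixP d (T : measurableType d) d' (T' : measurableType d') m n
    (f : T -> 'M[T']_(m, n)) :
  (forall i j, measurable_fun setT (fun x => f x i j)) -> measurable_fun setT f.
Proof.
move=> mf.
rewrite (_ : f = @tuple_matrix T' m n \o (@matrix_tuple T' m n \o f)).
  apply: measurableT_comp; first exact: measurable_tuple_matrix.
  apply/measurable_fun_tnthP => l; case/mxvec_indexP: l => i j.
  rewrite (_ : _ \o _ = fun x => f x i j)//.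
  by apply/funext => x /=; rewrite tnth_mktuple mxvecE.
by apply/funext => x /=; apply/matrixP => i j; rewrite !mxE tnth_mktuple mxvecE.
Qed.

(** On entries listed row by row, the linear part is the Kronecker product of [P] and the conjugate
    of [Q], again lower triangular. Each diagonal entry of [P] and [Q] occurs in [p] of its diagonal
    entries, and each of these counts squared: hence [2 * p]. *)
Lemma scales_matrix p (c P Q : 'M[C]_p) : lower_pos P -> lower_pos Q ->
  scales (matrix_lebesgue R p) (fun A => c + P *m A *m Q ^t*)
    (complex.Re ((\det P * \det Q) ^+ (2 * p))).
Proof.
move=> hP hQ.
have QR i : (Q i i)^* = Q i i by apply/CrealP; rewrite realE ltW ?hQ.2.
pose f (l : 'I_(p * p)) : 'I_p * 'I_p :=
  enum_val (cast_ord (esym (mxvec_cast p p)) l).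
have fE i j : f (mxvec_index i j) = (i, j).
  by rewrite /f cast_ordK enum_rankK.
pose K : 'M[C]_(p * p) := \matrix_(l, m) (P (f l).1 (f m).1 * (Q (f l).2 (f m).2)^*).
pose b (l : 'I_(p * p)) := c (f l).1 (f l).2.
have hK : lower_pos K.
  split=> [l m|l].
    case/mxvec_indexP: l => i j; case/mxvec_indexP: m => i' j'.
    rewrite !mxvec_index_val mxE !fE /= => lt.
    have [ii'|i'i] := ltnP i i'; first by rewrite hP.1// mul0r.
    have [jj'|j'j] := ltnP j j'; first by rewrite hQ.1// rmorph0 mulr0.
    by move: lt; rewrite ltnNge leq_add// leq_mul2r i'i orbT.
  case/mxvec_indexP: l => i j.
  by rewrite mxE !fE /= QR mulr_gt0// ?hP.2 ?hQ.2.
have := scales_affine_tuple b hK.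
move=> /(scales_image (@measurable_tuple_matrix _ C p p)
  (@measurable_matrix_tuple _ C p p) (@tuple_matrixK C p p)).
have -> : @tuple_matrix C p p \o affine_tuple K b \o @matrix_tuple C p p =
    (fun A => c + P *m A *m Q ^t*).
  apply/funext => A /=; apply/matrixP => i j; rewrite mxE tnth_mktuple /b fE !mxE /=.
  congr (_ + _); rewrite (reindex _ (curry_mxvec_bij _ _)) /=.
  under [RHS]eq_bigr => y _ do rewrite mxE mulr_suml.
  rewrite [RHS]exchange_big pair_big /=; apply: eq_bigr => -[x y] _ /=.
  by rewrite tnth_mktuple mxvecE !mxE !fE /= -!mulrA; congr (_ * _); rewrite mulrC.
congr scales.
have realK l : K l l = (complex.Re (K l l))%:C%C.
  by move: (hK.2 l); case: (K l l) => x y; rewrite ltcE /= => /andP[/eqP -> _].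
suff : ((\prod_i complex.Re (K i i) ^+ 2)%:C)%C = (\det P * \det Q) ^+ (2 * p).
  by move=> <-.
rewrite rmorph_prod /=; under eq_bigr do rewrite rmorphXn /= -realK.
rewrite (reindex _ (curry_mxvec_bij _ _)) /=.
rewrite (eq_bigr (fun x => P x.1 x.1 ^+ 2 * Q x.2 x.2 ^+ 2)) => [|[i j] _]; last first.
  by rewrite mxE !fE /= QR exprMn.
rewrite big_split /= exprM exprMn exprMn.
have h1 (D : 'M[C]_p) : \prod_(x : 'I_p * 'I_p) D x.1 x.1 ^+ 2 =
    (\prod_i D i i ^+ 2) ^+ p.
  rewrite -(pair_big xpredT xpredT (fun i _ => D i i ^+ 2)) /= -prodrXl.
  by apply: eq_bigr => i _; rewrite prodr_const card_ord.
have h2 (D : 'M[C]_p) : \prod_(x : 'I_p * 'I_p) D x.2 x.2 ^+ 2 =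
    (\prod_i D i i ^+ 2) ^+ p.
  rewrite -(pair_big xpredT xpredT (fun _ i => D i i ^+ 2)) /=.
  by rewrite prodr_const card_ord.
by rewrite h1 h2 !prodrXl -!lower_pos_det// mulrACA -!exprD addnn -mul2n -!exprM.
Qed.

End affine_scales.

(** * The density of the first coordinates *)

(** Sylvester's criterion by induction on the scalar size, the new factor of the determinant being a
    1 by 1 Schur complement. It turns positivity into finitely many inequalities between measurable
    functions. *)
Lemma toep_sylvester (C : numClosedFieldType) q (s : seq 'M[C]_q.+1) N :
  posdef (toep s N) <-> (forall M, (M <= N)%N -> 0 < \det (toep s M)).
Proof.
split=> [h M MN|].
  by move: h; rewrite -(subnKC MN) => /posdef_toep_le /posdef_det_gt0.
elim: N => [|N IH] h.
  by split=> [|u]; [exact: toep_herm|rewrite [u]flatmx0 eqxx].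
have pN : posdef (toep s N) by apply: IH => M MN; apply: h; exact: leqW.
have := h _ (leqnn N.+1); rewrite -addn1 toep_block det_schur//.
rewrite (pmulr_rgt0 _ (posdef_det_gt0 pN)) => d0; apply/posdef_schur; split; first exact: pN.
move: d0; set S := drsubmx _ - _ => d0.
have hS : S ^t* = S.
  rewrite /S adjmxB !adjmxM !trmxCK adjmxV toep_herm mulmxA; congr (_ - _).
  have := toep_herm s (N + 1).
  by rewrite -{1 2}[toep s (N + 1)]submxK adjmx_block => /eq_block_mx[].
rewrite det_mx11 in d0; split=> // u u0.
have -> : hform S u = S 0 0 * hform 1%:M u.
  by rewrite -hformZ; congr hform; rewrite scalemx1 [LHS]mx11_scalar.
by rewrite mulr_gt0// hform1_gt0.
Qed.

Section real_part.
Variable R : realType.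
Local Notation C := R[i].

Lemma Re_gt0 (z : C) : 0 < z -> 0 < complex.Re z.
Proof. by case: z => a b; rewrite ltcE /= => /andP[]. Qed.

Lemma pos_complexE (z : C) : 0 <= z -> z = (complex.Re z)%:C%C.
Proof. by case: z => a b; rewrite lecE /= => /andP[/eqP -> _]. Qed.

Lemma ReM_pos (z w : C) : 0 <= z -> complex.Re (z * w) = complex.Re z * complex.Re w.
Proof. by move=> /pos_complexE ->; case: w => a b /=; rewrite mul0r subr0. Qed.

Lemma ReX_pos (z : C) n : 0 <= z -> complex.Re (z ^+ n) = complex.Re z ^+ n.
Proof. by move=> z0; elim: n => // n IH; rewrite !exprS ReM_pos// IH. Qed.

Lemma ReV_pos (z : C) : 0 <= z -> complex.Re (z^-1) = (complex.Re z)^-1.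
Proof. by move=> /pos_complexE ->; rewrite -fmorphV. Qed.

Lemma measurable_complex_gt0 d (T : measurableType d) (f : T -> C) :
  measurable_fun setT f -> measurable_fun setT (fun x => 0 < f x).
Proof.
move=> mf; rewrite (_ : (fun x => _) =
    (fun x => (complex.Im (f x) == 0) && (0 < complex.Re (f x)))).
  apply: measurable_and.
    by apply: measurable_fun_eqr => //; exact: measurableT_comp (@measurable_Im R) mf.
  by apply: measurable_fun_ltr => //; exact: measurableT_comp (@measurable_Re R) mf.
by apply/funext => x; case: (f x) => a b; rewrite ltcE.
Qed.

End real_part.

Section toep_weight.
Variables (R : realType) (q : nat).
Local Notation p := q.+1.
Local Notation C := R[i].
Implicit Types s : seq 'M[C]_p.

Definition toep_dom n s : bool := `[< posdef (toep s (p + n * p)) >].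

(* Up to a constant factor, the density at [s] of the first [n] coordinates of a
   uniform point of the moment space of order [n + j], when [m = 2 p j]. The inverse is
   written as a real power because powers are known to be measurable. *)
Definition toep_weight n m s : R := (toep_dom n s)%:R *
  (complex.Re (\det (toep s (p + n * p))) *
   complex.Re (\det (toep s (n * p))) `^ (-1)) ^+ m.

Lemma toep_domP n s : reflect (posdef (toep s (p + n * p))) (toep_dom n s).
Proof. exact: asboolP. Qed.

Lemma toep_weight_dom n m s : toep_dom n s ->
  toep_weight n m s = complex.Re (toep_ratio s n) ^+ m.
Proof.
move=> h; rewrite /toep_weight h mul1r; congr (_ ^+ _).
move/toep_domP : h => pT; have [pM _] := posdef_toep_dr pT.
have d0 := posdef_det_gt0 pM.
rewrite powR_inv1 ?(ltW (Re_gt0 d0))// /toep_ratio ReM_pos ?ltW ?posdef_det_gt0//.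
by rewrite ReV_pos ?ltW.
Qed.

Lemma toep_weight_ndom n m s : ~~ toep_dom n s -> toep_weight n m s = 0.
Proof. by move=> /negbTE h; rewrite /toep_weight h mul0r. Qed.

Lemma toep_weight_ge0 n m s : 0 <= toep_weight n m s.
Proof.
have [h|h] := boolP (toep_dom n s); last by rewrite toep_weight_ndom.
rewrite toep_weight_dom// exprn_ge0// ltW// Re_gt0// toep_ratio_gt0//.
exact/toep_domP.
Qed.

Local Notation Mat := 'M[C]_p.

Lemma measurable_toep_entry n x y :
  measurable_fun setT (fun t : n.-tuple Mat => toep_entry t x y).
Proof.
have mk k i j : measurable_fun setT (fun t : n.-tuple Mat => moment_nth t k i j).
  case: k => [|k]; first exact: measurable_cst.
  rewrite (_ : (fun t => _) = (fun t : n.-tuple Mat => (nth 0 t k) i j))//.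
  have [kn|nk] := ltnP k n.
    rewrite (_ : (fun t => _) = (fun M : Mat => M i j) \o (@tnth n Mat ^~ (Ordinal kn))).
      exact: measurableT_comp (measurable_entry _ _) (measurable_tnth _).
    by apply/funext => t /=; rewrite (tnth_nth 0).
  rewrite (_ : (fun t => _) = cst 0)//.
  by apply/funext => t /=; rewrite nth_default ?size_tuple// mxE.
rewrite /toep_entry; case: (x %/ p <= y %/ p)%N; first exact: mk.
exact: measurable_complex_conj.
Qed.

Lemma measurable_det_toep n N :
  measurable_fun setT (fun t : n.-tuple Mat => \det (toep t N)).
Proof.
apply: measurable_complex_sum => s; apply: measurable_complexM => //.
apply: measurable_complex_prod => i.
have mj j : measurable_fun setT (fun t : n.-tuple Mat => toep t N i j).
  rewrite (_ : (fun t => _) = (fun t : n.-tuple Mat => toep_entry t i j)).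
    exact: measurable_toep_entry.
  by apply/funext => t; rewrite mxE.
exact: mj.
Qed.

Lemma measurable_toep_dom n m :
  measurable_fun setT (fun t : n.-tuple Mat => toep_dom m t).
Proof.
rewrite (_ : (fun t => _) = (fun t : n.-tuple Mat =>
    all (fun M => 0 < \det (toep t M)) (iota 0 (p + m * p).+1))).
  elim: (iota _ _) => [|M r IH] /=; first exact: measurable_cst.
  apply: measurable_and => //.
  exact: (measurable_complex_gt0 (measurable_det_toep M)).
apply/funext => t; apply/idP/idP.
  move=> /toep_domP/toep_sylvester h; apply/allP => M; rewrite mem_iota add0n ltnS.
  by move=> /andP[_]; exact: h.
move=> /allP h; apply/toep_domP/toep_sylvester => M MN; apply: h.
by rewrite mem_iota add0n ltnS.
Qed.

Lemma measurable_toep_weight n m :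
  seq_measurable (fun s : seq Mat => (toep_weight n m s)%:E).
Proof.
move=> k; apply/measurable_EFinP; apply: measurable_funM.
  rewrite (_ : (fun t => _) = (fun t : k.-tuple Mat => if toep_dom n t then 1 else 0 : R)).
    by apply: measurable_fun_ifT => //; exact: measurable_toep_dom.
  by apply/funext => t; case: ifP.
apply: measurable_funX; apply: measurable_funM.
  exact: measurableT_comp (@measurable_Re R) (measurable_det_toep _).
have mr := measurableT_comp (@measurable_Re R) (@measurable_det_toep k (n * p)).
exact: measurableT_comp (@measurable_powR R (-1)) mr.
Qed.

Definition ball_weight m (A : Mat) : R :=
  (`[< posdef (1%:M - A ^t* *m A) >])%:R * complex.Re (\det (1%:M - A ^t* *m A)) ^+ m.

Lemma ball_weight_ge0 m A : 0 <= ball_weight m A.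
Proof.
rewrite /ball_weight; case: asboolP => h; last by rewrite mul0r.
by rewrite mul1r exprn_ge0// ltW// Re_gt0// posdef_det_gt0.
Qed.

Local Open Scope ereal_scope.
Local Notation leb := (matrix_lebesgue R p).

(** Kept as an extended real: it is absorbed in the constant that normalization later fixes, and
    which is then seen to be finite. *)
Definition ball_mass m : \bar R := \int[leb]_A (ball_weight m A)%:E.

(** In the coordinates of the ball the Jacobian is [toep_ratio t n] to the power [2 * p], and the
    weight is its power [m] times [ball_weight]; the ratio leaves the integral. *)
Lemma integral_toep_weight_rcons n m (t : n.-tuple Mat) :
  \int[leb]_x (toep_weight n.+1 m (rcons t x))%:E =
  ball_mass m * (toep_weight n (m + 2 * p) t)%:E.
Proof.
have nt := size_tuple t; have [h|h] := boolP (toep_dom n t); last first.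
  rewrite toep_weight_ndom// mule0 integral0_eq// => x _.
  rewrite toep_weight_ndom//; apply: contra h => /toep_domP h; apply/toep_domP.
  have [//|h'] := pselect (posdef (toep t (p + n * p))).
  by have := @toep_fiber_neg _ _ t x; rewrite nt => /(_ h').
move/toep_domP : (h) => pT.
have := @toep_fiber _ _ t; rewrite nt => /(_ pT)[c [P [Q [hP hQ [dP dQ] key]]]].
have [mF hF] := scales_matrix c hP hQ.
have mw : measurable_fun setT (fun x : Mat => (toep_weight n.+1 m (rcons t x))%:E).
  have := @seq_measurable_rcons _ Mat R _ n (@measurable_toep_weight n.+1 m).
  move=> H; have mp : measurable_fun setT (pair t : Mat -> n.-tuple Mat * Mat).
    exact: measurable_pair1.
  exact: measurableT_comp H mp.
rewrite hF//; last by move=> x; rewrite lee_fin toep_weight_ge0.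
have h0 : (0 < toep_ratio t n)%R := toep_ratio_gt0 pT.
have hR := Re_gt0 h0.
have -> : complex.Re ((\det P * \det Q) ^+ (2 * p))%R = (complex.Re (toep_ratio t n) ^+ (2 * p))%R.
  have e2 : ((\det P * \det Q) ^+ 2 = toep_ratio t n ^+ 2)%R.
    by rewrite !expr2 mulrACA -(expr2 (\det P)) -(expr2 (\det Q)) dP dQ.
  by rewrite exprM e2 -exprM ReX_pos ?ltW.
rewrite toep_weight_dom// exprD EFinM [ball_mass m * _]muleC [X in X * ball_mass m]muleC -muleA.
congr (_ * _).
have wE x : toep_weight n.+1 m (rcons t (c + P *m x *m Q ^t*)%R) =
    (complex.Re (toep_ratio t n) ^+ m * ball_weight m x)%R.
  have [k1 k2] := key x; rewrite /ball_weight; case: asboolP => hx.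
    have dom : toep_dom n.+1 (rcons t (c + P *m x *m Q ^t*)%R) by apply/toep_domP/k1.
    rewrite toep_weight_dom// k2// ReM_pos ?exprMn ?mul1r// ltW//.
  rewrite toep_weight_ndom ?mul0r ?mulr0//; apply/negP => /toep_domP h'.
  by apply: hx; apply/k1.
under eq_integral do rewrite wE EFinM.
rewrite ge0_integralZl_EFin//; first last.
- by rewrite exprn_ge0// ltW.
(* Measurability of [ball_weight] is inherited from [toep_weight] through the affine map, after
   division by a positive constant. *)
- rewrite (_ : (fun x => _) = (fun x : Mat =>
      ((complex.Re (toep_ratio t n) ^+ m)^-1)%:E *
      (toep_weight n.+1 m (rcons t (c + P *m x *m Q ^t*)%R))%:E)).
    apply: measurable_funeM; exact: measurableT_comp mw mF.
  apply/funext => x; rewrite wE -EFinM mulKf//.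
  by rewrite expf_neq0// gt_eqF.
- by move=> x _; rewrite lee_fin ball_weight_ge0.
Qed.

(** The constant is chosen before [F]: it is the same for a test function and for the
    normalization. *)
Lemma integral_toep_weight k e : exists2 c : \bar R, 0 <= c &
  forall F : seq Mat -> \bar R, seq_measurable F -> (forall s, 0 <= F s) ->
  \int[tuple_product_measure leb (k + e)]_t (F (take k t) * (toep_weight (k + e) 0 t)%:E)
  = c * \int[tuple_product_measure leb k]_t
          (F t * (toep_weight k (e * (2 * p)) t)%:E).
Proof.
(* Each integration raises the exponent by [2 * p], so the induction needs an arbitrary initial
   one. *)
suff H m : exists2 c : \bar R, 0 <= c &
    forall F : seq Mat -> \bar R, seq_measurable F -> (forall s, 0 <= F s) ->
    \int[tuple_product_measure leb (k + e)]_t (F (take k t) * (toep_weight (k + e) m t)%:E)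
    = c * \int[tuple_product_measure leb k]_t
          (F t * (toep_weight k (m + e * (2 * p)) t)%:E).
  exact: (H 0%N).
elim: e m => [|e IH] m.
  exists 1 => // F mF F0; rewrite mul1e addn0 mul0n addn0; apply: eq_integral => t _.
  by rewrite take_oversize// size_tuple.
have [c c0 cE] := IH (m + 2 * p)%N.
have b0 : 0 <= ball_mass m by apply: integral_ge0 => x _; rewrite lee_fin ball_weight_ge0.
exists (ball_mass m * c); first exact: mule_ge0.
move=> F mF F0.
have mFt : seq_measurable (fun s => F (take k s)).
  move=> n; have tt : measurable_fun setT (fun t : n.-tuple Mat => [tuple of take k t]).
    apply/measurable_fun_tnthP => i.
    have ik : (i < n)%N by rewrite (leq_trans (ltn_ord i))// geq_minr.
    rewrite (_ : _ \o _ = @tnth n Mat ^~ (Ordinal ik)); first exact: measurable_tnth.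
    apply/funext => t /=; rewrite !(tnth_nth (0%R : Mat)) /= nth_take//.
    by rewrite (leq_trans (ltn_ord i))// geq_minl.
  exact: measurableT_comp (mF _) tt.
rewrite addnS.
rewrite (integral_tuple_rcons _ _ (h := fun s => F (take k s) * (toep_weight (k + e).+1 m s)%:E));
  first last.
- by move=> s; rewrite mule_ge0// lee_fin toep_weight_ge0.
- by move=> n; apply: emeasurable_funM; [exact: mFt|exact: measurable_toep_weight].
have -> : (m + e.+1 * (2 * p) = m + 2 * p + e * (2 * p))%N by rewrite mulSn addnA.
rewrite -muleA -cE// -ge0_integralZl//; first last.
- by move=> t _; rewrite mule_ge0// lee_fin toep_weight_ge0.
- by apply: emeasurable_funM; [exact: mFt|exact: measurable_toep_weight].
apply: eq_integral => t _.
have tk x : take k (rcons t x) = take k t.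
  by rewrite -cats1 takel_cat// size_tuple leq_addr.
under eq_integral do rewrite tk.
rewrite ge0_integralZl//; first last.
- by move=> x _; rewrite lee_fin toep_weight_ge0.
- have := @seq_measurable_rcons _ Mat R _ (k + e) (@measurable_toep_weight (k + e).+1 m).
  move=> H; have mp : measurable_fun setT (pair t : Mat -> (k + e).-tuple Mat * Mat).
    exact: measurable_pair1.
  exact: measurableT_comp H mp.
by rewrite integral_toep_weight_rcons muleCA.
Qed.

End toep_weight.

(** * The moment space *)

Section complex_norm.
Variable R : realType.
Local Notation C := R[i].

Lemma norm_complexR (x : R) : `|x%:C%C : C| = `|x|%:C%C.
Proof. by rewrite normc_def /= expr0n addr0 sqrtr_sqr. Qed.

Lemma norm_complex_Re (z : C) (e : R) : `|z| <= e%:C%C -> `|complex.Re z| <= e.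
Proof. by rewrite -lecR; apply: le_trans (normc_ge_Re z). Qed.

Lemma norm_complex_Im (z : C) (e : R) : `|z| <= e%:C%C -> `|complex.Im z| <= e.
Proof.
move=> h; rewrite -lecR; apply: le_trans h; rewrite normc_def lecR -sqrtr_sqr.
by rewrite ler_wsqrtr// lerDr sqr_ge0.
Qed.

Lemma norm_complex_le (z : C) (a b : R) :
  `|complex.Re z| <= a -> `|complex.Im z| <= b -> `|z| <= (a + b)%:C%C.
Proof.
move=> ha hb; rewrite {1}[z]complexE; apply: le_trans (ler_normD _ _) _.
rewrite normrM !norm_complexR normc_def /= expr0n expr1n add0r sqrtr1 mul1r.
by rewrite rmorphD /= lerD// lecR.
Qed.

Lemma norm_subX (z w : C) k : `|z| = 1 -> `|w| = 1 ->
  `|z ^+ k - w ^+ k| <= k%:R * `|z - w|.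
Proof.
move=> z1 w1; elim: k => [|k IH]; first by rewrite subrr normr0 mul0r.
have -> : z ^+ k.+1 - w ^+ k.+1 = z * (z ^+ k - w ^+ k) + (z - w) * w ^+ k.
  by rewrite !exprS; ring.
apply: le_trans (ler_normD _ _) _.
rewrite !normrM z1 mul1r normrX w1 expr1n mulr1 mulrS mulrDl mul1r addrC.
by rewrite lerD2l.
Qed.

End complex_norm.

Lemma normB_le (R : realDomainType) (a b c d x y : R) :
  `|a - c| <= x -> `|b - d| <= y -> `|a - b - (c - d)| <= x + y.
Proof.
move=> h1 h2; have -> : a - b - (c - d) = (a - c) - (b - d) by ring.
by apply: le_trans (ler_normB _ _) _; exact: lerD.
Qed.

(** * Integrals against charges compared with finite sums *)

Section charge_integral_approx.
Context d (T : measurableType d) (R : realType).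

Lemma Rintegral_simple (m : {finite_measure set T -> \bar R}) (I : finType)
    (r : T -> I) (phi : I -> R) :
  (forall i, measurable (r @^-1` [set i])) ->
  m.-integrable setT (EFin \o (phi \o r)) /\
  \int[m]_x phi (r x) = \sum_i phi i * fine (m (r @^-1` [set i])).
Proof.
move=> mr; pose A i := r @^-1` [set i].
have E : phi \o r = fun x => \sum_(i <- enum I) phi i * \1_(A i) x.
  apply/funext => x /=; rewrite big_enum (bigD1 (r x))//= big1 => [|i ir].
    by rewrite indicE mem_set// mulr1 addr0.
  by rewrite indicE memNset ?mulr0// /A /= => rx; rewrite rx eqxx in ir.
have iA i : m.-integrable setT (EFin \o \1_(A i)).
  apply: measurable_bounded_integrable => //.
  - exact: fin_num_fun_lty.
  - by apply: measurable_indic; exact: mr.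
  exists 1; split=> // M M1 x _ /=; rewrite indicE ger0_norm//.
  by case: (_ \in _); rewrite /= ?ltW// (lt_trans ltr01).
have iZ i : m.-integrable setT (EFin \o (fun x => phi i * \1_(A i) x)).
  have := integrableZl measurableT (phi i) (iA i).
  by apply: eq_integrable => // x _; rewrite /= EFinM.
have H (s : seq I) : m.-integrable setT
      (EFin \o (fun x => \sum_(i <- s) phi i * \1_(A i) x)) /\
    \int[m]_x (\sum_(i <- s) phi i * \1_(A i) x) =
    \sum_(i <- s) phi i * fine (m (A i)).
  elim: s => [|i s [IH1 IH2]].
    split; first by rewrite (_ : _ \o _ = cst 0%E) ?integrable0//;
      apply/funext => x /=; rewrite big_nil.
    by under eq_Rintegral do rewrite big_nil; rewrite Rintegral_cst// mul0r big_nil.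
  have -> : (fun x => \sum_(j <- i :: s) phi j * \1_(A j) x) =
     (fun x => phi i * \1_(A i) x + \sum_(j <- s) phi j * \1_(A j) x).
    by apply/funext => x; rewrite big_cons.
  split.
    have := integrableD measurableT (iZ i) IH1.
    by apply: eq_integrable => // x _; rewrite /= EFinD.
  rewrite RintegralD// IH2 big_cons RintegralZl//; congr (_ * _ + _).
  by rewrite /Rintegral integral_indic ?setIT//; exact: mr.
have [H1 H2] := H (enum I); rewrite E; split=> //.
have -> : \int[m]_x phi (r x) = \int[m]_x (\sum_(i <- enum I) phi i * \1_(A i) x).
  by apply: eq_Rintegral => x _; have /(congr1 (@^~ x)) /= := E.
by rewrite H2 big_enum.
Qed.

Lemma Rintegral_approx (m : {finite_measure set T -> \bar R}) (I : finType)
    (r : T -> I) (phi : I -> R) (f : T -> R) (e : R) :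
  (forall i, measurable (r @^-1` [set i])) -> measurable_fun setT f ->
  (forall x, `|f x - phi (r x)| <= e) ->
  `|\int[m]_x f x - \sum_i phi i * fine (m (r @^-1` [set i]))| <= e * fine (m setT).
Proof.
move=> mr mf fe; have [i1 <-] := Rintegral_simple m phi mr.
have mphi : measurable_fun setT (phi \o r) by case/integrableP : i1 => /measurable_EFinP.
have mT : (m setT < +oo)%E by exact: fin_num_fun_lty.
have id : m.-integrable setT (EFin \o (fun x => f x - phi (r x))).
  apply: measurable_bounded_integrable => //; first exact: measurable_funB.
  by exists e; split=> [|M eM x _ /=]; [exact: num_real|exact: le_trans (fe x) (ltW eM)].
have if_ : m.-integrable setT (EFin \o f).
  have := integrableD measurableT id i1; apply: eq_integrable => // x _.
  by rewrite /= -EFinD subrK.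
rewrite -RintegralB//; apply: le_trans (le_normr_Rintegral _ _) _ => //.
rewrite -Rintegral_cst//; apply: le_Rintegral => //.
- exact: (integrable_norm id).
- by apply: measurable_bounded_integrable => //; exact: bounded_cst.
Qed.

(** The total variation, through the same chosen Hahn decomposition as [charge_integral], so that
    both unfold together. *)
Definition charge_mass (nu : {charge set T -> \bar R}) : R :=
  let: exist P hP := cid (Hahn_decomposition nu) in
  let: exist N nuPN := cid hP in
  fine (jordan_pos nuPN setT) + fine (jordan_neg nuPN setT).

Lemma charge_mass_ge0 nu : 0 <= charge_mass nu.
Proof.
rewrite /charge_mass; case: cid => P hP; case: cid => N nuPN.
by rewrite addr_ge0// fine_ge0.
Qed.

(** This brings integrals back to values on sets, which is what nonnegativity of a matrix measure
    speaks of. The two Jordan parts are estimated separately. *)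
Lemma charge_integral_approx (nu : {charge set T -> \bar R}) (I : finType)
    (r : T -> I) (phi : I -> R) (f : T -> R) (e : R) :
  (forall i, measurable (r @^-1` [set i])) -> measurable_fun setT f ->
  (forall x, `|f x - phi (r x)| <= e) ->
  `|charge_integral nu f - \sum_i phi i * fine (nu (r @^-1` [set i]))|
    <= e * charge_mass nu.
Proof.
move=> mr mf fe; rewrite /charge_mass /charge_integral.
case: cid => P hP; case: cid => N nuPN.
have := Rintegral_approx (jordan_pos nuPN) mr mf fe.
have := Rintegral_approx (jordan_neg nuPN) mr mf fe.
set a := \int[_]_x _; set b := \int[_]_x _ => ha hb.
have -> : \sum_i phi i * fine (nu (r @^-1` [set i])) =
    \sum_i phi i * fine (jordan_pos nuPN (r @^-1` [set i]))
    - \sum_i phi i * fine (jordan_neg nuPN (r @^-1` [set i])).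
  rewrite -sumrB; apply: eq_bigr => i _; rewrite -mulrBr; congr (_ * _).
  have f1 : jordan_pos nuPN (r @^-1` [set i]) \is a fin_num by exact: fin_num_measure.
  have f2 : jordan_neg nuPN (r @^-1` [set i]) \is a fin_num by exact: fin_num_measure.
  rewrite (jordan_decomp nuPN)//.
  rewrite -[cadd _ _ _]/(jordan_pos nuPN (r @^-1` [set i]) +
    (-1)%:E * jordan_neg nuPN (r @^-1` [set i]))%E.
  by rewrite mulN1e fineB.
by rewrite mulrDr; exact: normB_le.
Qed.

Lemma complex_integral_approx (mu : complex_measure T R) (I : finType)
    (r : T -> I) (phi : I -> R[i]) (f : T -> R[i]) (e : R) :
  (forall i, measurable (r @^-1` [set i])) -> measurable_fun setT f ->
  (forall x, `|f x - phi (r x)| <= e%:C%C) ->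
  `|complex_integral mu f - \sum_i phi i * complex_measure_val mu (r @^-1` [set i])|
    <= (e * (2 * (charge_mass (re_measure mu) + charge_mass (im_measure mu))))%:C%C.
Proof.
move=> mr mf fe.
have fRe x : `|complex.Re (f x) - complex.Re (phi (r x))| <= e.
  by have := norm_complex_Re (fe x); rewrite raddfB.
have fIm x : `|complex.Im (f x) - complex.Im (phi (r x))| <= e.
  by have := norm_complex_Im (fe x); rewrite raddfB.
have mRe := measurableT_comp (@measurable_Re R) mf.
have mIm := measurableT_comp (@measurable_Im R) mf.
have h1 := charge_integral_approx (re_measure mu) (phi := fun i => complex.Re (phi i))
  mr mRe fRe.
have h2 := charge_integral_approx (im_measure mu) (phi := fun i => complex.Im (phi i))
  mr mIm fIm.
have h3 := charge_integral_approx (im_measure mu) (phi := fun i => complex.Re (phi i))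
  mr mRe fRe.
have h4 := charge_integral_approx (re_measure mu) (phi := fun i => complex.Im (phi i))
  mr mIm fIm.
set V1 := charge_mass (re_measure mu) in h1 h4 *.
set V2 := charge_mass (im_measure mu) in h2 h3 *.
(* The real part and the imaginary part each involve both charges, hence the factor 2. *)
have -> : e * (2 * (V1 + V2)) = (e * V1 + e * V2) + (e * V2 + e * V1) by ring.
apply: norm_complex_le.
  rewrite raddfB /= raddf_sum /=.
  have -> : \sum_i complex.Re (phi i * complex_measure_val mu (r @^-1` [set i])) =
     \sum_i complex.Re (phi i) * fine (re_measure mu (r @^-1` [set i]))
     - \sum_i complex.Im (phi i) * fine (im_measure mu (r @^-1` [set i])).
    by rewrite -sumrB; apply: eq_bigr => i _; case: (phi i).
  exact: normB_le.
rewrite raddfB /= raddf_sum /=.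
have -> : \sum_i complex.Im (phi i * complex_measure_val mu (r @^-1` [set i])) =
   \sum_i complex.Re (phi i) * fine (im_measure mu (r @^-1` [set i]))
   + \sum_i complex.Im (phi i) * fine (re_measure mu (r @^-1` [set i])).
  by rewrite -big_split; apply: eq_bigr => i _; case: (phi i).
rewrite opprD addrACA; apply: le_trans (ler_normD _ _) _.
exact: lerD.
Qed.

End charge_integral_approx.

Section circle_partition.
Variable R : realType.
Local Notation C := R[i].

Lemma norm_circle_val (z : circle R) : `|circle_val z| = 1.
Proof. by case: z => x hx; exact: (set_mem hx). Qed.

Lemma measurable_circle_val : measurable_fun setT (@circle_val R).
Proof. by move=> _ A mA; rewrite setTI; exists A => //; rewrite setTI. Qed.

Lemma circle_partition (e : R) : 0 < e ->
  exists (I : finType) (r : circle R -> I),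
    (forall i, measurable (r @^-1` [set i])) /\
    forall z w, r z = r w -> `|circle_val z - circle_val w| <= e%:C%C.
Proof.
move=> e0; pose N := (Num.truncn (2 / e)).+1.
have N0 : 0 < N%:R :> R by rewrite ltr0n.
have NE : 2 / N%:R <= e.
  by rewrite ler_pdivrMr// mulrC -ler_pdivrMr// ltW// truncnS_gt.
pose g (x : R) := (x + 1) * N%:R.
pose h (x : R) := Num.truncn (g x).
have hb x : `|x| <= 1 -> (h x < (2 * N).+1)%N.
  rewrite ler_norml => /andP[x1 x2]; rewrite ltnS /h truncn_le_nat /g.
  rewrite (@le_lt_trans _ _ (2 * N)%:R)// ?ltr_nat// natrM ler_wpM2r ?ler0n//.
  by rewrite -[2]/(1 + 1) lerD2r.
have g0 x : `|x| <= 1 -> 0 <= g x.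
  by rewrite ler_norml => /andP[x1 _]; rewrite /g mulr_ge0 ?ler0n// -lerBlDr sub0r.
have close x y : `|x| <= 1 -> `|y| <= 1 -> h x = h y -> `|x - y| <= N%:R^-1.
  move=> /g0 x0 /g0 y0 xy; have := truncn_itv x0; have := truncn_itv y0.
  rewrite -/(h x) -/(h y) -xy => /andP[a1 a2] /andP[b1 b2].
  have -> : x - y = (g x - g y) / N%:R.
    by rewrite /g -mulrBl mulfK ?gt_eqF//; ring.
  rewrite normrM normfV [`|N%:R|]gtr0_norm// ler_pdivrMr// mulVf ?gt_eqF//.
  rewrite -natr1 in a2 b2.
  by rewrite ler_norml; apply/andP; split; lra.
have nRe (z : circle R) : `|complex.Re (circle_val z)| <= 1.
  by apply: norm_complex_Re; rewrite norm_circle_val.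
have nIm (z : circle R) : `|complex.Im (circle_val z)| <= 1.
  by apply: norm_complex_Im; rewrite norm_circle_val.
pose r (z : circle R) : 'I_(2 * N).+1 * 'I_(2 * N).+1 :=
  (inord (h (complex.Re (circle_val z))), inord (h (complex.Im (circle_val z)))).
exists ('I_(2 * N).+1 * 'I_(2 * N).+1)%type, r; split=> [[a b]|z w].
  have mh (f : circle R -> R) (c : 'I_(2 * N).+1) : measurable_fun setT f ->
      (forall z, `|f z| <= 1) -> measurable [set z | inord (h (f z)) = c].
    move=> mf f1.
    have mg : measurable_fun setT (fun z => g (f z)).
      by apply: measurable_funM => //; exact: measurable_funD.
    have m1 : measurable_fun setT (fun z => (c%:R <= g (f z)) && (g (f z) < c.+1%:R)).
      apply: measurable_and; first exact: measurable_fun_ler.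
      exact: measurable_fun_ltr.
    rewrite (_ : [set z | _] = setT `&`
       (fun z => (c%:R <= g (f z)) && (g (f z) < c.+1%:R)) @^-1` [set true]).
      exact: m1.
    rewrite setTI; apply/seteqP; split=> z /=.
      move=> <-; rewrite inordK ?hb//; exact: truncn_itv (g0 _ (f1 z)).
    move=> hc; apply/val_inj; rewrite /= inordK ?hb// /h.
    by rewrite (truncn_def hc).
  rewrite (_ : _ @^-1` _ = [set z | inord (h (complex.Re (circle_val z))) = a]
     `&` [set z | inord (h (complex.Im (circle_val z))) = b]).
    apply: measurableI; apply: mh => //.
      exact: measurableT_comp (@measurable_Re R) measurable_circle_val.
    exact: measurableT_comp (@measurable_Im R) measurable_circle_val.
  by apply/seteqP; split=> z /=; [move=> [-> ->]|move=> [<- <-]].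
move=> [/(congr1 (@nat_of_ord _)) h1 /(congr1 (@nat_of_ord _)) h2].
rewrite !inordK ?hb// in h1 h2.
apply: le_trans (_ : (N%:R^-1 + N%:R^-1)%:C%C <= _).
  by apply: norm_complex_le; rewrite raddfB; apply: close; rewrite ?nRe ?nIm.
by rewrite lecR; apply: le_trans NE; rewrite mulrDl mul1r.
Qed.

End circle_partition.

(** * Nonnegativity of the Toeplitz matrix of a measure *)

Section moment_psd.
Variables (R : realType) (q : nat).
Local Notation p := q.+1.
Local Notation C := R[i].

Definition moment_seq (mu : matrix_measure (circle R) R p) n : seq 'M[C]_p :=
  [seq trig_moment mu l.+1 | l <- iota 0 n].

Lemma Rlim_ge0 (x K : R) : (forall e, 0 < e -> - (e * K) <= x) -> 0 <= x.
Proof.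
move=> h; have [K0|K0] := leP K 0.
  by apply: le_trans (h 1 ltr01); rewrite mul1r oppr_ge0.
apply/ler_addgt0Pr => e e0; have := h (e / K); rewrite divr_gt0// => /(_ isT).
by rewrite divfK ?gt_eqF// lerNl -lerBlDr sub0r lerNl => h'; lra.
Qed.

(** Nonnegative matrices are closed under entrywise limits: at [u] the forms differ by at most
    [e * V] times the square of the sum of the moduli of the entries of [u]. *)
Lemma hermitian_ge0_approx N (T : 'M[C]_N) : T ^t* = T ->
  (exists V : R, forall e : R, 0 < e -> exists2 T' : 'M[C]_N, psd T' &
     forall x y, `|T x y - T' x y| <= (e * V)%:C%C) -> psd T.
Proof.
move=> hT [V hV]; split=> // u.
have real_form (S : 'M[C]_N) : S ^t* = S -> hform S u = (complex.Re (hform S u))%:C%C.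
  move=> hS; have : (hform S u)^* = hform S u.
    rewrite /hform -[LHS]/(((u ^t* *m S *m u) 0 0)^*).
    have -> : ((u ^t* *m S *m u) 0 0)^* = ((u ^t* *m S *m u) ^t*) 0 0.
      by rewrite [RHS]mxE [in RHS]mxE.
    by rewrite !adjmxM trmxCK hS mulmxA.
  case: (hform S u) => a b /eqP; rewrite eq_complex /= => /andP[_ /eqP b0].
  by congr Complex; lra.
rewrite (real_form _ hT) lecR.
pose K := V * complex.Re ((\sum_x `|u x 0|) ^+ 2).
apply: (@Rlim_ge0 _ K) => e e0; have [T' [hT' pT'] close] := hV _ e0.
have : `|hform T u - hform T' u| <= (e * K)%:C%C.
  rewrite -hformB /hform mxE.
  apply: le_trans (ler_norm_sum _ _ _) _.
  apply: le_trans (_ : \sum_y (\sum_x `|u x 0| * (e * V)%:C%C) * `|u y 0| <= _).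
    apply: ler_sum => y _; rewrite normrM ler_wpM2r// mxE.
    apply: le_trans (ler_norm_sum _ _ _) _; apply: ler_sum => x _.
    by rewrite normrM !mxE norm_conjC ler_wpM2l.
  rewrite -mulr_sumr -mulr_suml mulrAC -expr2.
  have -> : (e * K)%:C%C = (\sum_x `|u x 0|) ^+ 2 * (e * V)%:C%C.
    rewrite /K mulrA rmorphM /= mulrC -pos_complexE//.
    by rewrite exprn_ge0// sumr_ge0.
  exact: lexx.
move=> /norm_complex_Re; rewrite raddfB /= ler_norml => /andP[h _].
have : 0 <= complex.Re (hform T' u).
  by have := pT' u; rewrite (real_form _ hT') lecR.
lra.
Qed.

(** Concentrating the mass of each small cell at a sample point gives a sum of congruences of the
    nonnegative matrices [M i], close to the Toeplitz matrix in every entry. *)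
Lemma toep_moment_ge0 (mu : matrix_measure (circle R) R p) n :
  circle_matrix_measures mu -> psd (toep (moment_seq mu n) (p + n * p)).
Proof.
move=> [pmu mu1]; apply: hermitian_ge0_approx; first exact: toep_herm.
pose V0 a b : R := charge_mass (re_measure (mu a b)) + charge_mass (im_measure (mu a b)).
have V0_ge0 a b : 0 <= V0 a b by rewrite addr_ge0// charge_mass_ge0.
pose V : R := \sum_a \sum_b V0 a b.
have V0V a b : V0 a b <= V.
  rewrite /V (bigD1 a)//= (bigD1 b)//= -addrA lerDl addr_ge0// ?sumr_ge0// => i _.
  by rewrite sumr_ge0.
have V_ge0 : 0 <= V by apply: le_trans (V0V ord0 ord0).
exists (n%:R * (2 * V)) => e e0.
have [I [r [mr close]]] := circle_partition e0.
(* One point per cell; for an empty cell the point 1 stands in, and nothing is compared with it. *)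
have sample i : exists z : circle R, (exists w, r w = i) -> r z = i.
  have [[w rw]|h] := pselect (exists w, r w = i); first by exists w.
  by exists (circle1 R) => h'.
have [zs zsP] := choice sample.
pose z i := circle_val (zs i).
have z1 i : `|z i| = 1 by exact: norm_circle_val.
pose A i := r @^-1` [set i].
(* The block row whose block [j] is [z i ^+ j] times the identity. *)
pose Z i : 'M[C]_(p, p + n * p) :=
  \matrix_(a, x) (if a == (x %% p)%N :> nat then z i ^+ (x %/ p) else 0).
pose M i := matrix_measure_val mu (A i).
have pM i : psd (M i).
  have [hM pM] := pmu (A i) (mr i); split=> //.
  by move: hM; rewrite is_hermitianmxE scale1r => /eqP <-.
exists (\sum_i (Z i) ^t* *m M i *m Z i).
  elim/big_ind : _ => [|x y|i _]; [|exact: psdD|exact: psd_congr].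
  split=> [|u]; first by rewrite adjmx0.
  by rewrite /hform mulmx0 mul0mx mxE.
have approx k a b : (k <= n)%N ->
    `|trig_moment mu k a b - \sum_i z i ^+ k * M i a b| <= (e * (n%:R * (2 * V)))%:C%C.
  move=> kn; rewrite mxE.
  have mk : measurable_fun setT (fun w : circle R => circle_val w ^+ k).
    elim: k {kn} => [|k IH]; first exact: measurable_cst.
    rewrite (_ : (fun w => _) = fun w : circle R => circle_val w * circle_val w ^+ k).
      by apply: measurable_complexM => //; exact: measurable_circle_val.
    by apply/funext => w; rewrite exprS.
  have hk w : `|circle_val w ^+ k - z (r w) ^+ k| <= (n%:R * e)%:C%C.
    apply: le_trans (norm_subX k (norm_circle_val _) (z1 _)) _.
    rewrite rmorphM /= ler_pM ?ler0n// ?rmorph_nat ?ler_nat//.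
    by apply: close; rewrite zsP//; exists w.
  have := complex_integral_approx (mu a b) (phi := fun i => z i ^+ k) mr mk hk.
  rewrite (_ : \sum_i _ = \sum_i z i ^+ k * M i a b); last first.
    by apply: eq_bigr => i _; rewrite mxE.
  move=> /le_trans; apply; rewrite lecR -mulrA [n%:R * _]mulrC -mulrA (ler_wpM2l (ltW e0))//.
  by rewrite [leLHS]mulrC ler_wpM2l ?ler0n// ler_wpM2l// V0V.
(* A constant is a step function on the one-cell partition, so the approximation holds with error
   0. *)
have moment0 : trig_moment mu 0 = 1%:M.
  rewrite -mu1; apply/matrixP => a b; rewrite !mxE.
  have h (w : circle R) : `|circle_val w ^+ 0 - (fun=> 1 : C) tt| <= (0 : R)%:C%C.
    by rewrite expr0 subrr normr0.
  have mt (i : unit) : measurable ((fun=> tt) @^-1` [set i] : set (circle R)).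
    by rewrite (_ : _ @^-1` _ = setT)//; apply/seteqP; split=> // x _; case: i.
  have mc : measurable_fun setT (fun w : circle R => circle_val w ^+ 0).
    rewrite (_ : (fun w => _) = cst 1); first exact: measurable_cst.
    by apply/funext => w; rewrite expr0.
  have := complex_integral_approx (mu a b) (r := fun=> tt) (phi := fun=> 1) mt mc h.
  rewrite mul0r normr_le0 subr_eq0 => /eqP ->; rewrite (big_pred1 tt) => [|[]//].
  rewrite mul1r; congr complex_measure_val.
  by apply/seteqP; split.
have momentE k : (k <= n)%N -> moment_nth (moment_seq mu n) k = trig_moment mu k.
  case: k => [|k] kn; first by rewrite moment0.
  by rewrite /moment_nth /= (nth_map 0%N) ?size_iota// nth_iota.
have bl (x : 'I_(p + n * p)) : (x %/ p <= n)%N.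
  by rewrite -ltnS ltn_divLR// mulSn.
move=> x y; rewrite mxE summxE.
have ZE i : ((Z i) ^t* *m M i *m Z i) x y =
   (z i ^+ (x %/ p))^* * z i ^+ (y %/ p) * M i (inord (x %% p)) (inord (y %% p)).
  rewrite -mulmxA mxE (bigD1 (inord (x %% p)))//= big1 => [|a ax]; last first.
    rewrite !mxE ifF ?rmorph0 ?mul0r//; apply: contraNF ax => /eqP ax.
    by apply/eqP/val_inj; rewrite /= inordK ?ltn_pmod.
  rewrite addr0 !mxE inordK ?ltn_pmod// eqxx (bigD1 (inord (y %% p)))//= big1 => [|b bys].
    rewrite addr0 !mxE inordK ?ltn_pmod// eqxx.
    by rewrite mulrA mulrAC.
  rewrite !mxE ifF ?mulr0//; apply: contraNF bys => /eqP bys.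
  by apply/eqP/val_inj; rewrite /= inordK ?ltn_pmod.
under eq_bigr do rewrite ZE.
have zz i k l : (k <= l)%N -> (z i ^+ k)^* * z i ^+ l = z i ^+ (l - k).
  move=> kl; rewrite -{1}(subnK kl) exprD mulrCA rmorphXn -exprMn /=.
  by rewrite [_^* * _]mulrC -normCK z1 expr1n expr1n mulr1.
rewrite /toep_entry; case: leqP => xy.
  under eq_bigr do rewrite zz//.
  rewrite momentE ?(leq_trans (leq_subr _ _) (bl y))//.
  apply: approx; exact: leq_trans (leq_subr _ _) (bl y).
rewrite momentE ?(leq_trans (leq_subr _ _) (bl x))//.
have -> : \sum_i (z i ^+ (x %/ p))^* * z i ^+ (y %/ p) *
       M i (inord (x %% p)) (inord (y %% p)) =
    (\sum_i z i ^+ (x %/ p - y %/ p) * M i (inord (y %% p)) (inord (x %% p)))^*.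
  rewrite rmorph_sum; apply: eq_bigr => i _; rewrite -zz ?(ltnW xy)// !rmorphM /= conjCK.
  rewrite [X in X * _ = _]mulrC; congr (_ * _).
  by rewrite -[in LHS](pM i).1 !mxE.
rewrite -rmorphB norm_conjC; apply: approx.
exact: leq_trans (leq_subr _ _) (bl x).
Qed.

End moment_psd.

(** * Measures with finitely many atoms *)

Section discrete_measure.
Context d (T : measurableType d) (R : realType).
Local Notation C := R[i].

Fixpoint discrete_charge (s : seq (R * T)) : {charge set T -> \bar R} :=
  if s is cz :: s' then
    cadd (cscale cz.1 (charge_of_finite_measure (\d_(cz.2)))) (discrete_charge s')
  else czero.

Lemma discrete_chargeE s A :
  discrete_charge s A = (\sum_(cz <- s) cz.1 * \1_A cz.2)%:E.
Proof.
elim: s => [|[c z] s IH]; first by rewrite big_nil.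
by rewrite big_cons EFinD -IH /= /cadd /cscale /= EFinM.
Qed.

Definition discrete_complex N (m : 'I_N -> C) (w : 'I_N -> T) : complex_measure T R :=
  ComplexMeasure (discrete_charge [seq (complex.Re (m i), w i) | i <- enum 'I_N])
    (discrete_charge [seq (complex.Im (m i), w i) | i <- enum 'I_N]).

Lemma discrete_complexE N (m : 'I_N -> C) (w : 'I_N -> T) A :
  complex_measure_val (discrete_complex m w) A = \sum_i m i * (\1_A (w i) : R)%:C%C.
Proof.
rewrite /complex_measure_val !discrete_chargeE.
rewrite (big_map (fun i => (complex.Re (m i), w i))) big_enum.
rewrite (big_map (fun i => (complex.Im (m i), w i))) big_enum /=.
apply/eqP; rewrite eq_complex /= !raddf_sum /=; apply/andP; split; apply/eqP;
by apply: eq_bigr => i _; case: (m i) => a b /=; rewrite !mulr0 ?subr0 ?add0r ?addr0.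
Qed.

End discrete_measure.

Section moment_space_toep.
Variables (R : realType) (q : nat).
Local Notation p := q.+1.
Local Notation C := R[i].

Lemma norm_small_eq0 (x : C) (K : R) :
  (forall e, 0 < e -> `|x| <= (e * K)%:C%C) -> x = 0.
Proof.
move=> h; have xE : `|x| = (complex.Re `|x|)%:C%C by exact: pos_complexE.
apply/eqP; rewrite -normr_le0 xE lecR -oppr_ge0; apply: (@Rlim_ge0 R _ K) => e e0.
by rewrite lerN2 -lecR -xE; exact: h.
Qed.

Lemma measurable_circleX k : measurable_fun setT (fun w : circle R => circle_val w ^+ k).
Proof.
elim: k => [|k IH]; first exact: measurable_cst.
rewrite (_ : (fun w => _) = fun w : circle R => circle_val w * circle_val w ^+ k).
  by apply: measurable_complexM => //; exact: measurable_circle_val.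
by apply/funext => w; rewrite exprS.
Qed.

(** The Jordan parts of a sum of point masses cannot be read off its coefficients, since atoms may
    coincide and cancel. The integral is instead compared with sums over cells, then every atom with
    the sample point of its cell. *)
Lemma discrete_integralX N (m : 'I_N -> C) (w : 'I_N -> circle R) k :
  complex_integral (discrete_complex m w) (fun z => circle_val z ^+ k) =
  \sum_i m i * circle_val (w i) ^+ k.
Proof.
set mu := discrete_complex m w.
set V := charge_mass (re_measure mu) + charge_mass (im_measure mu).
pose S := complex.Re (\sum_i `|m i|).
have SE : \sum_i `|m i| = S%:C%C by rewrite -pos_complexE// sumr_ge0.
apply/eqP; rewrite -subr_eq0; apply/eqP.
apply: (@norm_small_eq0 _ (k%:R * (2 * V) + k%:R * S)) => e e0.
have [I [r [mr close]]] := circle_partition e0.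
have sample i : exists z : circle R, (exists w, r w = i) -> r z = i.
  have [[z rz]|h] := pselect (exists w, r w = i); first by exists z.
  by exists (circle1 R) => h'.
have [zs zsP] := choice sample.
have hk z : `|circle_val z ^+ k - circle_val (zs (r z)) ^+ k| <= (k%:R * e)%:C%C.
  apply: le_trans (norm_subX k (norm_circle_val _) (norm_circle_val _)) _.
  rewrite rmorphM /= rmorph_nat ler_wpM2l ?ler0n//.
  by apply: close; rewrite zsP//; exists z.
have := complex_integral_approx mu (phi := fun i => circle_val (zs i) ^+ k) mr
  (measurable_circleX k) hk.
rewrite -/V; set X := complex_integral _ _; set Y := \sum_i _ => XY.
have YE : Y = \sum_i m i * circle_val (zs (r (w i))) ^+ k.
  rewrite /Y; under eq_bigr do rewrite discrete_complexE mulr_sumr.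
  rewrite exchange_big /=; apply: eq_bigr => i _.
  rewrite (bigD1 (r (w i)))//= big1 => [|j jr].
    by rewrite addr0 indicE mem_set// mulr1 mulrC.
  by rewrite indicE memNset ?mulr0// => /= h; rewrite h eqxx in jr.
have YZ : `|Y - \sum_i m i * circle_val (w i) ^+ k| <= (k%:R * e * S)%:C%C.
  rewrite YE -sumrB; apply: le_trans (ler_norm_sum _ _ _) _.
  rewrite rmorphM /= -SE mulr_sumr; apply: ler_sum => i _.
  by rewrite -mulrBr normrM mulrC ler_wpM2r// distrC.
rewrite -(subrK Y X) -addrA; apply: le_trans (ler_normD _ _) _.
apply: le_trans (lerD XY YZ) _; rewrite -rmorphD /= lecR.
by rewrite le_eqVlt; apply/orP; left; apply/eqP; ring.
Qed.

(** Atoms and masses come from [toep_representation]; its case of order 0 says that the total mass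
    is the identity. *)
Lemma moment_space_toep (s : seq 'M[C]_p) : let n := size s in
  posdef (toep s (p + n * p)) ->
  exists2 mu, circle_matrix_measures mu & moment_seq mu n = s.
Proof.
move=> n /toep_representation[N [z [M [z1 pM ME]]]].
pose w i : circle R := exist _ (z i) (mem_set (z1 i)).
have wE i : circle_val (w i) = z i by [].
pose mu : matrix_measure (circle R) R p := fun a b => discrete_complex (fun i => M i a b) w.
have valE A : matrix_measure_val mu A = \sum_i (\1_A (w i) : R)%:C%C *: M i.
  apply/matrixP => a b; rewrite mxE discrete_complexE summxE; apply: eq_bigr => i _.
  by rewrite mxE mulrC.
exists mu.
  split=> [A mA|].
    have : psd (\sum_i (\1_A (w i) : R)%:C%C *: M i).
      elim/big_ind : _ => [|x y|i _]; [|exact: psdD|].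
        split=> [|u]; first by rewrite adjmx0.
        by rewrite /hform mulmx0 mul0mx mxE.
      by apply: psdZ => //; rewrite ler0c indicE ler0n.
    by rewrite valE => -[h1 h2]; split=> //; rewrite is_hermitianmxE scale1r h1.
  rewrite valE -[RHS](ME 0%N)//; apply: eq_bigr => i _.
  by rewrite indicE mem_set// scale1r expr0 scale1r.
apply: (@eq_from_nth _ 0); first by rewrite size_map size_iota.
move=> l; rewrite size_map size_iota => ln.
rewrite (nth_map 0%N) ?size_iota// nth_iota//.
rewrite -[RHS]/(moment_nth s l.+1) -ME//; apply/matrixP => a b.
rewrite mxE discrete_integralX summxE; apply: eq_bigr => i _.
by rewrite mxE wE mulrC.
Qed.

End moment_space_toep.

Section integral_density.
Context d (T : measurableType d) (R : realType).
Variables (nu lam : {measure set T -> \bar R}) (w : T -> R).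
Hypotheses (mw : measurable_fun setT w) (w0 : forall x, 0 <= w x).
Hypothesis nuE : forall A, measurable A -> nu A = (\int[lam]_(x in A) (w x)%:E)%E.
Local Open Scope ereal_scope.
Import HBNNSimple.

Let integral_density_nnsfun (h : {nnsfun T >-> R}) :
  \int[nu]_x (h x)%:E = \int[lam]_x ((h x)%:E * (w x)%:E).
Proof.
have mE r : measurable (h @^-1` [set r]).
  by rewrite -[X in measurable X]setTI; apply: measurable_funP.
under [LHS]eq_integral do rewrite fimfunE -fsumEFin//.
rewrite [LHS]ge0_integral_fsum//; last 2 first.
  - by move=> r; exact/measurable_EFinP/measurableT_comp.
  - by move=> n x _; rewrite EFinM nnfun_muleindic_ge0.
under [RHS]eq_integral.
  move=> x xD; rewrite fimfunE -fsumEFin// ge0_mule_fsuml; last first.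
    by move=> r; rewrite EFinM nnfun_muleindic_ge0.
  over.
rewrite [RHS]ge0_integral_fsum//; last 2 first.
  - move=> r; apply: emeasurable_funM; last exact/measurable_EFinP.
    by apply/measurable_EFinP; exact: measurableT_comp.
  - move=> n x _; rewrite mule_ge0//; last by rewrite lee_fin.
    by rewrite EFinM nnfun_muleindic_ge0.
apply: eq_fsbigr => r _.
have [r0|r0] := leP 0%R r; last first.
  rewrite preimage_nnfun0// !integral0_eq// => x _; rewrite indicE in_set0 mulr0//.
  by rewrite mul0e.
under [LHS]eq_integral do rewrite EFinM.
rewrite ge0_integralZl_EFin//; last exact/measurable_EFinP/measurable_indic.
rewrite integral_indic// setIT nuE//.
under [RHS]eq_integral do rewrite EFinM -muleA.
rewrite ge0_integralZl_EFin//; last 2 first.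
  by move=> x _; rewrite mule_ge0// lee_fin.
  apply: emeasurable_funM; last exact/measurable_EFinP.
  exact/measurable_EFinP/measurable_indic.
congr (_ * _); rewrite integral_mkcond; apply: eq_integral => x _.
by rewrite patchE indicE; case: ifP => _; rewrite ?mul1e ?mul0e.
Qed.

(** From simple functions to nonnegative ones by monotone convergence. *)
Lemma integral_density (f : T -> \bar R) : measurable_fun setT f ->
  (forall x, 0 <= f x) -> \int[nu]_x f x = \int[lam]_x (f x * (w x)%:E).
Proof.
move=> mf f0; pose f_ := nnsfun_approx measurableT mf.
have fw0 n x : 0 <= (f_ n x)%:E * (w x)%:E by rewrite mule_ge0// lee_fin.
have mfw n : measurable_fun setT (fun x => (f_ n x)%:E * (w x)%:E).
  by apply: emeasurable_funM; exact/measurable_EFinP.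
have ndfw x : {homo (fun n => (f_ n x)%:E * (w x)%:E) : m n / (m <= n)%N >-> m <= n}.
  move=> m n mn; rewrite lee_wpmul2r ?lee_fin//.
  exact/lefP/nd_nnsfun_approx.
transitivity (lim (\int[nu]_x (f_ n x)%:E @[n --> \oo])).
  rewrite -monotone_convergence//=.
  - apply: eq_integral => x _; apply/esym/cvg_lim => //=.
    exact: cvg_nnsfun_approx.
  - by move=> n; exact/measurable_EFinP.
  - by move=> n x _; rewrite lee_fin.
  - by move=> x _ m n mn; rewrite lee_fin; exact/lefP/nd_nnsfun_approx.
rewrite [RHS](_ : _ = lim (\int[lam]_x ((f_ n x)%:E * (w x)%:E) @[n --> \oo])); last first.
  rewrite -monotone_convergence//=.
  apply: eq_integral => x _; apply/esym/cvg_lim => //.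
  have := cvg_nnsfun_approx measurableT mf (fun x _ => f0 x) (I : [set: T] x).
  move=> h; under eq_cvg do rewrite muleC; rewrite muleC.
  by apply: cvgeZl.
by apply: congr_lim; apply/funext => n; exact: integral_density_nnsfun.
Qed.

End integral_density.

Section monotone.
Context d (T : measurableType d) (R : realType).
Local Open Scope ereal_scope.

(* [mu] is compared on sets that are not supposed to be measurable. *)
Definition set_monotone (mu : set T -> \bar R) :=
  forall A B, A `<=` B -> mu A <= mu B.

(** No measurability enters: the integral of a nonnegative function is a supremum over the simple
    functions below it. *)
Lemma ge0_integral_monotone (mu : {measure set T -> \bar R}) (f g : T -> \bar R) :
  (forall x, 0 <= f x) -> (forall x, f x <= g x) ->
  \int[mu]_x f x <= \int[mu]_x g x.
Proof.
move=> f0 fg; have g0 x : 0 <= g x by exact: le_trans (f0 x) (fg x).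
rewrite !ge0_integralTE//; apply: ereal_sup_le => _ [h hf <-]; exists h => // x.
exact: le_trans (hf x) (fg x).
Qed.

End monotone.

Section monotone_measures.
Variable R : realType.
Local Open Scope ereal_scope.

Lemma monotone_lebesgue : set_monotone (@lebesgue_measure R).
Proof. by move=> A B AB; exact: le_mu_ext. Qed.

Lemma monotone_product d1 d2 (T1 : measurableType d1) (T2 : measurableType d2)
    (m1 : {sigma_finite_measure set T1 -> \bar R})
    (m2 : {sigma_finite_measure set T2 -> \bar R}) :
  set_monotone m2 -> set_monotone (product_measure m1 m2).
Proof.
move=> h A B AB; apply: ge0_integral_monotone => x; first exact: measure_ge0.
by apply: h => y; rewrite /xsection /= !inE; exact: AB.
Qed.

Lemma monotone_image d1 d2 (T1 : measurableType d1) (T2 : measurableType d2)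
    (mu : {sigma_finite_measure set T1 -> \bar R}) (f : T1 -> T2) (g : T2 -> T1)
    (mf : measurable_fun setT f) (mg : measurable_fun setT g) (fK : cancel f g) :
  set_monotone mu -> set_monotone (image_measure mu mf mg fK).
Proof. by move=> h A B AB; apply: h => x /=; exact: AB. Qed.

Lemma monotone_tuple d (T : measurableType d)
    (mu : {sigma_finite_measure set T -> \bar R}) n :
  set_monotone mu -> set_monotone (tuple_product_measure mu n).
Proof.
move=> h; elim: n => [|n IH] /=; last exact: monotone_image (monotone_product _ IH).
move=> A B AB /=; rewrite !diracE lee_fin ler_nat.
by case: (boolP (_ \in A)) => // /set_mem /AB /mem_set ->.
Qed.

(** Every layer of the construction is monotone on arbitrary sets: Lebesgue measure is given by an
    outer measure, a product integrates the measures of sections, an image measure takes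
    preimages. *)
Lemma monotone_seq_matrix_lebesgue p n : set_monotone (seq_matrix_lebesgue R p n).
Proof.
apply/monotone_image/monotone_tuple/monotone_image/monotone_tuple.
exact/monotone_image/monotone_product/monotone_lebesgue.
Qed.

End monotone_measures.

Section rows.
Variables (R : realType) (q : nat).
Local Notation p := q.+1.
Local Notation Mat := 'M[R[i]]_p.
Local Open Scope ereal_scope.
Local Notation leb := (matrix_lebesgue R p).

Definition row_seq n (G : 'rV[Mat]_n) : seq Mat := matrix_tuple G.

Lemma size_row_seq n (G : 'rV[Mat]_n) : size (row_seq G) = n.
Proof. by rewrite size_tuple mul1n. Qed.

Lemma nth_row_seq n (G : 'rV[Mat]_n) (l : 'I_n) : nth 0%R (row_seq G) l = G ord0 l.
Proof.
have e : mxvec_index (ord0 : 'I_1) l = l :> nat by rewrite mxvec_index_val mul0n add0n.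
have := @tnth_mktuple _ _ (fun i => mxvec G ord0 i) (mxvec_index ord0 l).
by rewrite mxvecE (tnth_nth 0%R) e.
Qed.

Lemma row_seqP n (G : 'rV[Mat]_n) (s : seq Mat) :
  size s = n -> (forall l : 'I_n, nth 0%R s l = G ord0 l) -> row_seq G = s.
Proof.
move=> sn h; apply: (@eq_from_nth _ 0%R); first by rewrite size_row_seq.
by move=> l; rewrite size_row_seq => ln; rewrite (nth_row_seq G (Ordinal ln)) -h.
Qed.

Lemma seq_measurable_row n (h : seq Mat -> \bar R) : seq_measurable h ->
  measurable_fun setT (fun G : 'rV[Mat]_n => h (row_seq G)).
Proof.
by move=> mh; exact: measurableT_comp (mh _) (@measurable_matrix_tuple _ Mat 1 n).
Qed.

Lemma integral_row n (h : seq Mat -> \bar R) : seq_measurable h -> (forall s, 0 <= h s) ->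
  \int[seq_matrix_lebesgue R p n]_G h (row_seq G) =
  \int[tuple_product_measure leb n]_t h t.
Proof.
move=> mh h0.
rewrite (integral_image _ _ _ _ (g := fun G : 'rV[Mat]_n => h (row_seq G)))//; last first.
  exact: seq_measurable_row.
transitivity (\int[tuple_product_measure leb (1 * n)]_t h t).
  by apply: eq_integral => t _; rewrite /row_seq tuple_matrixK.
suff H m : m = n -> \int[tuple_product_measure leb m]_t h t =
    \int[tuple_product_measure leb n]_t h t by apply: H; rewrite mul1n.
by move=> ->.
Qed.

Lemma scales_tuple n d (T : measurableType d)
    (mu : {sigma_finite_measure set T -> \bar R}) (f : T -> T) (a : R) : (0 <= a)%R ->
  scales mu f a -> scales (tuple_product_measure mu n)
    (fun t : n.-tuple T => [tuple of map f t]) (a ^+ n).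
Proof.
move=> a0 hf; have mm m : measurable_fun setT (fun t : m.-tuple T => [tuple of map f t]).
  apply/measurable_fun_tnthP => i.
  rewrite (_ : _ \o _ = f \o (@tnth m T ^~ i)).
    exact: measurableT_comp hf.1 (measurable_tnth _).
  by apply/funext => t /=; rewrite tnth_map.
elim: n => [|n IH].
  rewrite expr0; split=> [|g mg g0]; [exact: mm|rewrite mul1e]; apply: eq_integral => t _.
  by congr g; rewrite (tuple0 t) [RHS]tuple0.
have mF : measurable_fun setT (fun z : T * n.-tuple T => (f z.1, [tuple of map f z.2])).
  apply: measurable_fun_pair.
    exact: measurableT_comp hf.1 measurable_fst.
  exact: measurableT_comp (mm n) measurable_snd.
have := scales_product (exprn_ge0 n a0) mF hf (fun=> IH).
move=> /(scales_image (@measurable_tuple_cons _ T n) (@measurable_tuple_uncons _ T n)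
   (@tuple_consK T n)).
rewrite -exprS; congr scales; apply/funext => t; apply/val_inj => /=.
by case: (tupleP t).
Qed.

(** Each of the [n] blocks has real dimension [2 * p * p]. *)
Lemma scales_row n (c : R) : (0 < c)%R ->
  scales (seq_matrix_lebesgue R p n) (@scale_coords R p c n) (c ^+ (2 * p * p * n)).
Proof.
move=> c0; have c0' : (0 < c%:C%C)%R by rewrite ltcE /= eqxx.
have hP : lower_pos (c%:C%C%:M : Mat).
  split=> [i j ij|i]; last by rewrite mxE eqxx.
  by rewrite mxE -val_eqE /= ltn_eqF// mulr0n.
have hQ : lower_pos (1%:M : Mat).
  split=> [i j ij|i]; last by rewrite mxE eqxx.
  by rewrite mxE -val_eqE /= ltn_eqF// mulr0n.
have := scales_matrix 0%R hP hQ.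
have -> : complex.Re ((\det (c%:C%C%:M : Mat) * \det (1%:M : Mat)) ^+ (2 * p))%R =
    (c ^+ (2 * p * p))%R.
  by rewrite det1 mulr1 det_scalar -exprM -rmorphXn /= mulnC.
move=> h; have := scales_tuple (1 * n) (exprn_ge0 _ (ltW c0)) h.
move=> /(scales_image (@measurable_tuple_matrix _ Mat 1 n)
  (@measurable_matrix_tuple _ Mat 1 n) (@tuple_matrixK Mat 1 n)).
have -> : (2 * p * p * n = 2 * p * p * (1 * n))%N by rewrite mul1n.
rewrite -exprM; congr scales; apply/funext => G; apply/matrixP => i l.
rewrite !ord1 !mxE tnth_map tnth_mktuple mxvecE.
by rewrite add0r adjmx1 mulmx1 mul_scalar_mx.
Qed.

End rows.

Lemma scales_measure d (T : measurableType d) (R : realType)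
    (mu : {measure set T -> \bar R}) (f : T -> T) (a : R) (A : set T) :
  scales mu f a -> measurable A -> mu A = (a%:E * mu (f @^-1` A))%E.
Proof.
move=> [mf hf] mA; have mfA : measurable (f @^-1` A).
  by rewrite -[X in measurable X]setTI; exact: mf.
have := hf (EFin \o \1_A); rewrite !integral_indic// !setIT; apply.
  exact/measurable_EFinP/measurable_indic.
by move=> x; rewrite lee_fin indicE ler0n.
Qed.

(** Outside [U], the set [D] lies in [V t] minus [U], of measure [(t ^+ a)^-1 - 1] times that of
    [U], which vanishes as [t] tends to 1. [D] is handled by monotonicity only. *)
Lemma squeeze_measure d (T : measurableType d) (R : realType)
    (mu : {measure set T -> \bar R}) (U D A : set T) (V : R -> set T) (a : nat) :
  set_monotone mu -> measurable U -> measurable A -> (mu D < +oo)%E -> U `<=` D ->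
  (forall t, 0 < t < 1 -> [/\ measurable (V t), D `<=` V t &
    mu U = ((t ^+ a)%:E * mu (V t))%E]) ->
  mu (D `&` A) = mu (U `&` A).
Proof.
move=> mono mU mA Doo UD hV.
apply/eqP; rewrite eq_le; apply/andP; split; last first.
  by apply: mono => G [UG AG]; split=> //; exact: UD.
have Uoo : (mu U < +oo)%E by apply: le_lt_trans (mono _ _ UD) Doo.
have Ufin : mu U \is a fin_num by rewrite ge0_fin_numE.
pose u := fine (mu U); have uE : mu U = u%:E by rewrite fineK.
have u0 : 0 <= u by exact: fine_ge0.
have key t : 0 < t < 1 -> (mu (D `&` A) <= mu (U `&` A) + ((t ^+ a)^-1 * u - u)%:E)%E.
  move=> t01; have [mVt DVt] := hV _ t01; rewrite uE => h.
  have [t0 t1] := andP t01.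
  have VtE : mu (V t) = ((t ^+ a)^-1 * u)%:E.
    by rewrite EFinM h muleA -EFinM mulVf ?mul1e// gt_eqF// exprn_gt0.
  have UVt : U `<=` V t by move=> G /UD /DVt.
  have : D `&` A `<=` (U `&` A) `|` (V t `\` U).
    move=> G [DG AG]; have [UG|UG] := pselect (U G); first by left.
    by right; split=> //; exact: DVt.
  move=> /mono /le_trans; apply.
  apply: le_trans (measureU2 _ _ _) _ => //; first exact: measurableI.
    exact: measurableD.
  have VtU : V t `&` U = U by exact: setIidr.
  have Voo : (mu (V t) < +oo)%E by rewrite VtE ltry.
  have E : mu (V t `\` U) = ((t ^+ a)^-1 * u - u)%:E.
    transitivity (mu (V t) - mu (V t `&` U))%E; first exact: measureD.
    by rewrite VtU VtE uE EFinB.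
  by apply: leeD2l; rewrite -E.
apply/lee_addgt0Pr => e e0.
have : (fun t : R => (t ^+ a)^-1 * u - u) t @[t --> 1^'-] --> 0.
  have -> : 0 = ((1 ^+ a)^-1 * u - u :> R) by rewrite expr1n invr1 mul1r subrr.
  apply: cvg_at_left_filter; apply: cvgB; last exact: cvg_cst.
  apply: cvgM; last exact: cvg_cst.
  apply: cvgV; first by rewrite expr1n oner_eq0.
  exact: exprn_continuous.
move=> /cvgrPdist_lt /(_ _ e0) h.
have [t [t01 ht]] : exists t : R, 0 < t < 1 /\ `|0 - ((t ^+ a)^-1 * u - u)| < e.
  apply: (@filter_ex _ ((1 : R)^'-)); near=> t; split; last by near: t.
  by apply/andP; split; near: t; [exact: nbhs_left_gt|exact: nbhs_left_lt].
apply: le_trans (key _ t01) _; rewrite leeD2l// lee_fin ltW//.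
by apply: le_lt_trans ht; rewrite sub0r normrN ler_norm.
Unshelve. all: by end_near. Qed.

(** * The uniform law on the moment space *)

Section uniform_moment_space.
Variables (R : realType) (q : nat).
Local Notation p := q.+1.
Local Notation C := R[i].
Local Notation Mat := 'M[C]_p.
Local Notation mspace n := (@moment_space R p n).
Local Notation lam := (seq_matrix_lebesgue R p).

Definition row_dom n : set 'rV[Mat]_n := [set G | toep_dom n (row_seq G)].
Arguments row_dom : clear implicits.

Lemma row_dom_moment n : row_dom n `<=` mspace n.
Proof.
move=> G /toep_domP h; have := @moment_space_toep R q (row_seq G).
rewrite size_row_seq => /(_ h)[mu cmu muE]; exists mu => //.
apply/rowP => l; rewrite mxE -nth_row_seq -muE.
by rewrite (nth_map 0%N) ?size_iota// nth_iota.
Qed.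

Lemma scale_row_seq n (t : R) (G : 'rV[Mat]_n) :
  row_seq (scale_coords t G) = [seq t%:C%C *: M | M <- row_seq G].
Proof.
apply: row_seqP => [|l]; first by rewrite size_map size_row_seq.
by rewrite (nth_map 0) ?size_row_seq// mxE nth_row_seq.
Qed.

(** The Toeplitz matrix of a measure is nonnegative, and scaling its moments by [t] adds a positive
    multiple of the identity to [t] times it. *)
Lemma moment_row_dom n (t : R) : 0 < t < 1 ->
  mspace n `<=` @scale_coords R p t n @^-1` row_dom n.
Proof.
move=> /andP[t0 t1] _ [mu cmu <-]; apply/toep_domP.
have -> : row_seq (scale_coords t (\row_(l < n) trig_moment mu l.+1)) =
    [seq t%:C%C *: M | M <- moment_seq mu n].
  rewrite scale_row_seq; congr map; apply: row_seqP.
    by rewrite size_map size_iota.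
  by move=> l; rewrite mxE (nth_map 0%N) ?size_iota// nth_iota.
have [tC tC1] : 0 < t%:C%C :> C /\ 0 < 1 - t%:C%C :> C.
  split; first by rewrite ltcE /= eqxx.
  by rewrite subr_gt0 ltcE /= eqxx.
rewrite toep_scale; last by rewrite realE ltW.
rewrite addrC; apply: posdef_psdD.
  by rewrite -scalemx1; apply: posdefZ => //; exact: posdef1.
by apply: psdZ; [exact: ltW|exact: toep_moment_ge0].
Qed.

Lemma measurable_row_dom n : measurable (row_dom n).
Proof.
have h : measurable_fun setT (fun G : 'rV[Mat]_n => toep_dom n (row_seq G)).
  exact: measurableT_comp (@measurable_toep_dom R q (1 * n) n)
    (@measurable_matrix_tuple _ Mat 1 n).
have -> : row_dom n = setT `&` (fun G => toep_dom n (row_seq G)) @^-1` [set true].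
  by rewrite setTI.
exact: h.
Qed.

Local Open Scope ereal_scope.

Lemma measure_scale_row_dom n (t : R) : (0 < t)%R ->
  lam n (row_dom n) = (t ^+ (2 * p * p * n))%:E * lam n (@scale_coords R p t n @^-1` row_dom n).
Proof.
move=> t0; apply: (scales_measure (scales_row q n t0)); exact: measurable_row_dom.
Qed.

(* The moment space is squeezed between [row_dom] and the dilations of [row_dom]
   by [t^-1 > 1], so that its boundary is negligible; it need not be measurable. *)
Lemma moment_space_measure n (A : set 'rV[Mat]_n) :
  lam n (mspace n) < +oo -> measurable A ->
  lam n (mspace n `&` A) = lam n (row_dom n `&` A).
Proof.
move=> Doo mA; have mU := @measurable_row_dom n.
apply: (@squeeze_measure _ _ R (lam n) (row_dom n) (mspace n) A
  (fun t => @scale_coords R p t n @^-1` row_dom n) (2 * p * p * n)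
  (@monotone_seq_matrix_lebesgue R p n) mU mA Doo (@row_dom_moment n)).
move=> t /andP[t0 t1]; split.
- by rewrite -[X in measurable X]setTI; exact: (scales_row q n t0).1.
- by apply: moment_row_dom; rewrite t0.
- exact: measure_scale_row_dom.
Qed.

Lemma uniform_integral n d (Omega : measurableType d) (P : probability Omega R)
    (X : {RV P >-> 'rV[Mat]_n}) :
  uniform_on (lam n) (mspace n) X ->
  exists2 c : R, (0 < c)%R & forall g : 'rV[Mat]_n -> \bar R,
    measurable_fun setT g -> (forall G, 0 <= g G) ->
    \int[P]_w g (X w) = c%:E * \int[lam n]_G (g G * (toep_weight n 0 (row_seq G))%:E).
Proof.
move=> unif; set D := mspace n in unif.
(* A null or an infinite volume would have [fine] equal to 0, and then the law of [X] would have
   total mass 0. The hypothesis on [X] thus contains that the volume is positive and finite. *)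
have D1 : fine (lam n D) != 0%R.
  have := unif setT measurableT; rewrite setIT.
  have -> : distribution P X setT = 1.
    by rewrite /distribution /pushforward preimage_setT probability_setT.
  case: eqP => // ->; rewrite invr0 mulr0 => /eqP.
  by rewrite eqe oner_eq0.
have Doo : lam n D < +oo.
  by rewrite ltey; apply: contra D1 => /eqP ->.
have D0 : (0 < fine (lam n D))%R by rewrite lt_neqAle eq_sym D1 fine_ge0.
set c := (fine (lam n D))^-1%R; have c0 : (0 < c)%R by rewrite invr_gt0.
exists c => // g mg g0.
have mU := @measurable_row_dom n.
have wE G : toep_weight n 0 (row_seq G) = \1_(row_dom n) G :> R.
  rewrite /toep_weight expr0 mulr1 indicE; congr (_%:R).
  apply/esym; have [h|/negP h] := boolP (toep_dom n (row_seq G)).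
    by rewrite mem_set.
  by rewrite memNset.
pose w G : R := (c * \1_(row_dom n) G)%R.
have mw : measurable_fun setT w.
  by apply: measurable_funM => //; exact: measurable_indic.
have w0 G : (0 <= w G)%R by rewrite mulr_ge0 ?(ltW c0)// indicE ler0n.
have mX : measurable_fun setT X by exact: measurable_funP.
transitivity (\int[distribution P X]_G g G).
  by rewrite ge0_integral_pushforward.
rewrite (integral_density (lam := lam n) mw w0)// => [|A mA]; last first.
  rewrite [LHS](unif A mA) (moment_space_measure Doo mA).
  under eq_integral do rewrite EFinM.
  rewrite ge0_integralZl_EFin//; last 2 first.
  - apply: measurable_funTS; exact/measurable_EFinP/measurable_indic.
  - exact: ltW.
  rewrite integral_indic// mulrC EFinM fineK//.
  rewrite ge0_fin_numE//; apply: le_lt_trans Doo.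
  by apply: monotone_seq_matrix_lebesgue => G [/row_dom_moment].
rewrite -ge0_integralZl_EFin//; first last.
- exact: ltW.
- apply: emeasurable_funM => //; apply/measurable_EFinP.
  by under eq_fun do rewrite wE; exact: measurable_indic.
- by move=> G _; rewrite mule_ge0// lee_fin wE indicE ler0n.
by apply: eq_integral => G _; rewrite wE /w EFinM muleCA.
Qed.

End uniform_moment_space.

(** * The Gaussian law *)

Section continuous_rows.
Variables (R : realType) (p k : nat).
Local Notation C := R[i].
Local Notation Row := 'rV['M[C]_p]_k.

(* [f] continuous is the limit of the functions [f \o round_decode m \o round_code m],
   which are measurable because they take countably many values. *)
Definition round_code (m : nat) (G : Row) : 'rV['M[int * int]_p]_k :=
  \row_l \matrix_(i, j) (Num.floor (complex.Re (G ord0 l i j) * m.+1%:R),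
                         Num.floor (complex.Im (G ord0 l i j) * m.+1%:R)).

Definition round_decode (m : nat) (c : 'rV['M[int * int]_p]_k) : Row :=
  \row_l \matrix_(i, j) Complex ((c ord0 l i j).1%:~R / m.+1%:R)
                                ((c ord0 l i j).2%:~R / m.+1%:R).

Lemma measurable_row_entry (l : 'I_k) (i j : 'I_p) :
  measurable_fun setT (fun G : Row => G ord0 l i j).
Proof.
exact: measurableT_comp (measurable_entry i j) (measurable_entry ord0 l).
Qed.

Lemma measurable_round_code m c : measurable [set G | round_code m G = c].
Proof.
have mfl (f : Row -> R) (a : int) : measurable_fun setT f ->
    measurable [set G | Num.floor (f G * m.+1%:R) = a].
  move=> mf; have mg : measurable_fun setT (fun G => f G * m.+1%:R).
    exact: measurable_funM.
  have m1 : measurable_fun setT (fun G => (a%:~R <= f G * m.+1%:R) &&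
      (f G * m.+1%:R < (a + 1)%:~R)).
    by apply: measurable_and; [exact: measurable_fun_ler|exact: measurable_fun_ltr].
  rewrite (_ : [set G | _] = setT `&` (fun G => (a%:~R <= f G * m.+1%:R) &&
      (f G * m.+1%:R < (a + 1)%:~R)) @^-1` [set true]); first exact: m1.
  rewrite setTI; apply/seteqP; split=> G /=; first by move=> <-; exact: floor_itv.
  exact: floor_def.
rewrite (_ : [set G | _] = \bigcap_(x in [set: 'I_k * 'I_p * 'I_p])
   ([set G : Row | Num.floor (complex.Re (G ord0 x.1.1 x.1.2 x.2) * m.+1%:R) =
      (c ord0 x.1.1 x.1.2 x.2).1] `&`
    [set G : Row | Num.floor (complex.Im (G ord0 x.1.1 x.1.2 x.2) * m.+1%:R) =
      (c ord0 x.1.1 x.1.2 x.2).2])).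
  apply: fin_bigcap_measurable => [|x _]; first exact: finite_finset.
  apply: measurableI; apply: mfl.
    exact: measurableT_comp (@measurable_Re R) (measurable_row_entry _ _ _).
  exact: measurableT_comp (@measurable_Im R) (measurable_row_entry _ _ _).
apply/seteqP; split=> G /=.
  by move=> <- x _ /=; rewrite !mxE.
move=> h; apply/rowP => l; apply/matrixP => i j; rewrite !mxE.
by have [/= -> ->] := h (l, i, j) I; case: (c ord0 l i j).
Qed.

Lemma measurable_round (f : Row -> R) m :
  measurable_fun setT (fun G => f (round_decode m (round_code m G))).
Proof.
move=> _ B mB; rewrite setTI.
(* Codes are integer matrices, hence countable: the union runs over their [pickle] numbers. *)
rewrite (_ : _ @^-1` B = \bigcup_n [set G | exists c,
   [/\ unpickle n = Some c, B (f (round_decode m c)) & round_code m G = c]]).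
  apply: bigcup_measurable => n _.
  case E : (unpickle n) => [c|]; last first.
    by rewrite (_ : [set G | _] = set0)//; apply/seteqP; split=> // G [c []].
  have [Bc|Bc] := pselect (B (f (round_decode m c))).
    rewrite (_ : [set G | _] = [set G | round_code m G = c]).
      exact: measurable_round_code.
    by apply/seteqP; split=> G /=; [move=> [_ [[<-]]]|exists c].
  rewrite (_ : [set G | _] = set0)//; apply/seteqP; split=> // G [c' [[<-]]] //.
apply/seteqP; split=> G /=.
  move=> BG; exists (pickle (round_code m G)) => //=; exists (round_code m G).
  by rewrite pickleK.
by move=> [n _ [c [_ Bc hc]]]; rewrite hc.
Qed.

Lemma round_cvg (G : Row) : round_decode m (round_code m G) @[m --> \oo] --> G.
Proof.
apply/cvg_ballP => e e0.
(* Radii of balls are positive elements of [R[i]], hence real; half of the radius is left to each of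
   the real and imaginary parts. *)
have Re0 : 0 < complex.Re e := Re_gt0 e0.
have e20 : 0 < complex.Re e / 2 by rewrite divr_gt0.
near=> m; split=> // i l; split=> // a b; rewrite /ball /= /ball_ /=.
have close (x : R) : `|x - (Num.floor (x * m.+1%:R))%:~R / m.+1%:R| < complex.Re e / 2.
  have m0 : 0 < m.+1%:R :> R by rewrite ltr0n.
  have -> : x - (Num.floor (x * m.+1%:R))%:~R / m.+1%:R =
      (x * m.+1%:R - (Num.floor (x * m.+1%:R))%:~R) / m.+1%:R.
    by rewrite mulrBl mulfK// gt_eqF.
  have /andP[h1 h2] := floor_itv (x * m.+1%:R).
  rewrite ger0_norm ?divr_ge0 ?subr_ge0// ?ler0n//.
  apply: (@le_lt_trans _ _ (m.+1%:R^-1)).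
    rewrite ler_pdivrMr// mulVf ?gt_eqF// lerBlDl.
    by rewrite intrD1 in h2; exact: ltW.
  near: m; exact: (near_infty_natSinv_lt (PosNum e20)).
rewrite !mxE (pos_complexE (ltW e0)) ord1.
have := @norm_complex_le R (G ord0 l a b -
  Complex ((Num.floor (complex.Re (G ord0 l a b) * m.+1%:R))%:~R / m.+1%:R)
          ((Num.floor (complex.Im (G ord0 l a b) * m.+1%:R))%:~R / m.+1%:R)).
move=> /(_ _ _ (lexx _) (lexx _)) /le_lt_trans; apply.
have -> : complex.Re e = complex.Re e / 2 + complex.Re e / 2 by field.
by rewrite ltcR ltrD// raddfB; exact: close.
Unshelve. all: by end_near. Qed.

Lemma measurable_continuous_row (f : Row -> R) : continuous f -> measurable_fun setT f.
Proof.
move=> cf; apply: (@measurable_fun_cvg _ _ _ _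
   (fun m G => f (round_decode m (round_code m G)))).
  by move=> m; exact: measurable_round.
by move=> G _; apply: continuous_cvg; [exact: cf|exact: round_cvg].
Qed.

End continuous_rows.

Lemma mxvec_index_row k (l : 'I_k) : mxvec_index (ord0 : 'I_1) l = l :> nat.
Proof. by rewrite mxvec_index_val mul0n. Qed.

Section rectangles.
Context d (T : measurableType d) (R : realType).
Variable mu : {sigma_finite_measure set T -> \bar R}.
Local Open Scope ereal_scope.

Lemma tuple_product_rect n (B : 'I_n -> set T) : (forall i, measurable (B i)) ->
  measurable [set t : n.-tuple T | forall i, B i (tnth t i)] /\
  tuple_product_measure mu n [set t | forall i, B i (tnth t i)] = \prod_(i < n) mu (B i).
Proof.
elim: n B => [|n IH] B mB.
  have -> : [set t : 0.-tuple T | forall i, B i (tnth t i)] = setT.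
    by apply/seteqP; split=> // t _ [].
  by split=> //=; rewrite big_ord0 diracT.
have [mr rE] := IH (fun i => B (lift ord0 i)) (fun i => mB _).
have pre : @tuple_cons T n @^-1` [set t | forall i, B i (tnth t i)] =
    B ord0 `*` [set t | forall i, B (lift ord0 i) (tnth t i)].
  apply/seteqP; split=> -[x t] /=.
    move=> h; split; first exact: (h ord0).
    by move=> i /=; have := h (lift ord0 i); rewrite tnth_consS.
  move=> [h0 hS] i; case: (unliftP ord0 i) => [j ->|->]; first by rewrite tnth_consS; exact: hS.
  exact: h0.
split.
  have -> : [set t : n.+1.-tuple T | forall i, B i (tnth t i)] =
      \bigcap_(i in [set: 'I_n.+1]) (@tnth _ T ^~ i @^-1` B i).
    by apply/seteqP; split=> t /= h; [move=> i _; exact: h|move=> i; exact: (h i I)].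
  apply: fin_bigcap_measurable => [|i _]; first exact: finite_finset.
  by rewrite -[X in measurable X]setTI; exact: measurable_tnth.
rewrite big_ord_recl -rE -[LHS]/(product_measure mu (tuple_product_measure mu n)
  (@tuple_cons T n @^-1` [set t | forall i, B i (tnth t i)])) pre.
exact: product_measure1E.
Qed.

(** Boxes, a generating family closed under intersection, on which independence determines the joint
    law. *)
Definition row_rect k : set (set 'rV[T]_k) :=
  [set A | exists2 B : 'I_k -> set T, (forall l, measurable (B l)) &
     A = [set M : 'rV[T]_k | forall l, B l (M ord0 l)]].

Lemma row_rect_generate k : @measurable _ 'rV[T]_k = <<s @row_rect k >>.
Proof.
apply/seteqP; split.
  apply: smallest_sub; first exact: smallest_sigma_algebra.
  move=> _ [[i l] _ [B mB <-]]; apply: sub_sigma_algebra; rewrite setTI.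
  exists (fun l' => if l' == l then B else setT) => [l'|]; first by case: ifP.
  apply/seteqP; split=> M /=; rewrite (ord1 i).
    by move=> h l'; case: eqP => // ->.
  by move=> /(_ l); rewrite eqxx.
apply: smallest_sub; first exact: sigma_algebra_measurable.
move=> _ [B mB ->].
have -> : [set M : 'rV[T]_k | forall l, B l (M ord0 l)] =
    \bigcap_(l in [set: 'I_k]) ((fun M : 'rV[T]_k => M ord0 l) @^-1` B l).
  by apply/seteqP; split=> M /= h; [move=> l _; exact: h|move=> l; exact: (h l I)].
apply: fin_bigcap_measurable => [|l _]; first exact: finite_finset.
by rewrite -[X in measurable X]setTI; exact: measurable_entry.
Qed.

Lemma row_rect_setI k : setI_closed (@row_rect k).
Proof.
move=> _ _ [B mB ->] [B' mB' ->]; exists (fun l => B l `&` B' l).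
  by move=> l; exact: measurableI.
by apply/seteqP; split=> M /= => [[h h'] l|h]; [split|split=> l; have [] := h l].
Qed.

Lemma row_product_rect k (B : 'I_k -> set T) : (forall l, measurable (B l)) ->
  matrix_product_measure mu 1 k [set M : 'rV[T]_k | forall l, B l (M ord0 l)] =
  \prod_(l < k) mu (B l).
Proof.
move=> mB; have e : (1 * k = k)%N by rewrite mul1n.
have [_ H] := tuple_product_rect (B := fun i : 'I_(1 * k) => B (cast_ord e i)) (fun i => mB _).
transitivity (\prod_(i < 1 * k) mu (B (cast_ord e i))); last first.
  rewrite [RHS](reindex (cast_ord e))//=.
  by exists (cast_ord (esym e)) => i _; rewrite ?cast_ordK ?cast_ordKV.
rewrite -H -[LHS]/(tuple_product_measure mu (1 * k)
  (@tuple_matrix T 1 k @^-1` [set M : 'rV[T]_k | forall l, B l (M ord0 l)])); congr (_ _).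
have eE l : cast_ord e (mxvec_index (ord0 : 'I_1) l) = l.
  by apply/val_inj; exact: mxvec_index_row.
apply/seteqP; split=> t /= h.
  move=> i; have := h (cast_ord e i); rewrite mxE (_ : mxvec_index _ _ = i)//.
  by apply/val_inj; exact: (mxvec_index_row (cast_ord e i)).
by move=> l; have := h (mxvec_index ord0 l); rewrite eE mxE.
Qed.

End rectangles.

Section joint_density.
Context d (T : measurableType d) (R : realType).
Variables (gm lam : {sigma_finite_measure set T -> \bar R}) (g : T -> R).
Hypotheses (mg : measurable_fun setT g) (g0 : forall x, 0 <= g x).
Hypothesis gmE : forall A, measurable A -> gm A = (\int[lam]_(x in A) (g x)%:E)%E.
Local Open Scope ereal_scope.

Lemma measurable_prod_tuple n :
  measurable_fun setT (fun t : n.-tuple T => \prod_(i < n) g (tnth t i))%R.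
Proof.
apply: measurable_prod => i _.
exact: measurableT_comp mg (measurable_tnth _).
Qed.

(** Induction on the length: the density of the head is moved inside the integral over the tail. *)
Lemma integral_tuple_density n (h : n.-tuple T -> \bar R) : measurable_fun setT h ->
  (forall t, 0 <= h t) ->
  \int[tuple_product_measure gm n]_t h t =
  \int[tuple_product_measure lam n]_t (h t * (\prod_(i < n) g (tnth t i))%:E).
Proof.
elim: n h => [|n IH] h mh h0.
  rewrite !integral_tuple0//; last first.
    by apply: emeasurable_funM => //; apply/measurable_EFinP; exact: measurable_prod_tuple.
  by rewrite big_ord0 mule1.
have mp m : measurable_fun setT (fun t : m.-tuple T => (\prod_(i < m) g (tnth t i))%:E).
  by apply/measurable_EFinP; exact: measurable_prod_tuple.
have p0 m (t : m.-tuple T) : 0 <= (\prod_(i < m) g (tnth t i))%:E.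
  by rewrite lee_fin prodr_ge0.
rewrite !integral_tuple_cons//; first last.
- by move=> t; rewrite mule_ge0.
- by apply: emeasurable_funM; [exact: mh|exact: mp].
have mhc : measurable_fun setT (fun z : T * n.-tuple T => h (tuple_cons z)).
  exact: measurableT_comp mh (@measurable_tuple_cons _ T n).
have mhp : measurable_fun setT
    (fun z : T * n.-tuple T => h (tuple_cons z) * (\prod_(i < n) g (tnth z.2 i))%:E).
  apply: emeasurable_funM => //; exact: measurableT_comp (mp n) measurable_snd.
under eq_integral => x _.
  rewrite IH//; last exact: measurableT_comp mhc (measurable_pair1 _).
  over.
rewrite (integral_density (lam := lam) mg g0 gmE); first last.
- by move=> x; apply: integral_ge0 => t _; rewrite mule_ge0.
- apply: (measurable_fun_fubini_tonelli_F
    (fun z : T * n.-tuple T => h (tuple_cons z) * (\prod_(i < n) g (tnth z.2 i))%:E)) => //.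
  by move=> z; rewrite mule_ge0.
apply: eq_integral => x _; rewrite muleC -ge0_integralZl_EFin//; first last.
- exact: measurableT_comp mhp (measurable_pair1 _).
- by move=> t _; rewrite mule_ge0.
apply: eq_integral => t _; rewrite big_ord_recl EFinM muleCA.
by under [in RHS]eq_bigr do rewrite tnth_consS.
Qed.

End joint_density.

Section ginibre.
Variables (R : realType) (p : nat).
Local Notation C := R[i].
Local Notation Mat := 'M[C]_p.

Definition sqnorm (M : Mat) : R :=
  \sum_i \sum_j (complex.Re (M i j) ^+ 2 + complex.Im (M i j) ^+ 2).

Lemma sqnorm_ge0 M : 0 <= sqnorm M.
Proof. by do 2!apply: sumr_ge0 => ? _; rewrite addr_ge0// sqr_ge0. Qed.

Lemma sqnormE M : (sqnorm M)%:C%C = \sum_i \sum_j `|M i j| ^+ 2.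
Proof.
rewrite /sqnorm rmorph_sum; apply: eq_bigr => i _.
by rewrite /= rmorph_sum /=; apply: eq_bigr => j _; rewrite add_Re2_Im2.
Qed.

Lemma frobenius_norm2 M : frobenius_norm M ^+ 2 = sqnorm M.
Proof.
rewrite /frobenius_norm; have -> : complex.Re (\tr (M ^t* *m M)) = sqnorm M.
  suff -> : \tr (M ^t* *m M) = (sqnorm M)%:C%C by [].
  rewrite sqnormE exchange_big; apply: eq_bigr => i _; rewrite mxE.
  by apply: eq_bigr => j _; rewrite !mxE mulrC -normCK.
by rewrite sqr_sqrtr// sqnorm_ge0.
Qed.

Lemma sqnormZ (c : R) M : sqnorm (c%:C%C *: M) = c ^+ 2 * sqnorm M.
Proof.
rewrite /sqnorm mulr_sumr; apply: eq_bigr => i _; rewrite mulr_sumr.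
apply: eq_bigr => j _; rewrite mxE; case: (M i j) => a b /=.
by rewrite !mul0r subr0 addr0; ring.
Qed.

Lemma measurable_sqnorm : measurable_fun setT sqnorm.
Proof.
apply: measurable_sum => i; apply: measurable_sum => j.
apply: measurable_funD; apply: measurable_funX.
  exact: measurableT_comp (@measurable_Re R) (measurable_entry i j).
exact: measurableT_comp (@measurable_Im R) (measurable_entry i j).
Qed.

Definition ginibre_const : R := (pi ^+ (p ^ 2))^-1.

Lemma ginibre_const_gt0 : 0 < ginibre_const.
Proof. by rewrite invr_gt0 exprn_gt0// pi_gt0. Qed.

Lemma ginibre_pdfE M : ginibre_pdf M = ginibre_const * expR (- sqnorm M).
Proof. by rewrite /ginibre_pdf frobenius_norm2. Qed.

Lemma ginibre_pdf_ge0 (M : Mat) : 0 <= ginibre_pdf M.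
Proof. by rewrite ginibre_pdfE mulr_ge0 ?expR_ge0// ltW// ginibre_const_gt0. Qed.

Lemma measurable_ginibre_pdf : measurable_fun setT (@ginibre_pdf R p).
Proof.
rewrite (_ : @ginibre_pdf R p = fun M => ginibre_const * expR (- sqnorm M)).
  apply: measurable_funM => //; apply: measurableT_comp => //.
  by apply: measurable_funN; exact: measurable_sqnorm.
by apply/funext => M; rewrite ginibre_pdfE.
Qed.

Variable k : nat.

Definition row_sqnorm (G : 'rV[Mat]_k) : R := \sum_l sqnorm (G ord0 l).

Lemma row_sqnorm_ge0 G : 0 <= row_sqnorm G.
Proof. by apply: sumr_ge0 => l _; exact: sqnorm_ge0. Qed.

Lemma row_sqnormZ c (G : 'rV[Mat]_k) :
  row_sqnorm (scale_coords c G) = c ^+ 2 * row_sqnorm G.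
Proof.
by rewrite /row_sqnorm mulr_sumr; apply: eq_bigr => l _; rewrite mxE sqnormZ.
Qed.

Lemma measurable_row_sqnorm : measurable_fun setT row_sqnorm.
Proof.
apply: measurable_sum => l.
exact: measurableT_comp measurable_sqnorm (measurable_entry ord0 l).
Qed.

Definition row_gauss (G : 'rV[Mat]_k) : R := expR (- row_sqnorm G).

Lemma measurable_row_gauss : measurable_fun setT row_gauss.
Proof.
apply: measurableT_comp => //; apply: measurable_funN.
exact: measurable_row_sqnorm.
Qed.

Lemma prod_ginibre_pdf (G : 'rV[Mat]_k) :
  \prod_l ginibre_pdf (G ord0 l) = ginibre_const ^+ k * row_gauss G.
Proof.
rewrite /row_gauss /row_sqnorm -sumrN expR_sum -[k in _ ^+ k]card_ord -prodr_const.
by rewrite -big_split; apply: eq_bigr => l _; rewrite ginibre_pdfE.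
Qed.

End ginibre.

Section ginibre_law.
Variables (R : realType) (p k : nat) (hk : (1 <= k)%N).
Context d (Omega : measurableType d) (Q : probability Omega R).
Local Notation Mat := 'M[R[i]]_p.
Variable G : 'I_k -> {RV Q >-> Mat}.
Hypothesis hGind : mutually_independent G.
Hypothesis hGdens :
  forall l, has_density (matrix_lebesgue R p) (@ginibre_pdf R p) (G l).
Local Open Scope ereal_scope.

(** The common law of all the [G l], which share a density; [hk] provides an index to name it. *)
Let gm : {sigma_finite_measure set Mat -> \bar R} := distribution Q (G (Ordinal hk)).

Let gmE A : measurable A -> gm A = \int[matrix_lebesgue R p]_(x in A) (ginibre_pdf x)%:E.
Proof. exact: hGdens. Qed.

Let rowG w : 'rV[Mat]_k := \row_l G l w.

Let measurable_rowG : measurable_fun setT rowG.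
Proof.
apply: measurable_matrixP => i l.
rewrite (_ : (fun x => _) = G l); last by apply/funext => w; rewrite mxE.
exact: measurable_funP.
Qed.

Let rG : {mfun Omega >-> 'rV[Mat]_k} :=
  HB.pack rowG (isMeasurableFun.Build _ _ _ _ rowG measurable_rowG).

(** Two finite measures that agree on boxes are equal; on a box this is the product formula of
    independence. *)
Let law_rowG A : measurable A -> distribution Q rG A = matrix_product_measure gm 1 k A.
Proof.
move=> mA; apply: (@measure_unique _ R _ (@row_rect _ Mat k) (fun=> setT) (row_rect_generate _ k)
   (@row_rect_setI _ Mat k) _ _ (distribution Q rG)) => //.
- move=> _; exists (fun=> setT) => //.
  by apply/seteqP; split.
- by rewrite bigcup_const.
- move=> _ [B mB ->]; apply: etrans (esym (row_product_rect gm mB)).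
  have := hGind [set: 'I_k]%SET mB.
  have -> : \bigcap_(i in [set i | i \in [set: 'I_k]%SET]) (G i @^-1` B i) =
      rowG @^-1` [set M | forall l, B l (M ord0 l)].
    apply/seteqP; split=> w /= h.
      by move=> l; rewrite mxE; apply: h; rewrite /= inE.
    by move=> l _ /=; have := h l; rewrite mxE.
  move=> H; apply: etrans H _.
  rewrite (eq_bigl xpredT) => [|l]; last by rewrite inE.
  apply: eq_bigr => l _; rewrite gmE//; exact: hGdens.
- by move=> _; rewrite (le_lt_trans (probability_le1 _ _)) ?ltry.
Qed.

Lemma integral_row_of (F : 'rV[Mat]_k -> \bar R) : measurable_fun setT F ->
  (forall M, 0 <= F M) ->
  \int[Q]_w F (\row_l G l w) =
  (ginibre_const R p ^+ k)%:E *
    \int[seq_matrix_lebesgue R p k]_M (F M * (row_gauss M)%:E).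
Proof.
move=> mF F0.
have mFt : measurable_fun setT (F \o @tuple_matrix Mat 1 k).
  exact: measurableT_comp mF (@measurable_tuple_matrix _ Mat 1 k).
transitivity (\int[matrix_product_measure gm 1 k]_M F M).
  transitivity (\int[distribution Q rG]_M F M).
    by rewrite ge0_integral_pushforward.
  by apply: eq_measure_integral => A mA _; exact: law_rowG.
rewrite integral_image// (integral_tuple_density (lam := matrix_lebesgue R p)
  (@measurable_ginibre_pdf R p) (@ginibre_pdf_ge0 R p) gmE mFt)//; last by move=> t; exact: F0.
have mg : measurable_fun setT (fun M : 'rV[Mat]_k => F M * (row_gauss M)%:E).
  apply: emeasurable_funM => //; apply/measurable_EFinP.
  exact: measurable_row_gauss.
have c0 : (0 <= ginibre_const R p ^+ k)%R by rewrite exprn_ge0// ltW// ginibre_const_gt0.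
rewrite -ge0_integralZl_EFin//; last by move=> M _; rewrite mule_ge0// lee_fin expR_ge0.
have mg' : measurable_fun setT (fun M : 'rV[Mat]_k =>
    (ginibre_const R p ^+ k)%:E * (F M * (row_gauss M)%:E)).
  exact: measurable_funeM.
rewrite (integral_image _ _ _ _ mg'); last first.
  by move=> M; rewrite !mule_ge0// lee_fin// expR_ge0.
apply: eq_integral => t _; rewrite muleCA -EFinM -prod_ginibre_pdf; congr (_ * _%:E).
have e : (1 * k = k)%N by rewrite mul1n.
rewrite [LHS](reindex (cast_ord (esym e))) /=; last first.
  by exists (cast_ord e) => i _; rewrite ?cast_ordK ?cast_ordKV.
apply: eq_bigr => l _; rewrite mxE; congr (ginibre_pdf (tnth t _)).
by apply/esym/val_inj; exact: (mxvec_index_row l).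
Qed.

End ginibre_law.

(** * The limit *)

Section toep_limit.
Variables (R : realType) (q : nat).
Local Notation p := q.+1.
Local Notation C := R[i].
Local Notation Mat := 'M[C]_p.
Implicit Types s : seq Mat.

(** Inverse of [1 + y <= expR y] at [y = x / (1 - x)], where [1 + y] is the inverse of [1 - x]. *)
Lemma expR_le_1B (x : R) : x < 1 -> expR (- (x / (1 - x))) <= 1 - x.
Proof.
move=> x1; have x0 : 0 < 1 - x by rewrite subr_gt0.
rewrite expRN -[leRHS]invrK lef_pV2 ?posrE ?expR_gt0 ?invr_gt0//.
apply: le_trans (expR_ge1Dx _); rewrite le_eqVlt; apply/orP; left; apply/eqP.
by field; rewrite gt_eqF.
Qed.

Definition seq_sqnorm s : R := \sum_(l < size s) sqnorm (nth 0 s l).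

Lemma seq_sqnormZ (t : R) s :
  seq_sqnorm [seq t%:C%C *: M | M <- s] = t ^+ 2 * seq_sqnorm s.
Proof.
rewrite /seq_sqnorm size_map mulr_sumr; apply: eq_bigr => l _.
by rewrite (nth_map 0)// sqnormZ.
Qed.

Lemma tr_toep_row s : let F := toep_row s (size s) in
  \tr (F *m F ^t*) = (seq_sqnorm s)%:C%C.
Proof.
move=> F; set k := size s in F *.
have FE a (l : 'I_k) (b : 'I_p) : F a (mxvec_index l b) = (nth 0 s l) a b.
  have -> : F a (mxvec_index l b) =
      toep s (p + k * p) (lshift (k * p) a) (rshift p (mxvec_index l b)).
    by rewrite !mxE.
  rewrite (@toep_entry_row _ _ _ _ _ _ a l.+1 b)//.
  by rewrite -[LHS]/(p + nat_of_ord (mxvec_index l b))%N mxvec_index_val mulSn addnA.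
have -> : \tr (F *m F ^t*) = \sum_a \sum_(l < k) \sum_b `|(nth 0 s l) a b| ^+ 2.
  apply: eq_bigr => a _; rewrite mxE (reindex _ (curry_mxvec_bij _ _)) /=.
  rewrite pair_big /=; apply: eq_bigr => -[l b] _ /=.
  by rewrite !mxE -normCK -FE !mxE.
rewrite exchange_big /seq_sqnorm rmorph_sum /=; apply: eq_bigr => l _.
by rewrite sqnormE.
Qed.

Section bounds.
Variable s : seq Mat.
Hypothesis pT : posdef (toep s (p + size s * p)).
Let k := size s.
Let M := toep s (k * p).
Let F := toep_row s k.
Let Y := F *m invmx M *m F ^t*.

Let pM : posdef M. Proof. by have [] := posdef_toep_dr pT. Qed.
Let pL : posdef (1%:M - Y). Proof. by have [] := posdef_toep_dr pT. Qed.
Let pY : psd Y.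
Proof.
have := psd_congr (F ^t*) (posdef_psd (posdefV pM)).
by rewrite trmxCK.
Qed.

Let hE : toep_ratio s k = \det (1%:M - Y). Proof. exact: toep_ratioE. Qed.

(** [M <= b] gives a lower bound on the trace of [Y], and Hadamard's inequality with
    [1 - y <= expR (- y)] bounds the determinant of [1 - Y] by the exponential of minus that
    trace. *)
Lemma toep_ratio_le (b : R) : 0 < b -> psd (b%:C%C%:M - M) ->
  complex.Re (toep_ratio s k) <= expR (- (seq_sqnorm s / b)).
Proof.
move=> b0 hb; have b0C : 0 < b%:C%C :> C by rewrite ltcE /= eqxx.
have trY : seq_sqnorm s / b <= complex.Re (\tr Y).
  have := psd_trace_conj_le F (psdB_inv_ge pM b0C hb).
  rewrite mul_mx_scalar -scalemxAl linearZ /= tr_toep_row -fmorphV -rmorphM /=.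
  by rewrite (pos_complexE (psd_trace_ge0 pY)) lecR mulrC.
rewrite hE; apply: le_trans (_ : expR (- complex.Re (\tr Y)) <= _); last first.
  by rewrite ler_expR lerN2.
have hH := hadamard pL.
have diag i : (1%:M - Y) i i = (1 - complex.Re (Y i i))%:C%C.
  have d0 := ltW (posdef_diag_gt0 i pL).
  by rewrite [LHS](pos_complexE d0) !mxE eqxx mulr1n raddfB.
have diag0 i : 0 <= 1 - complex.Re (Y i i).
  by have := ltW (posdef_diag_gt0 i pL); rewrite diag lecE /= eqxx.
have : complex.Re (\det (1%:M - Y)) <= \prod_i (1 - complex.Re (Y i i)).
  rewrite -lecR -pos_complexE; last exact/ltW/posdef_det_gt0.
  by apply: le_trans hH _; rewrite rmorph_prod /=; under eq_bigr do rewrite diag.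
move=> /le_trans; apply.
rewrite /mxtrace raddf_sum -sumrN expR_sum; apply: ler_prod => i _.
by rewrite diag0 /=; exact: expR_ge1Dx.
Qed.

(** [M >= a] bounds the trace of [Y] from above, and [det_1B_ge] concludes. *)
Lemma toep_ratio_ge (a : R) : 0 < a -> psd (M - a%:C%C%:M) ->
  1 - seq_sqnorm s / a <= complex.Re (toep_ratio s k).
Proof.
move=> a0 ha; have a0C : 0 < a%:C%C :> C by rewrite ltcE /= eqxx.
have trY : complex.Re (\tr Y) <= seq_sqnorm s / a.
  have := psd_trace_conj_le F (psdB_inv_le pM a0C ha).
  rewrite mul_mx_scalar -scalemxAl linearZ /= tr_toep_row -fmorphV -rmorphM /=.
  by rewrite (pos_complexE (psd_trace_ge0 pY)) lecR mulrC.
apply: le_trans (_ : 1 - complex.Re (\tr Y) <= _); first by rewrite lerB.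
have := det_1B_ge pY (posdef_psd pL); rewrite -hE.
rewrite {1}(pos_complexE (psd_trace_ge0 pY)) -[X in X - _](rmorph1 (@real_complex R)).
rewrite -rmorphB /= (pos_complexE (_ : 0 <= toep_ratio s k)) ?lecR//.
exact/ltW/toep_ratio_gt0.
Qed.

(** Here [b] is the trace [k * p] of [M], a bound that holds for all moments at once: this gives the
    dominating Gaussian. *)
Lemma toep_weight_le m : (0 < k)%N ->
  toep_weight k m s <= expR (- (m%:R * (seq_sqnorm s / (k * p)%:R))).
Proof.
move=> k0; rewrite toep_weight_dom; last exact/toep_domP.
rewrite -mulrN expRM_natl lerXn2r ?nnegrE ?expR_ge0//.
  exact/ltW/Re_gt0/toep_ratio_gt0.
apply: toep_ratio_le; first by rewrite ltr0n muln_gt0 k0.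
by rewrite rmorph_nat -(toep_trace s); exact/psd_trace_bound/posdef_psd.
Qed.

End bounds.

(** The scaled matrix is the identity plus [t] times the Hermitian matrix [toep s N - 1%:M]. The
    room left by [c'] lets one constant serve for two sizes. *)
Lemma toep_perturb s N : exists2 c : R, 0 <= c & forall c' t : R, c <= c' -> 0 < t ->
  psd (toep [seq t%:C%C *: M | M <- s] N - (1 - t * c')%:C%C%:M) /\
  psd ((1 + t * c')%:C%C%:M - toep [seq t%:C%C *: M | M <- s] N).
Proof.
have hH : (toep s N - 1%:M) ^t* = toep s N - 1%:M.
  by rewrite adjmxB toep_herm adjmx1.
have [c c0 [h1 h2]] := hermitian_bounded hH.
exists (complex.Re c); first by rewrite -lecR -pos_complexE.
move=> c' t cc' t0; have t0C : 0 <= t%:C%C :> C by rewrite lecE /= eqxx ltW.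
have psdc : psd ((c'%:C%C - c)%:M : 'M[C]_N).
  rewrite -scalemx1; apply: psdZ; last exact/posdef_psd/posdef1.
  by rewrite subr_ge0 (pos_complexE c0) lecR.
rewrite toep_scale; last by rewrite realE t0C.
set t' := t%:C%C; set T := toep s N.
have e1 : t' *: T + (1 - t')%:M - (1 - t * c')%:C%C%:M =
    t' *: ((c'%:C%C - c)%:M + (c%:M + (T - 1%:M))).
  apply/matrixP => i j; rewrite !mxE rmorphB rmorphM rmorph1 /= -/t'.
  by case: (i == j); rewrite ?mulr0n ?mulr1n; ring.
have e2 : (1 + t * c')%:C%C%:M - (t' *: T + (1 - t')%:M) =
    t' *: ((c'%:C%C - c)%:M + (c%:M - (T - 1%:M))).
  apply/matrixP => i j; rewrite !mxE rmorphD rmorphM rmorph1 /= -/t'.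
  by case: (i == j); rewrite ?mulr0n ?mulr1n; ring.
have p1 := psdZ t0C (psdD psdc h2).
have p2 := psdZ t0C (psdD psdc h1).
split; first by move: p1; rewrite -/T -/t' -e1; exact.
by move: p2; rewrite -/T -/t' -e2; exact.
Qed.

(** [t n] is the scale and [m n] the exponent. The ratio is enclosed between [toep_ratio_ge] and
    [toep_ratio_le] with constants [1 - t n * c] and [1 + t n * c], both tending to 1. *)
Lemma toep_weight_cvg s (t : R^nat) (m : nat -> nat) :
  (forall n, 0 <= t n) -> (\forall n \near \oo, 0 < t n) -> t @ \oo --> 0 ->
  (fun n => (m n)%:R * t n ^+ 2) @ \oo --> (1 : R) ->
  toep_weight (size s) (m n) [seq (t n)%:C%C *: M | M <- s] @[n --> \oo] -->
  expR (- seq_sqnorm s).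
Proof.
move=> t0 tpos tcvg mcvg; set k := size s; set S := seq_sqnorm s.
have [c1 c10 h1] := toep_perturb s (p + k * p).
have [c2 c20 h2] := toep_perturb s (k * p).
pose c := c1 + c2.
have c1c : c1 <= c by rewrite lerDl.
have c2c : c2 <= c by rewrite lerDr.
(* The upper bound for the trace of [Y] at the scaled sequence; the ratio is at least [1 - x n]. *)
pose x n := t n ^+ 2 * S / (1 - t n * c).
have tc_cvg : (fun n => t n * c) @ \oo --> (0 : R).
  by rewrite -[0](mul0r c); apply: cvgM => //; exact: cvg_cst.
have B1_cvg : (fun n => 1 - t n * c) @ \oo --> (1 : R).
  by rewrite -[X in _ --> X]subr0; apply: cvgB => //; exact: cvg_cst.
have B2_cvg : (fun n => 1 + t n * c) @ \oo --> (1 : R).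
  by rewrite -[X in _ --> X]addr0; apply: cvgD => //; exact: cvg_cst.
have x_cvg : x @ \oo --> (0 : R).
  have -> : 0 = 0 ^+ 2 * S / 1 :> R by rewrite expr0n !mul0r.
  apply: cvgM; last by apply: cvgV; rewrite ?oner_eq0.
  apply: cvgM; last exact: cvg_cst.
  by rewrite expr2; under eq_fun do rewrite expr2; exact: cvgM.
have X1_cvg : (fun n => 1 - x n) @ \oo --> (1 : R).
  by rewrite -[X in _ --> X]subr0; apply: cvgB => //; exact: cvg_cst.
have D_cvg : (fun n => (1 - t n * c) * (1 - x n)) @ \oo --> (1 : R).
  by rewrite -[X in _ --> X]mul1r; exact: cvgM.
(* The lower envelope is [expR_le_1B] at [x n] raised to the power [m n], written so that the factor
   [m n * t n ^+ 2] appears. *)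
apply: (@squeeze_cvgr _ _ _ _
  (fun n => expR (- ((m n)%:R * t n ^+ 2 * (S / ((1 - t n * c) * (1 - x n))))))
  (fun n => expR (- ((m n)%:R * t n ^+ 2 * (S / (1 + t n * c)))))).
- near=> n.
  have tn : 0 < t n by near: n.
  have tc1 : 0 < 1 - t n * c by near: n; exact: (cvgr_gt _ B1_cvg).
  have tc2 : 0 < 1 + t n * c by near: n; exact: (cvgr_gt _ B2_cvg).
  have x1 : 0 < 1 - x n by near: n; exact: (cvgr_gt _ X1_cvg).
  set sn := [seq (t n)%:C%C *: M | M <- s].
  have ssn : size sn = k by rewrite size_map.
  have [a1 _] := h1 _ _ c1c tn; have [a2 b2] := h2 _ _ c2c tn.
  have pT : posdef (toep sn (p + size sn * p)).
    rewrite ssn -[toep _ _](subrK (1 - t n * c)%:C%C%:M) addrC.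
    apply: posdef_psdD => //; rewrite -scalemx1; apply: posdefZ; last exact: posdef1.
    by rewrite ltcE /= eqxx.
  rewrite -ssn toep_weight_dom; last exact/toep_domP.
  have Ssn : seq_sqnorm sn = t n ^+ 2 * S by rewrite seq_sqnormZ.
  have Rpos : 0 <= complex.Re (toep_ratio sn (size sn)) by exact/ltW/Re_gt0/toep_ratio_gt0.
  apply/andP; split.
    have -> : (m n)%:R * t n ^+ 2 * (S / ((1 - t n * c) * (1 - x n))) =
        (m n)%:R * (x n / (1 - x n)).
      by rewrite {2}/x invfM; ring.
    rewrite -mulrN expRM_natl lerXn2r ?nnegrE ?expR_ge0//.
    apply: le_trans (expR_le_1B _) _; first by rewrite -subr_gt0.
    by rewrite /x -Ssn; apply: toep_ratio_ge => //; rewrite ssn.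
  have -> : (m n)%:R * t n ^+ 2 * (S / (1 + t n * c)) =
      (m n)%:R * (t n ^+ 2 * S / (1 + t n * c)) by ring.
  rewrite -mulrN expRM_natl lerXn2r ?nnegrE ?expR_ge0//.
  by rewrite -Ssn; apply: toep_ratio_le => //; rewrite ssn.
- apply: continuous_cvg; first exact: continuous_expR.
  apply: cvgN; rewrite -[X in _ --> X]mul1r; apply: cvgM => //.
  rewrite -[X in _ --> X]mulr1; apply: cvgM; first exact: cvg_cst.
  by rewrite -[X in _ --> X]invr1; apply: cvgV; first exact: oner_neq0.
- apply: continuous_cvg; first exact: continuous_expR.
  apply: cvgN; rewrite -[X in _ --> X]mul1r; apply: cvgM => //.
  rewrite -[X in _ --> X]mulr1; apply: cvgM; first exact: cvg_cst.
  by rewrite -[X in _ --> X]invr1; apply: cvgV; first exact: oner_neq0.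
Unshelve. all: by end_near. Qed.

End toep_limit.

(** * Expectations as ratios of weighted integrals *)

Section weighted_expectation.
Context d (T : measurableType d) (R : realType) (lam : {measure set T -> \bar R}).
Variable w : T -> R.
Hypotheses (w0 : forall x, 0 <= w x) (iw : lam.-integrable setT (EFin \o w)).

Lemma integrable_bounded_weight (f : T -> R) M : measurable_fun setT f ->
  (forall x, `|f x| <= M) -> lam.-integrable setT (fun x => (f x * w x)%:E).
Proof.
move=> mf fM; have M0 : 0 <= M by exact: le_trans (fM point).
apply: (@le_integrable _ _ _ lam setT measurableT _ (fun x => (M * w x)%:E)).
- by apply/measurable_EFinP/measurable_funM => //; exact/measurable_EFinP/(measurable_int _ iw).
- by move=> x _; rewrite /= lee_fin !normrM ler_wpM2r// (ger0_norm M0).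
- by have := integrableZl measurableT M iw; apply: eq_integrable => // x _; rewrite EFinM.
Qed.

(** The same lemma applies to the laws of the projections and to the limit law. The constant [c] is
    eliminated by the test function 1, for which the left side is 1. *)
Lemma expectation_weight d' (Omega : measurableType d') (P : probability Omega R)
    (Y : Omega -> T) (c : \bar R) (f : T -> R) M :
  measurable_fun setT Y -> measurable_fun setT f -> (forall x, `|f x| <= M) ->
  (forall h : T -> \bar R, measurable_fun setT h -> (forall x, (0 <= h x)%E) ->
    (\int[P]_x h (Y x) = c * \int[lam]_x (h x * (w x)%:E))%E) ->
  (0 <= c)%E ->
  'E_P[f \o Y]%E =
    (fine (\int[lam]_x (f x * w x)%:E)%E / fine (\int[lam]_x (w x)%:E)%E)%:E.
Proof.
move=> mY mf fM hc c0; have M0 : 0 <= M by exact: le_trans (fM point).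
have iwf : (\int[lam]_x (w x)%:E)%E \is a fin_num by exact: integrable_fin_num.
set W := (\int[lam]_x (w x)%:E)%E in iwf *.
have W0 : (0 <= W)%E by apply: integral_ge0 => x _; rewrite lee_fin.
have cW : (c * W = 1)%E.
  rewrite -[RHS](@probability_setT _ _ _ P) -[RHS]mul1e -(integral_cst P measurableT).
  rewrite -[RHS]/(\int[P]_x (cst 1%E (Y x)))%E hc//.
  by congr (_ * _)%E; apply: eq_integral => x _; rewrite mul1e.
have iF := integrable_bounded_weight mf fM.
set I := (\int[lam]_x (f x * w x)%:E)%E.
have If : I \is a fin_num by exact: integrable_fin_num.
have ifY : P.-integrable setT (EFin \o (f \o Y)).
  apply: measurable_bounded_integrable => //.
  - exact: (le_lt_trans (probability_le1 _ measurableT) (ltry _)).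
  - exact: measurableT_comp.
  - by exists M; split; rewrite ?num_real// => x xM y _; apply: le_trans (fM _) (ltW _).
have Ef : 'E_P[f \o Y]%E = (\int[P]_x (f (Y x))%:E)%E by rewrite unlock.
have Eff : 'E_P[f \o Y]%E \is a fin_num by rewrite Ef; exact: integrable_fin_num.
(* The assumption concerns nonnegative functions, so it is applied to [f + M]; the contribution of
   [M] is subtracted afterwards. *)
have : ('E_P[f \o Y] + M%:E = c * (I + M%:E * W))%E.
  have -> : ('E_P[f \o Y] + M%:E = \int[P]_x (f (Y x) + M)%:E)%E.
    rewrite Ef; under [RHS]eq_integral do rewrite EFinD.
    rewrite integralD//; last exact: finite_measure_integrable_cst.
    congr (_ + _)%E; apply/esym/(etrans (integral_cst P measurableT _)).
    by apply: etrans (mule1 _); congr (_ * _)%E; exact: probability_setT.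
  rewrite (hc (fun x => (f x + M)%:E)); last first.
  - by move=> x; rewrite lee_fin -lerBlDr sub0r; have /ler_normlP[+ _] := fM x; rewrite lerNl.
  - by apply/measurable_EFinP/measurable_funD.
  congr (_ * _)%E; under eq_integral do rewrite -EFinM mulrDl EFinD.
  rewrite integralD//; last first.
    by have := integrableZl measurableT M iw; apply: eq_integrable => // x _; rewrite EFinM.
  by congr (_ + _)%E; rewrite -integralZl.
move: cW W0 iwf If Eff; rewrite -/I.
(* An infinite [c] contradicts [c * W = 1], as its product with a finite number is 0 or infinite. *)
case: c c0 {hc} => [c||]//; last first.
  move=> _ h W0 Wf; exfalso; move: h; rewrite -(fineK Wf) muleC mulr_infty.
  have [->|] := eqVneq (fine W) 0; first by rewrite sgr0 mul0e => -[] /eqP; rewrite eq_sym oner_eq0.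
  by rewrite neq_lt => /orP[h|h]; [rewrite ltr0_sg// EFinN mulN1e|rewrite gtr0_sg// mul1e].
case: W => // W c0 cW W0 _; case: I => // I _; case: 'E_P[_]%E => // E _.
case: cW => cWE [] /(congr1 (fun x => x - M)); rewrite addrK mulrDr mulrCA cWE mulr1 addrK => ->.
have W1 : W != 0 by apply/eqP => W0'; move/eqP: cWE; rewrite W0' mulr0 eq_sym oner_eq0.
by congr EFin => /=; rewrite mulrC; congr (_ * _); apply: (mulIf W1); rewrite cWE mulVf.
Qed.

End weighted_expectation.

Section projection.
Variables (R : realType) (q : nat).
Local Notation p := q.+1.
Local Notation C := R[i].
Local Notation Mat := 'M[C]_p.
Local Notation lam := (seq_matrix_lebesgue R p).
Local Open Scope ereal_scope.

Definition seq_row k (s : seq Mat) : 'rV[Mat]_k := \row_l nth 0%R s l.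

Lemma measurable_seq_row k n : measurable_fun setT (fun t : n.-tuple Mat => seq_row k t).
Proof.
apply: measurable_matrixP => i l.
have [ln|nl] := ltnP l n.
  rewrite (_ : (fun x => _) = @tnth _ _ ^~ (Ordinal ln)); first exact: measurable_tnth.
  by apply/funext => t; rewrite mxE (tnth_nth 0%R).
rewrite (_ : (fun x => _) = cst 0%R); first exact: measurable_cst.
by apply/funext => t; rewrite mxE nth_default// size_tuple.
Qed.

Lemma seq_row_seq k (G : 'rV[Mat]_k) : seq_row k (row_seq G) = G.
Proof. by apply/rowP => l; rewrite mxE nth_row_seq. Qed.

Lemma first_coords_seq k n (G : 'rV[Mat]_n) : (k <= n)%N ->
  first_coords k G = seq_row k (take k (row_seq G)).
Proof.
move=> kn; apply/rowP => l; rewrite !mxE nth_take//.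
have ln : (l < n)%N by exact: leq_trans kn.
by rewrite insubT -nth_row_seq.
Qed.

Lemma measurable_first_coords k n :
  measurable_fun setT (@first_coords R p k n : 'rV[Mat]_n -> 'rV[Mat]_k).
Proof.
apply: measurable_matrixP => i l.
have [ln|nl] := boolP (l < n)%N.
  rewrite (_ : (fun x => _) = fun G : 'rV[Mat]_n => G ord0 (Ordinal ln)).
    exact: measurable_entry.
  by apply/funext => G; rewrite mxE insubT.
rewrite (_ : (fun x => _) = cst 0%R); first exact: measurable_cst.
by apply/funext => G; rewrite mxE insubN.
Qed.

Definition scaled_weight k m (t : R) (G : 'rV[Mat]_k) : R :=
  toep_weight k m (row_seq (scale_coords t G)).

Lemma scaled_weight_ge0 k m t (G : 'rV[Mat]_k) : (0 <= scaled_weight m t G)%R.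
Proof. exact: toep_weight_ge0. Qed.

Lemma measurable_scaled_weight k m t : (0 < t)%R ->
  measurable_fun setT (@scaled_weight k m t).
Proof.
move=> t0; apply/measurable_EFinP.
exact: measurableT_comp (seq_measurable_row (@measurable_toep_weight R q k m))
  (scales_row q k t0).1.
Qed.

(** The volume, the masses of the balls and the Jacobian of the scaling all go into [c]; what
    remains is the weight with exponent [(n - k) * (2 * p)] at the shrunken moments. *)
Lemma integral_scaled_projection n k d (Omega : measurableType d) (P : probability Omega R)
    (X : {RV P >-> 'rV[Mat]_n}) (t : R) :
  (k <= n)%N -> (0 < t)%R -> uniform_on (lam n) (@moment_space R p n) X ->
  exists2 c : \bar R, 0 <= c & forall h : 'rV[Mat]_k -> \bar R,
    measurable_fun setT h -> (forall G, 0 <= h G) ->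
    \int[P]_w h (scale_coords t^-1 (first_coords k (X w))) =
    c * \int[lam k]_G (h G * (scaled_weight ((n - k) * (2 * p)) t G)%:E).
Proof.
move=> kn t0 hX; have [c1 c10 h1] := uniform_integral hX.
have [c2 c20 h2] := integral_toep_weight R q k (n - k).
have t10 : (0 < t^-1)%R by rewrite invr_gt0.
have [ms hs] := scales_row q k t0; have [msV _] := scales_row q k t10.
have scaleK (G : 'rV[Mat]_k) : scale_coords t^-1 (scale_coords t G) = G.
  by apply/rowP => l; rewrite !mxE scalerA -rmorphM /= mulVf ?gt_eqF// scale1r.
exists (c1%:E * (c2 * (t ^+ (2 * p * p * k))%:E)).
  by rewrite !mule_ge0// lee_fin; [exact: ltW|exact/exprn_ge0/ltW].
move=> h mh h0.
have mhV : measurable_fun setT (fun G : 'rV[Mat]_k => h (scale_coords t^-1 G)).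
  exact: measurableT_comp.
pose F s := h (scale_coords t^-1 (seq_row k s)).
have mF : seq_measurable F.
  by move=> j; exact: measurableT_comp mhV (@measurable_seq_row k j).
have F0 s : 0 <= F s by exact: h0.
have Ftake s : F (take k s) = F s.
  by congr (h (scale_coords _ _)); apply/rowP => l; rewrite !mxE nth_take.
rewrite (h1 (fun G => h (scale_coords t^-1 (first_coords k G)))) => [|//|//]; last first.
  by apply: measurableT_comp mhV _; exact: measurable_first_coords.
rewrite -!muleA; congr (_ * _).
under eq_integral do rewrite first_coords_seq// -/(F _).
rewrite (@integral_row R q n (fun s => F (take k s) * (toep_weight n 0 s)%:E)); last 2 first.
- move=> j; apply: emeasurable_funM; last exact: measurable_toep_weight.
  by under eq_fun do rewrite Ftake; exact: mF.
- by move=> s; rewrite mule_ge0// lee_fin toep_weight_ge0.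
rewrite -[in LHS](subnKC kn) h2//; congr (_ * _).
have mFw : seq_measurable (fun s => F s * (toep_weight k ((n - k) * (2 * p)) s)%:E).
  by move=> j; apply: emeasurable_funM; [exact: mF|exact: measurable_toep_weight].
have Fw0 s : 0 <= F s * (toep_weight k ((n - k) * (2 * p)) s)%:E.
  by rewrite mule_ge0// lee_fin toep_weight_ge0.
rewrite -(@integral_row R q k (fun s => F s * (toep_weight k ((n - k) * (2 * p)) s)%:E))//.
have hFw := hs _ (seq_measurable_row mFw) (fun G => Fw0 (row_seq G)).
refine (etrans hFw _); clear hFw.
by congr (_ * _); apply: eq_integral => G _; rewrite /F seq_row_seq scaleK.
Qed.

End projection.

Section gaussian_limit.
Variables (R : realType) (q k : nat).
Hypothesis k0 : (0 < k)%N.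
Local Notation p := q.+1.
Local Notation C := R[i].
Local Notation Mat := 'M[C]_p.
Local Notation Row := 'rV[Mat]_k.
Local Notation lam := (seq_matrix_lebesgue R p k).

Lemma seq_sqnorm_row (G : Row) : seq_sqnorm (row_seq G) = row_sqnorm G.
Proof.
rewrite /seq_sqnorm (_ : \sum_(l < _) _ = \sum_(l < k) sqnorm (row_seq G)`_l).
  by apply: eq_bigr => l _; rewrite nth_row_seq.
by rewrite size_row_seq.
Qed.

Lemma scaled_weight_cvg (t : R^nat) (m : nat -> nat) (G : Row) :
  (forall n, 0 <= t n) -> (\forall n \near \oo, 0 < t n) -> t @ \oo --> 0 ->
  (fun n => (m n)%:R * t n ^+ 2) @ \oo --> (1 : R) ->
  scaled_weight (m n) (t n) G @[n --> \oo] --> row_gauss G.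
Proof.
move=> t0 tpos tcvg mcvg; rewrite /row_gauss -seq_sqnorm_row.
rewrite (_ : (fun n => _) = fun n =>
    toep_weight (size (row_seq G)) (m n) [seq (t n)%:C%C *: M | M <- row_seq G]).
  exact: toep_weight_cvg.
by apply/funext => n; rewrite /scaled_weight scale_row_seq [in RHS]size_row_seq.
Qed.

(** A lower bound on the exponent times the squared scale suffices for a Gaussian bound that does
    not change with [n]. *)
Lemma scaled_weight_le m (t a : R) (G : Row) : a * (k * p)%:R <= m%:R * t ^+ 2 ->
  scaled_weight m t G <= expR (- (a * row_sqnorm G)).
Proof.
move=> am; rewrite /scaled_weight.
have [/toep_domP pT|nd] := boolP (toep_dom k (row_seq (scale_coords t G))); last first.
  by rewrite toep_weight_ndom// expR_ge0.
set s := row_seq _ in pT *; have ss : size s = k by rewrite size_row_seq.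
rewrite -[X in (X * p)%N]ss in pT.
have := toep_weight_le pT m; rewrite ss => /(_ k0)/le_trans; apply.
rewrite ler_expR lerN2 seq_sqnorm_row row_sqnormZ.
have kp : 0 < (k * p)%:R :> R by rewrite ltr0n muln_gt0 k0.
have -> : m%:R * (t ^+ 2 * row_sqnorm G / (k * p)%:R) =
    m%:R * t ^+ 2 / (k * p)%:R * row_sqnorm G by ring.
by rewrite ler_wpM2r ?row_sqnorm_ge0// ler_pdivlMr.
Qed.

(** Supplied in the end by the total mass 1 of the law of the [G l]. *)
Hypothesis gauss_fin : (\int[lam]_G (row_gauss G)%:E < +oo)%E.

(** Dilation by the square root of [a^-1] reduces to the case [a = 1]. *)
Lemma integrable_gauss (a : R) : 0 < a ->
  lam.-integrable setT (fun G : Row => (expR (- (a * row_sqnorm G)))%:E).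
Proof.
move=> a0.
have mg : measurable_fun setT (fun G : Row => (expR (- (a * row_sqnorm G)))%:E).
  apply/measurable_EFinP; apply: measurableT_comp => //.
  by apply: measurableT_comp => //; apply: measurable_funM => //; exact: measurable_row_sqnorm.
have g0 (G : Row) : (0 <= (expR (- (a * row_sqnorm G)))%:E)%E by rewrite lee_fin expR_ge0.
apply/integrableP; split=> //.
under eq_integral do rewrite gee0_abs//.
pose c := Num.sqrt a^-1; have c0 : 0 < c by rewrite sqrtr_gt0 invr_gt0.
have [_ hs] := scales_row q k c0.
have hg := hs _ mg g0.
have -> : (\int[lam]_G (expR (- (a * row_sqnorm G)))%:E)%E =
    ((c ^+ (2 * p * p * k))%:E * \int[lam]_G (row_gauss G)%:E)%E.
  refine (etrans hg _); congr (_ * _)%E; apply: eq_integral => G _.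
  by rewrite row_sqnormZ sqr_sqrtr ?invr_ge0 ?(ltW a0)// mulVKf ?gt_eqF.
by rewrite lte_mul_pinfty// lee_fin exprn_ge0// ltW.
Qed.

(** Dominated convergence after a shift by [N], because the Gaussian bound is available from some
    rank on. *)
Lemma integral_weight_cvg (t : R^nat) (m : nat -> nat) (f : Row -> R) M a N :
  measurable_fun setT f -> (forall G, `|f G| <= M) ->
  (forall n, 0 <= t n) -> (\forall n \near \oo, 0 < t n) -> t @ \oo --> 0 ->
  (fun n => (m n)%:R * t n ^+ 2) @ \oo --> (1 : R) ->
  0 < a -> (forall n, 0 < t (n + N)%N) ->
  (forall n, a * (k * p)%:R <= (m (n + N)%N)%:R * t (n + N)%N ^+ 2) ->
  (\int[lam]_G (f G * scaled_weight (m n) (t n) G)%:E)%E @[n --> \oo] -->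
  (\int[lam]_G (f G * row_gauss G)%:E)%E.
Proof.
move=> mf fM t0 tpos tcvg mcvg a0 tN mN.
rewrite -(cvg_shiftn N).
have ig := integrable_gauss a0.
pose w n G := (f G * scaled_weight (m (n + N)%N) (t (n + N)%N) G)%:E.
have mw n : measurable_fun setT (w n).
  by apply/measurable_EFinP/measurable_funM => //; exact: measurable_scaled_weight.
have ml : measurable_fun setT (fun G => (f G * row_gauss G)%:E).
  by apply/measurable_EFinP/measurable_funM => //; exact: measurable_row_gauss.
have wl : {ae lam, forall G, setT G -> w n G @[n --> \oo] --> (f G * row_gauss G)%:E}.
  apply: aeW => G _; apply: cvg_EFin; first exact: nearW.
  apply: cvgM; first exact: cvg_cst.
  exact: (cvg_comp _ _ (cvg_addnr N) (scaled_weight_cvg (G := G) t0 tpos tcvg mcvg)).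
have ib : lam.-integrable setT (fun G => (M * expR (- (a * row_sqnorm G)))%:E).
  by have := integrableZl measurableT M ig; apply: eq_integrable => // x _; rewrite EFinM.
have wb : {ae lam, forall G n, setT G ->
    (`|w n G| <= (M * expR (- (a * row_sqnorm G)))%:E)%E}.
  apply: aeW => G n _; rewrite lee_fin normrM ler_pM//.
  by rewrite ger0_norm ?scaled_weight_ge0//; exact: scaled_weight_le.
by have [_ _] := dominated_convergence measurableT mw ml wl ib wb.
Qed.

End gaussian_limit.

Section scaling_sequence.
Variables (R : realType) (q k : nat).
Local Notation p := q.+1.

Definition proj_scale n : R := (Num.sqrt (2 * p * n)%:R)^-1.

Definition proj_exponent n := ((n - k) * (2 * p))%N.

Lemma invn_cvg0 : (fun n : nat => n%:R^-1 : R) @ \oo --> 0.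
Proof. by rewrite -cvg_shiftS; exact: cvg_harmonic. Qed.

Lemma proj_scale_ge0 n : 0 <= proj_scale n.
Proof. by rewrite invr_ge0 sqrtr_ge0. Qed.

Lemma proj_scale_gt0 n : (0 < n)%N -> 0 < proj_scale n.
Proof. by move=> n0; rewrite invr_gt0 sqrtr_gt0 ltr0n muln_gt0. Qed.

Lemma proj_scale_cvg : proj_scale @ \oo --> 0.
Proof.
have -> : proj_scale = fun n => Num.sqrt ((2 * p)%:R^-1 * n%:R^-1).
  by apply/funext => n; rewrite /proj_scale -invfM -natrM sqrtrV.
rewrite -[X in _ --> X]sqrtr0; apply: continuous_cvg; first exact: sqrt_continuous.
rewrite -[X in _ --> X](mulr0 (2 * p)%:R^-1); apply: cvgM; first exact: cvg_cst.
exact: invn_cvg0.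
Qed.

(** This product is what fixes the rate: [2 * p] real powers per integrated coordinate, for [n - k]
    coordinates, against the squared scale. *)
Lemma proj_exponent_scale n : (k <= n)%N -> (0 < n)%N ->
  (proj_exponent n)%:R * proj_scale n ^+ 2 = 1 - k%:R / n%:R.
Proof.
move=> kn n0; rewrite /proj_exponent /proj_scale exprVn sqr_sqrtr// natrM natrB//.
rewrite natrM; field.
by rewrite nat1r !pnatr_eq0 -lt0n n0.
Qed.

Lemma proj_exponent_cvg :
  (fun n => (proj_exponent n)%:R * proj_scale n ^+ 2) @ \oo --> (1 : R).
Proof.
have h : (fun n : nat => 1 - k%:R / n%:R : R) @ \oo --> (1 : R).
  rewrite -[X in _ --> X]subr0; apply: cvgB; first exact: cvg_cst.
  rewrite -[X in _ --> X](mulr0 k%:R); apply: cvgM; first exact: cvg_cst.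
  exact: invn_cvg0.
apply: cvg_trans h; apply: near_eq_cvg; near=> n.
rewrite proj_exponent_scale//; near: n; [exact: nbhs_infty_ge|exact: nbhs_infty_gt].
Unshelve. all: by end_near. Qed.

(** From [n >= 2 * k] on, [1 - k / n] is at least one half; the constant [(2 * (k * p))^-1] is this
    half divided by the trace bound [k * p]. *)
Lemma proj_exponent_ge n : (0 < k)%N -> (2 * k <= n)%N ->
  (2 * (k * p))%:R^-1 * (k * p)%:R <= (proj_exponent n)%:R * proj_scale n ^+ 2.
Proof.
move=> k0 kn; rewrite proj_exponent_scale; last 2 first.
- by apply: leq_trans kn; rewrite leq_pmull.
- by apply: leq_trans kn; rewrite muln_gt0.
have kp : (k * p)%:R != 0 :> R by rewrite pnatr_eq0 muln_eq0 negb_or -lt0n k0.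
have n0 : 0 < n%:R :> R by rewrite ltr0n; apply: leq_trans kn; rewrite muln_gt0.
rewrite natrM invfM mulfVK// lerBrDr -lerBrDl ler_pdivrMr//.
have : (2 * k)%:R <= n%:R :> R by rewrite ler_nat.
by rewrite natrM; lra.
Qed.

End scaling_sequence.

Theorem corollary3p7 (R : realType) (p : nat) (hp : (1 <= p)%N)
  (k : nat) (hk : (1 <= k)%N)
  (d : nat -> measure_display) (Omega : forall n, measurableType (d n))
  (P : forall n, probability (Omega n) R)
  (X : forall n, {RV (P n) >-> 'rV['M[R[i]]_p]_n})
  (hX : forall n, uniform_on (seq_matrix_lebesgue R p n) (@moment_space R p n) (X n))
  (d' : measure_display) (Omega' : measurableType d') (Q : probability Omega' R)
  (G : 'I_k -> {RV Q >-> 'M[R[i]]_p})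
  (hGind : mutually_independent G)
  (hGdens : forall l, has_density (matrix_lebesgue R p) (@ginibre_pdf R p) (G l)) :
  cvg_in_distribution P
    (fun n w => scale_coords (Num.sqrt (2 * p * n)%:R) (first_coords k (X n w)))
    Q (fun w => \row_(l < k) G l w).
Proof.
(* Toeplitz indices are taken modulo the block size, which is written as a successor. *)
destruct p as [|q]; first by [].
move=> f cf [M fM]; have mf := measurable_continuous_row cf.
set lam := seq_matrix_lebesgue R q.+1 k.
have c0 : (0 < (ginibre_const R q.+1 ^+ k)%:E)%E by rewrite lte_fin exprn_gt0 ?ginibre_const_gt0.
have hQ := integral_row_of hk hGind hGdens.
set W := (\int[lam]_M (row_gauss M)%:E)%E.
(* The test function 1 evaluates the Gaussian integral: it is finite and nonzero because [Q] has
   mass 1. *)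
have cW : ((ginibre_const R q.+1 ^+ k)%:E * W = 1)%E.
  have h1 := hQ (cst 1%E) (measurable_cst _) (fun=> lee01).
  rewrite -[RHS](@probability_setT _ _ _ Q) -[RHS]mul1e -(integral_cst Q measurableT).
  apply: etrans (esym h1); congr (_ * _)%E.
  by apply: eq_integral => N _; rewrite mul1e.
have W0 : (0 <= W)%E by apply: integral_ge0 => N _; rewrite lee_fin expR_ge0.
have Wy : (W < +oo)%E.
  rewrite ltey; apply/eqP => Wy; move: cW; rewrite Wy muleC gt0_mulye//.
have Wf : W \is a fin_num by rewrite ge0_fin_numE.
have W1 : fine W != 0.
  apply/eqP => W1; move: cW; rewrite -(fineK Wf) W1 mule0 => -[] /eqP.
  by rewrite eq_sym oner_eq0.
have iW : lam.-integrable setT (EFin \o @row_gauss R q.+1 k).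
  have := integrable_gauss Wy ltr01.
  by apply: eq_integrable => // N _; rewrite /= mul1r.
have mY : measurable_fun setT (fun w => \row_(l < k) G l w).
  apply: measurable_matrixP => i l.
  by under eq_fun do rewrite mxE; exact: measurable_funPT.
(* The limit becomes a ratio of Gaussian integrals. Numerator and denominator of the ratios for
   finite [n] then converge by [IE], applied to [f] and to the constant 1. *)
have -> := @expectation_weight _ _ _ lam (@row_gauss R q.+1 k) (fun N => expR_ge0 _) iW
  _ _ _ _ _ _ _ mY mf fM hQ (ltW c0).
pose t := @proj_scale R q; pose m := @proj_exponent q k.
pose I (g : 'rV['M[R[i]]_q.+1]_k -> R) n :=
  (\int[lam]_N (g N * scaled_weight (m n) (t n) N)%:E)%E.
have a0 : 0 < (2 * (k * q.+1))%:R^-1 :> R by rewrite invr_gt0 ltr0n !muln_gt0 hk.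
have IE (g : 'rV['M[R[i]]_q.+1]_k -> R) (K : R) :
    measurable_fun setT g -> (forall N, `|g N| <= K) ->
    I g @ \oo --> (\int[lam]_N (g N * row_gauss N)%:E)%E.
  move=> mg gK; apply: (@integral_weight_cvg R q k hk Wy t m g K
    (2 * (k * q.+1))%:R^-1 (2 * k)) => //.
  - exact: proj_scale_ge0.
  - by near=> n; apply: proj_scale_gt0; near: n; exact: nbhs_infty_gt.
  - exact: proj_scale_cvg.
  - exact: proj_exponent_cvg.
  - by move=> n; apply: proj_scale_gt0; rewrite addn_gt0 muln_gt0 hk orbT.
  - by move=> n; apply: proj_exponent_ge => //; exact: leq_addl.
have If := IE f M mf fM.
have I1 : I (cst 1) @ \oo --> W.
  have /= := IE (cst 1) 1 (measurable_cst _) (fun=> _).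
  rewrite (_ : (\int[lam]_N _)%E = W).
    by apply; rewrite normr1.
  by apply: eq_integral => N _; rewrite mul1r.
have Iff : (\int[lam]_N (f N * row_gauss N)%:E)%E \is a fin_num.
  by apply: integrable_fin_num => //; exact: integrable_bounded_weight fM.
have : (fun n => (fine (I f n) / fine (I (cst 1) n))%:E) @ \oo -->
    (fine (\int[lam]_N (f N * row_gauss N)%:E)%E / fine W)%:E.
  apply: cvg_EFin; first exact: nearW.
  apply: cvgM; first by apply: fine_cvg; rewrite fineK.
  by apply: cvgV => //; apply: fine_cvg; rewrite fineK.
apply: cvg_trans; apply: near_eq_cvg; near=> n.
(* From this rank on the projection keeps genuine coordinates and the weight is integrable, so the
   expectation is the ratio of the two integrals. *)
have kn : (2 * k <= n)%N by near: n; exact: nbhs_infty_ge.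
have kn' : (k <= n)%N by apply: leq_trans kn; rewrite leq_pmull.
have tn : 0 < t n.
  by apply: proj_scale_gt0; apply: leq_trans kn; rewrite muln_gt0 hk.
have [c cn0 hc] := @integral_scaled_projection R q n k _ _ _ (X n) (t n) kn' tn (hX n).
have iw : lam.-integrable setT (EFin \o @scaled_weight R q k (m n) (t n)).
  apply: (le_integrable measurableT) (integrable_gauss Wy a0).
    by apply/measurable_EFinP; exact: measurable_scaled_weight.
  move=> N _; rewrite lee_fin !ger0_norm ?expR_ge0 ?scaled_weight_ge0//.
  by apply: scaled_weight_le => //; exact: proj_exponent_ge.
have mYn : measurable_fun setT (fun w =>
    scale_coords (t n)^-1 (first_coords k (X n w)) : 'rV['M[R[i]]_q.+1]_k).
  apply: measurableT_comp; first by apply: (scales_row q k _).1; rewrite invr_gt0.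
  by apply: measurableT_comp; [exact: measurable_first_coords|exact: measurable_funPT].
have := expectation_weight (@scaled_weight_ge0 R q k (m n) (t n)) iw mYn mf fM hc cn0.
rewrite /t /proj_scale invrK => ->; rewrite /I; congr (_ / fine _)%:E.
by apply: eq_integral => N _; rewrite mul1r.
Unshelve. all: by end_near. Qed.
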